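(* Let $\gamma\in H$ be given, and let $\mu\in H$ be a solution of \[ \mu-\mathbf N\mu=-\mathbf M\gamma . \] Define \[ \Phi(z):=\frac{1}{2\pi i}\int_\Gamma\frac{\gamma+i\mu}{A}\,\frac{d\eta}{\eta-z},\qquad z\notin\Gamma, \] and let $f:=\Phi$ in $G$. Then the boundary values of $f$ from $G$ satisfy \[ Af^+=\gamma+h+i\mu,\qquad\text{where}\qquad h=\tfrac12\bigl[\mathbf M\mu-(\mathbf I-\mathbf N)\gamma\bigr]\in S^- . \]
   Context: $G$ is an unbounded multiply connected region of connectivity $m$ with $\infty\in G$ and $0\in G$. Its boundary is $\Gamma=\Gamma_1\cup\dots\cup\Gamma_m$, consisting of simple, non-intersecting, smooth, clockwise oriented closed curves, so that $G$ lies to the left of $\Gamma$. $G^-:=(\mathbb C\cup\{\infty\})\setminus(G\cup\Gamma)$ is the union of the bounded simply connected regions $G_k$ enclosed by $\Gamma_k$. Each $\Gamma_k$ is parametrized by a $2\pi$-periodic, twice continuously differentiable function $\eta_k$ with $\dot\eta_k\ne0$. $J$ is the disjoint union of $J_k=[0,2\pi]$, and $\eta=\eta_k$ on $J_k$. $H$ is the space of real functions on $J$ that are Hölder continuous and $2\pi$-periodic on each $J_k$. Functions on $\Gamma$ are identified with functions on $J$ via $\eta$. $A$ is a nonvanishing complex function on $\Gamma$ with continuously differentiable parametric form $A(t)$, $t\in J$. The real kernels are given by \[ M(s,t)+iN(s,t):=\frac1\pi\frac{A(s)}{A(t)}\frac{\dot\eta(t)}{\eta(t)-\eta(s)} . \]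 The operators are $\mathbf N\mu(s)=\int_J N(s,t)\mu(t)\,dt$ and $\mathbf M\mu(s)=\int_J M(s,t)\mu(t)\,dt$ (principal value). $\mathbf I$ is the identity. $S^-:=\{\gamma\in H:\ \gamma=Ag^- \text{ for some } g \text{ analytic in } G^-\}$, where $g^-$ is the boundary value of $g$ from $G^-$. That is, $S^-$ consists of the real functions of the form $Ag^-$. *)

(* Defs.v *)
From Stdlib Require Import Reals ClassicalEpsilon.
From Coquelicot Require Import Coquelicot.

Local Open Scope R_scope.

Fixpoint sumC (m : nat) (f : nat -> C) : C :=
  match m with
  | O => RtoC 0
  | S n => Cplus (sumC n f) (f n)
  end.

Fixpoint sumR (m : nat) (f : nat -> R) : R :=
  match m with
  | O => 0
  | S n => sumR n f + f n
  end.

Definition derC (f : R -> C) (t : R) (l : C) : Prop :=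
  @is_derive R_AbsRing C_R_NormedModule f t l.

Definition RIntC (f : R -> C) (a b : R) : C :=
  @RInt C_R_CompleteNormedModule f a b.

Definition periodic2pi {T : Type} (f : R -> T) : Prop :=
  forall t, f (t + 2 * PI) = f t.

Definition Holder_on_J (u : R -> R) : Prop :=
  exists alpha K : R, 0 < alpha <= 1 /\ 0 <= K /\
    forall s t, 0 <= s <= 2 * PI -> 0 <= t <= 2 * PI ->
      Rabs (u s - u t) <= K * Rpower (Rabs (s - t)) alpha.

(* The space H: real functions on J, Hoelder continuous and 2pi-periodic on each J_k.
   A function on J is represented as u : nat -> R -> R, u k being its restriction to J_k. *)
Definition inH (m : nat) (u : nat -> R -> R) : Prop :=
  forall k, (k < m)%nat -> Holder_on_J (u k) /\ periodic2pi (u k).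

(* Principal value  PV int_J_k F(t) dt  for a kernel with a possible singularity at t = s:
   lim_{eps -> 0+} int_{s+eps}^{s+2pi-eps} F(t) dt  (for 2pi-periodic F).
   The value is the (unique) limit, chosen by Hilbert's epsilon. *)
Definition PVint (F : R -> R) (s : R) : R :=
  epsilon (inhabits 0) (fun l =>
    filterlim (fun e => RInt F (s + e) (s + 2 * PI - e)) (at_right 0) (locally l)).

Definition kernelMN (A eta eta' : nat -> R -> C) (j : nat) (s : R) (k : nat) (t : R) : C :=
  Cmult (RtoC (/ PI))
    (Cmult (Cdiv (A j s) (A k t)) (Cdiv (eta' k t) (Cminus (eta k t) (eta j s)))).

Definition Mker A eta eta' j s k t : R := fst (kernelMN A eta eta' j s k t).
Definition Nker A eta eta' j s k t : R := snd (kernelMN A eta eta' j s k t).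

Definition Mop (m : nat) (A eta eta' : nat -> R -> C) (mu : nat -> R -> R) (j : nat) (s : R) : R :=
  sumR m (fun k => PVint (fun t => Mker A eta eta' j s k t * mu k t) s).
Definition Nop (m : nat) (A eta eta' : nat -> R -> C) (mu : nat -> R -> R) (j : nat) (s : R) : R :=
  sumR m (fun k => PVint (fun t => Nker A eta eta' j s k t * mu k t) s).

Definition onGamma (m : nat) (eta : nat -> R -> C) (z : C) : Prop :=
  exists k t, (k < m)%nat /\ z = eta k t.

Definition wind (eta eta' : nat -> R -> C) (k : nat) (z : C) : C :=
  Cmult (Cinv (Cmult (RtoC (2 * PI)) Ci))
    (RIntC (fun t => Cdiv (eta' k t) (Cminus (eta k t) z)) 0 (2 * PI)).

(* The region G: points off Gamma around which no boundary curve winds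
   (the unbounded component of the complement of Gamma, the curves being
   non-nested Jordan curves). *)
Definition regionG (m : nat) (eta eta' : nat -> R -> C) (z : C) : Prop :=
  ~ onGamma m eta z /\ forall k, (k < m)%nat -> wind eta eta' k z = RtoC 0.

Definition regionGm (m : nat) (eta eta' : nat -> R -> C) (z : C) : Prop :=
  ~ onGamma m eta z /\ ~ regionG m eta eta' z.

Definition analytic_on (D : C -> Prop) (g : C -> C) : Prop :=
  forall z, D z -> ex_derive (K := C_AbsRing) (V := C_NormedModule) g z.

Definition inSminus (m : nat) (A eta eta' : nat -> R -> C) (h : nat -> R -> R) : Prop :=
  inH m h /\
  exists g : C -> C, analytic_on (regionGm m eta eta') g /\
    forall j s, (j < m)%nat -> 0 <= s <= 2 * PI ->
      exists gm : C,
        filterlim g (within (regionGm m eta eta') (locally (eta j s))) (locally gm) /\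
        RtoC (h j s) = Cmult (A j s) gm.

Definition Phi (m : nat) (A eta eta' : nat -> R -> C) (gam mu : nat -> R -> R) (z : C) : C :=
  Cmult (Cinv (Cmult (RtoC (2 * PI)) Ci))
    (sumC m (fun k => RIntC (fun t =>
        Cmult (Cdiv (Cplus (RtoC (gam k t)) (Cmult Ci (RtoC (mu k t)))) (A k t))
              (Cdiv (eta' k t) (Cminus (eta k t) z))) 0 (2 * PI))).

(* Main.v *)
Require Import Defs.
From Stdlib Require Import Reals ClassicalEpsilon.
From Coquelicot Require Import Coquelicot.
From Stdlib Require Import FunctionalExtensionality PropExtensionality ZArith Lra Lia.

Local Open Scope R_scope.

(** Let [phi = (gam + i mu) / A], which is Hoelder continuous on each curve, and let [Phi] be its
    Cauchy integral.  By the Sokhotski-Plemelj formula [Phi] has boundary values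
    [(PV +- i PI phi(s)) / (2 PI i)] from [G] and from [G^-], where [PV] is the principal value of
    the Cauchy integral at [eta(s)].  Multiplying by [A] turns [PV] into the operators [M] and [N],
    and the integral equation identifies the results as [gam + h + i mu] and [h]; hence
    [h = A Phi^-] with [Phi] analytic in [G^-].

    The Plemelj formula is obtained from the regularized integral [P(s)] of
    [(phi(t) - phi(s)) eta'(t) / (eta(t) - eta(s))], by comparing kernels near [t = s].  The Jordan
    curve theorem is replaced by the fact that the winding integral only takes the values [0] and
    [- 2 PI i]: comparing its values on both sides of the curve with the model kernel
    [1 / (tau - i d)] forces the principal value of [eta' / (eta - eta(s))] to be [- i PI]. *)

(** * Complex-valued integrals *)

(** The boundary values are limits through all of the region, tangential approach included, and [h]
    must itself be shown to be Hoelder continuous. One estimate, uniform in the boundary point,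
    serves both purposes: with [W(z)] the integral of the bare kernel [eta' / (eta - z)], the Cauchy
    integral minus [phi(s) W(z)] minus [P(s)] is at most a constant times [d^(al/2)], provided that
    [z] is within order [d] of [eta(s)] and separated from the curve in proportion to [d]. The side
    of the curve enters through [W(z)] alone. Two base points with a common [z] give the Hoelder
    continuity of [P], and this in turn settles the tangential case.

    Half of the exponent [al] is given up on purpose: one half keeps the integrand integrable, the
    other half remains as the rate in [d]. The passages to the limit under an integral are all
    quantitative in this way: the integrand is bounded by a power of the small parameter times an
    integrable power of [pdist], and one lemma, whose constant depends only on the exponent,
    integrates such bounds. *)

Definition isI (f : R -> C) (a b : R) (l : C) : Prop :=
  @is_RInt C_R_NormedModule f a b l.

Lemma filterlim_Cmod {T : Type} (F : (T -> Prop) -> Prop) {FF : Filter F} (f : T -> C) (l : C) :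
  filterlim f F (locally l) <-> forall eps : posreal, F (fun x => Cmod (f x - l)%C < eps).
Proof.
exact (@filterlim_locally_ball_norm C_AbsRing T C_NormedModule F FF f l).
Qed.

Lemma norm_Cmod (z : C) : @norm R_AbsRing C_R_NormedModule z = Cmod z.
Proof. symmetry. exact (Cmod_norm z). Qed.

Lemma Rabs_fst_Cmod (z : C) : Rabs (fst z) <= Cmod z.
Proof. eapply Rle_trans; [apply Rmax_l | apply (Rmax_Cmod z)]. Qed.

Lemma Rabs_snd_Cmod (z : C) : Rabs (snd z) <= Cmod z.
Proof. eapply Rle_trans; [apply Rmax_r | apply (Rmax_Cmod z)]. Qed.

Lemma Cmod_le_abs (z : C) : Cmod z <= Rabs (fst z) + Rabs (snd z).
Proof.
unfold Cmod.
rewrite <- (sqrt_Rsqr (Rabs (fst z) + Rabs (snd z))).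
- apply sqrt_le_1_alt. unfold Rsqr.
  rewrite <- (pow2_abs (fst z)), <- (pow2_abs (snd z)).
  pose proof (Rabs_pos (fst z)); pose proof (Rabs_pos (snd z)); nra.
- pose proof (Rabs_pos (fst z)); pose proof (Rabs_pos (snd z)); lra.
Qed.

Lemma filterlim_C_components {T : Type} (F : (T -> Prop) -> Prop) {FF : Filter F} (f : T -> C) (l : C) :
  filterlim f F (locally l) <->
  filterlim (fun x => fst (f x)) F (locally (fst l)) /\
  filterlim (fun x => snd (f x)) F (locally (snd l)).
Proof.
split.
- intros H. destruct l as [l1 l2].
  split; (eapply filterlim_comp; [exact H|]).
  + exact (@continuous_fst R_UniformSpace R_UniformSpace l1 l2).
  + exact (@continuous_snd R_UniformSpace R_UniformSpace l1 l2).
- intros [H1 H2]. apply filterlim_Cmod; auto. intros eps.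
  assert (He : 0 < eps / 2) by (pose proof (cond_pos eps); lra).
  generalize (filter_and _ _ (proj1 (filterlim_locally _ _) H1 (mkposreal _ He))
                (proj1 (filterlim_locally _ _) H2 (mkposreal _ He))).
  apply filter_imp. intros x [A B].
  change (Rabs (fst (f x) - fst l) < eps / 2) in A.
  change (Rabs (snd (f x) - snd l) < eps / 2) in B.
  eapply Rle_lt_trans; [apply Cmod_le_abs|]. unfold Cminus, Cplus, Copp; simpl.
  unfold Rminus in A, B. lra.
Qed.

(** * Limits of complex-valued functions along a filter *)

Section FilterlimC.
Context {T : Type} (F : (T -> Prop) -> Prop) {FF : Filter F}.

Lemma filterlim_Cplus (f g : T -> C) (a b : C) :
  filterlim f F (locally a) -> filterlim g F (locally b) ->
  filterlim (fun x => (f x + g x)%C) F (locally (a + b)%C).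
Proof.
intros Hf Hg.
exact (filterlim_comp_2 _ _ Cplus Hf Hg (@filterlim_plus R_AbsRing C_R_NormedModule a b)).
Qed.

Lemma filterlim_Cmult (f g : T -> C) (a b : C) :
  filterlim f F (locally a) -> filterlim g F (locally b) ->
  filterlim (fun x => (f x * g x)%C) F (locally (a * b)%C).
Proof.
intros Hf Hg.
apply filterlim_C_components in Hf; [|exact FF]. apply filterlim_C_components in Hg; [|exact FF].
destruct Hf as [Hf1 Hf2], Hg as [Hg1 Hg2].
apply filterlim_C_components; [exact FF|]. simpl. split.
- refine (filterlim_comp_2 _ _ Rplus (filterlim_comp_2 _ _ Rmult Hf1 Hg1 (@filterlim_mult R_AbsRing _ _))
    (filterlim_comp _ _ _ _ _ _ _ _ (filterlim_comp_2 _ _ Rmult Hf2 Hg2 (@filterlim_mult R_AbsRing _ _)) (@filterlim_opp R_AbsRing R_NormedModule _))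
    (@filterlim_plus R_AbsRing R_NormedModule _ _)).
- refine (filterlim_comp_2 _ _ Rplus (filterlim_comp_2 _ _ Rmult Hf1 Hg2 (@filterlim_mult R_AbsRing _ _))
    (filterlim_comp_2 _ _ Rmult Hf2 Hg1 (@filterlim_mult R_AbsRing _ _))
    (@filterlim_plus R_AbsRing R_NormedModule _ _)).
Qed.

Lemma filterlim_Cinv (f : T -> C) (a : C) :
  a <> 0 -> filterlim f F (locally a) -> filterlim (fun x => (/ f x)%C) F (locally (/ a)%C).
Proof.
intros Ha Hf.
apply filterlim_comp with (1 := Hf).
apply filterlim_Cmod; [apply locally_filter|]. intros eps.
assert (Hm : 0 < Cmod a) by (apply Cmod_gt_0; exact Ha).
pose proof (cond_pos eps) as He.
(* The first bound keeps [Cmod x] above [Cmod a / 2]; the second then makes [Cmod (x - a)] smaller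
   than [eps * Cmod x * Cmod a], as the difference of the reciprocals requires. *)
assert (Hd : 0 < Rmin (Cmod a / 2) (eps * Cmod a * Cmod a / 2)).
{ apply Rmin_pos; [lra|]. assert (0 < eps * Cmod a) by (apply Rmult_lt_0_compat; lra).
  assert (0 < eps * Cmod a * Cmod a) by (apply Rmult_lt_0_compat; lra). lra. }
pose proof (proj1 (@filterlim_Cmod C (locally a) _ (fun x => x) a) (fun P H => H) (mkposreal _ Hd)) as H.
revert H. apply filter_imp. simpl. intros x Hx.
pose proof (Rmin_l (Cmod a / 2) (eps * Cmod a * Cmod a / 2)) as H1.
pose proof (Rmin_r (Cmod a / 2) (eps * Cmod a * Cmod a / 2)) as H2.
assert (Hxa : Cmod a / 2 < Cmod x).
{ pose proof (Cmod_triangle x (a - x)%C) as Ht. replace (x + (a - x))%C with a in Ht by ring.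
  replace (a - x)%C with (- (x - a))%C in Ht by ring. rewrite Cmod_opp in Ht. lra. }
assert (Hx0 : x <> 0) by (intros ->; rewrite Cmod_0 in Hxa; lra).
replace (/ x - / a)%C with (- (x - a) / (x * a))%C by (field; split; assumption).
rewrite Cmod_div, Cmod_opp, Cmod_mult by (apply Cmult_neq_0; assumption).
apply Rmult_lt_reg_r with (Cmod x * Cmod a); [apply Rmult_lt_0_compat; lra|].
unfold Rdiv. rewrite Rmult_assoc, Rinv_l, Rmult_1_r by (apply Rgt_not_eq, Rmult_lt_0_compat; lra).
apply Rlt_le_trans with (1 := Hx). eapply Rle_trans; [exact H2|].
assert (0 < eps * Cmod a) by (apply Rmult_lt_0_compat; lra). nra.
Qed.

Lemma filterlim_Cconst (a : C) : filterlim (fun _ : T => a) F (locally a).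
Proof. apply filterlim_const. Qed.

Lemma filterlim_Copp (f : T -> C) (a : C) :
  filterlim f F (locally a) -> filterlim (fun x => (- f x)%C) F (locally (- a)%C).
Proof.
intros Hf. apply filterlim_comp with (1 := Hf).
exact (@filterlim_opp R_AbsRing C_R_NormedModule a).
Qed.

Lemma filterlim_Cminus (f g : T -> C) (a b : C) :
  filterlim f F (locally a) -> filterlim g F (locally b) ->
  filterlim (fun x => (f x - g x)%C) F (locally (a - b)%C).
Proof. intros Hf Hg. apply filterlim_Cplus; [|apply filterlim_Copp]; assumption. Qed.

Lemma filterlim_Cdiv (f g : T -> C) (a b : C) : b <> 0 ->
  filterlim f F (locally a) -> filterlim g F (locally b) ->
  filterlim (fun x => (f x / g x)%C) F (locally (a / b)%C).
Proof. intros Hb Hf Hg. apply filterlim_Cmult; [|apply filterlim_Cinv]; assumption. Qed.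

Lemma filterlim_RtoC (f : T -> R) (a : R) :
  filterlim f F (locally a) -> filterlim (fun x => RtoC (f x)) F (locally (RtoC a)).
Proof.
intros Hf. apply filterlim_C_components; [exact FF|]. split; [exact Hf|].
apply filterlim_const.
Qed.

End FilterlimC.

Definition contC (f : R -> C) (t : R) : Prop := filterlim f (locally t) (locally (f t)).

Lemma filterlim_C_unique {T : Type} (F : (T -> Prop) -> Prop) {FF : ProperFilter F} (f : T -> C) (a b : C) :
  filterlim f F (locally a) -> filterlim f F (locally b) -> a = b.
Proof. exact (@filterlim_locally_unique T R_AbsRing C_R_NormedModule F _ f a b). Qed.

Lemma derC_cont (f : R -> C) t l : derC f t l -> contC f t.
Proof.
intros H. exact (@ex_derive_continuous R_AbsRing C_R_NormedModule f t (ex_intro _ l H)).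
Qed.

Lemma derC_components (f : R -> C) t l : derC f t l ->
  is_derive (fun x => fst (f x)) t (fst l) /\ is_derive (fun x => snd (f x)) t (snd l).
Proof.
intros H. split.
- unfold derC, is_derive in *.
  apply (filterdiff_ext_lin _ (fun y => fst (@scal R_AbsRing C_R_NormedModule y l))); [|reflexivity].
  exact (filterdiff_comp' f (fun p : C_R_NormedModule => fst p) t _ _ H (filterdiff_linear _ (@is_linear_fst R_AbsRing R_NormedModule R_NormedModule))).
- unfold derC, is_derive in *.
  apply (filterdiff_ext_lin _ (fun y => snd (@scal R_AbsRing C_R_NormedModule y l))); [|reflexivity].
  exact (filterdiff_comp' f (fun p : C_R_NormedModule => snd p) t _ _ H (filterdiff_linear _ (@is_linear_snd R_AbsRing R_NormedModule R_NormedModule))).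
Qed.

Lemma isI_components (f : R -> C) a b l :
  isI f a b l <-> is_RInt (fun t => fst (f t)) a b (fst l) /\ is_RInt (fun t => snd (f t)) a b (snd l).
Proof.
split.
- intros H; split; [apply (is_RInt_fct_extend_fst (U:=R_NormedModule) (V:=R_NormedModule) f a b l H) | apply (is_RInt_fct_extend_snd (U:=R_NormedModule) (V:=R_NormedModule) f a b l H)].
- intros [H1 H2]. destruct l as [l1 l2].
  exact (is_RInt_fct_extend_pair (U:=R_NormedModule) (V:=R_NormedModule) f a b l1 l2 H1 H2).
Qed.

Lemma isI_unique (f : R -> C) a b l : isI f a b l -> RIntC f a b = l.
Proof. exact (@is_RInt_unique C_R_CompleteNormedModule f a b l). Qed.

Lemma isI_cont (f : R -> C) a b : a <= b ->
  (forall t, a <= t <= b -> contC f t) -> isI f a b (RIntC f a b).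
Proof.
intros Hab H. apply (@RInt_correct C_R_CompleteNormedModule).
apply (@ex_RInt_continuous C_R_CompleteNormedModule). intros z.
rewrite Rmin_left, Rmax_right by assumption. apply H.
Qed.

Lemma isI_plus f g a b lf lg : isI f a b lf -> isI g a b lg ->
  isI (fun t => f t + g t)%C a b (lf + lg)%C.
Proof. exact (@is_RInt_plus C_R_NormedModule f g a b lf lg). Qed.

Lemma isI_minus f g a b lf lg : isI f a b lf -> isI g a b lg ->
  isI (fun t => f t - g t)%C a b (lf - lg)%C.
Proof. exact (@is_RInt_minus C_R_NormedModule f g a b lf lg). Qed.

(** The integral is taken in [C] as a real normed module, so the scalar rule covers real factors; a
    complex factor is distributed over the components. *)
Lemma isI_Cmult c f a b l : isI f a b l -> isI (fun t => c * f t)%C a b (c * l)%C.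
Proof.
intros H. apply isI_components in H. destruct H as [H1 H2].
apply isI_components. destruct c as [c1 c2]. simpl. split.
- apply (is_RInt_minus (V:=R_NormedModule)); apply (is_RInt_scal (V:=R_NormedModule)); assumption.
- apply (is_RInt_plus (V:=R_NormedModule)); apply (is_RInt_scal (V:=R_NormedModule)); assumption.
Qed.

Lemma isI_ext f g a b l : a <= b -> (forall t, a < t < b -> f t = g t) ->
  isI f a b l -> isI g a b l.
Proof.
intros Hab H. apply (@is_RInt_ext C_R_NormedModule).
rewrite Rmin_left, Rmax_right by assumption. exact H.
Qed.

Lemma isI_bound f g a b lf lg : a <= b -> (forall t, a <= t <= b -> Cmod (f t) <= g t) ->
  isI f a b lf -> is_RInt g a b lg -> Cmod lf <= lg.
Proof.
intros Hab H. rewrite <- norm_Cmod.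
apply (@norm_RInt_le C_R_NormedModule f g a b lf lg Hab).
intros t Ht. rewrite norm_Cmod. exact (H t Ht).
Qed.

Lemma isI_const_bound f a b l B : a <= b -> (forall t, a <= t <= b -> Cmod (f t) <= B) ->
  isI f a b l -> Cmod l <= (b - a) * B.
Proof.
intros Hab H. rewrite <- norm_Cmod.
apply (@norm_RInt_le_const C_R_NormedModule f a b l B Hab).
intros t Ht. rewrite norm_Cmod. exact (H t Ht).
Qed.

Lemma isI_Chasles f a b c l1 l2 : isI f a b l1 -> isI f b c l2 -> isI f a c (l1 + l2)%C.
Proof. exact (@is_RInt_Chasles C_R_NormedModule f a b c l1 l2). Qed.

Lemma isI_derC f df a b : a <= b -> (forall t, a <= t <= b -> derC f t (df t)) ->
  (forall t, a <= t <= b -> contC df t) -> isI df a b (f b - f a)%C.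
Proof.
intros Hab H1 H2. apply (@is_RInt_derive C_R_CompleteNormedModule f df a b);
rewrite Rmin_left, Rmax_right by assumption; assumption.
Qed.

Lemma contC_const c t : contC (fun _ => c) t.
Proof. apply filterlim_const. Qed.

Lemma contC_plus f g t : contC f t -> contC g t -> contC (fun x => f x + g x)%C t.
Proof. apply filterlim_Cplus. apply locally_filter. Qed.

Lemma contC_minus f g t : contC f t -> contC g t -> contC (fun x => f x - g x)%C t.
Proof. apply filterlim_Cminus. apply locally_filter. Qed.

Lemma contC_mult f g t : contC f t -> contC g t -> contC (fun x => f x * g x)%C t.
Proof. apply filterlim_Cmult. apply locally_filter. Qed.

Lemma contC_div (f g : R -> C) t : g t <> RtoC 0 -> contC f t -> contC g t -> contC (fun x => f x / g x)%C t.
Proof. apply filterlim_Cdiv. apply locally_filter. Qed.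

Lemma contC_RtoC f t : continuous f t -> contC (fun x => RtoC (f x)) t.
Proof. apply filterlim_RtoC. apply locally_filter. Qed.

Lemma contC_Cmod f t : contC f t -> continuous (fun x => Cmod (f x)) t.
Proof.
intros H0. pose proof (proj1 (filterlim_Cmod (locally t) f (f t)) H0) as H.
apply filterlim_locally. intros eps. generalize (H eps). apply filter_imp. intros x Hx.
eapply Rle_lt_trans; [|exact Hx]. change (Rabs (Cmod (f x) - Cmod (f t)) <= Cmod (f x - f t)).
pose proof (Cmod_triangle (f x - f t) (f t)) as H1.
pose proof (Cmod_triangle (f t - f x) (f x)) as H2.
replace (f x - f t + f t)%C with (f x) in H1 by ring.
replace (f t - f x + f x)%C with (f t) in H2 by ring.
replace (f t - f x)%C with (- (f x - f t))%C in H2 by ring. rewrite Cmod_opp in H2.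
apply Rabs_le; lra.
Qed.

Lemma Cmod_minus_sym (x y : C) : Cmod (x - y) = Cmod (y - x).
Proof. replace (x - y)%C with (- (y - x))%C by ring. apply Cmod_opp. Qed.

Lemma Cmod_minus_triangle (x y z : C) : Cmod (x - z) <= Cmod (x - y) + Cmod (y - z).
Proof. replace (x - z)%C with ((x - y) + (y - z))%C by ring. apply Cmod_triangle. Qed.

Lemma at_right_lt (c : R) : 0 < c -> at_right 0 (fun e => 0 < e < c).
Proof.
intros Hc. exists (mkposreal c Hc). intros y Hy Hy0. split; [exact Hy0|].
change (Rabs (y - 0) < c) in Hy. apply Rabs_lt_between in Hy. lra.
Qed.

Lemma filterlim_Cmod_le {T : Type} (F : (T -> Prop) -> Prop) {FF : ProperFilter F} (f : T -> C) (l : C) (B : R) :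
  filterlim f F (locally l) -> F (fun x => Cmod (f x) <= B) -> Cmod l <= B.
Proof.
intros H1 H2. apply Rnot_lt_le. intros Hlt.
assert (He : 0 < Cmod l - B) by lra.
pose proof (proj1 (filterlim_Cmod F f l) H1 (mkposreal _ He)) as H3.
destruct (filter_ex _ (filter_and _ _ H2 H3)) as [x [Hx1 Hx2]]. simpl in Hx2.
pose proof (Cmod_triangle (f x) (l - f x)) as Ht.
replace (f x + (l - f x))%C with l in Ht by ring.
rewrite (Cmod_minus_sym l) in Ht. lra.
Qed.

(* The integrals over the truncated intervals are part of the definition, so that
   improper integrals can be combined without further integrability hypotheses. *)
Definition improper (f : R -> C) (a b : R) (l : C) : Prop :=
  exists I : R -> C, (forall e, 0 < e < (b - a) / 2 -> isI f (a + e) (b - e) (I e)) /\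
    filterlim I (at_right 0) (locally l).

Lemma improper_lim f a b l : a < b -> improper f a b l ->
  filterlim (fun e => RIntC f (a + e) (b - e)) (at_right 0) (locally l).
Proof.
intros Hab [I [H1 H2]]. apply filterlim_ext_loc with (2 := H2).
assert (Hc : 0 < (b - a) / 2) by lra.
generalize (at_right_lt _ Hc). apply filter_imp. intros e He. symmetry. apply isI_unique. auto.
Qed.

Lemma improper_unique f a b l l' : a < b -> improper f a b l -> improper f a b l' -> l = l'.
Proof.
intros Hab H1 H2. apply improper_lim in H1; [|exact Hab]. apply improper_lim in H2; [|exact Hab].
eapply filterlim_C_unique; [|exact H1|exact H2]. apply at_right_proper_filter.
Qed.

Lemma improper_plus f g a b l l' : improper f a b l -> improper g a b l' ->
  improper (fun t => f t + g t)%C a b (l + l')%C.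
Proof.
intros [I [H1 H2]] [J [H3 H4]]. exists (fun e => I e + J e)%C. split.
- intros e He. apply isI_plus; auto.
- apply filterlim_Cplus; auto. apply at_right_proper_filter.
Qed.

Lemma improper_Cmult c f a b l : improper f a b l -> improper (fun t => c * f t)%C a b (c * l)%C.
Proof.
intros [I [H1 H2]]. exists (fun e => c * I e)%C. split.
- intros e He. apply isI_Cmult; auto.
- apply filterlim_Cmult; auto using filterlim_Cconst. apply at_right_proper_filter.
  apply filterlim_const.
Qed.

Lemma improper_ext f g a b l : (forall t, a < t < b -> f t = g t) -> improper f a b l -> improper g a b l.
Proof.
intros Hfg [I [H1 H2]]. exists I. split; [|exact H2].
intros e He. apply isI_ext with (3 := H1 e He); [lra|]. intros t Ht. apply Hfg. lra.
Qed.

Lemma improper_minus f g a b l l' : improper f a b l -> improper g a b l' ->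
  improper (fun t => f t - g t)%C a b (l - l')%C.
Proof.
intros H1 H2. pose proof (improper_plus _ _ _ _ _ _ H1 (improper_Cmult (RtoC (-1)) _ _ _ _ H2)) as H.
replace (l - l')%C with (l + RtoC (-1) * l')%C by (apply injective_projections; simpl; ring).
eapply improper_ext; [|exact H]. intros t _. apply injective_projections; simpl; ring.
Qed.

Lemma contC_bounded f a b : a <= b -> (forall t, a <= t <= b -> contC f t) ->
  exists B, 0 <= B /\ forall t, a <= t <= b -> Cmod (f t) <= B.
Proof.
intros Hab Hf. destruct (continuity_ab_maj (fun t => Cmod (f t)) a b Hab) as [x [Hx _]].
- intros t Ht. apply continuity_pt_filterlim. apply contC_Cmod. auto.
- exists (Cmod (f x)). split; [apply Cmod_ge_0|auto].
Qed.

(** The truncation removes two end pieces of length [e], on which [f] is bounded by some [B]; they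
    contribute at most [2 * e * B]. *)
Lemma improper_proper f a b : a < b -> (forall t, a <= t <= b -> contC f t) ->
  improper f a b (RIntC f a b).
Proof.
intros Hab Hf. exists (fun e => RIntC f (a + e) (b - e)). split.
- intros e He. apply isI_cont; [lra|]. intros t Ht. apply Hf. lra.
- destruct (contC_bounded f a b (Rlt_le _ _ Hab) Hf) as [B [HB0 HB]].
  apply filterlim_Cmod; [apply at_right_proper_filter|]. intros eps.
  assert (Hd : 0 < Rmin ((b - a) / 2) (eps / (2 * (B + 1)))).
  { apply Rmin_pos; [lra|]. pose proof (cond_pos eps). apply Rdiv_lt_0_compat; lra. }
  generalize (at_right_lt _ Hd). apply filter_imp. intros e [He He'].
  pose proof (Rmin_l ((b - a) / 2) (eps / (2 * (B + 1)))) as Hl.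
  pose proof (Rmin_r ((b - a) / 2) (eps / (2 * (B + 1)))) as Hr.
  assert (HI : forall x y, a <= x -> x <= y -> y <= b -> isI f x y (RIntC f x y)).
  { intros x y Hx Hxy Hy. apply isI_cont; [exact Hxy|]. intros t Ht. apply Hf. lra. }
  assert (Hn : forall x y, a <= x -> x <= y -> y <= b -> Cmod (RIntC f x y) <= (y - x) * B).
  { intros x y Hx Hxy Hy. apply isI_const_bound with f; [exact Hxy| |apply HI; assumption].
    intros t Ht. apply HB. lra. }
  assert (Hsum : RIntC f a b = (RIntC f a (a + e) + (RIntC f (a + e) (b - e) + RIntC f (b - e) b))%C).
  { apply isI_unique. apply isI_Chasles with (a + e); [apply HI; lra|].
    apply isI_Chasles with (b - e); apply HI; lra. }
  rewrite Hsum.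
  replace (RIntC f (a + e) (b - e) - _)%C with (- (RIntC f a (a + e) + RIntC f (b - e) b))%C by ring.
  rewrite Cmod_opp. eapply Rle_lt_trans; [apply Cmod_triangle|].
  pose proof (Hn a (a + e) ltac:(lra) ltac:(lra) ltac:(lra)) as N1.
  pose proof (Hn (b - e) b ltac:(lra) ltac:(lra) ltac:(lra)) as N2.
  assert (He2 : e * (2 * (B + 1)) < eps).
  { apply Rlt_le_trans with (eps / (2 * (B + 1)) * (2 * (B + 1))).
    - apply Rmult_lt_compat_r; lra.
    - right. field. lra. }
  nra.
Qed.

(** * Real powers *)

Lemma Rpower_pos x y : 0 < Rpower x y.
Proof. apply exp_pos. Qed.

Lemma is_derive_Rpower x y : 0 < x -> is_derive (fun x => Rpower x y) x (y * Rpower x (y - 1)).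
Proof. intros Hx. apply is_derive_Reals. apply derivable_pt_lim_power. exact Hx. Qed.

Lemma continuous_Rpower x y : 0 < x -> continuous (fun x => Rpower x y) x.
Proof. intros Hx. apply (ex_derive_continuous (K := R_AbsRing) (V := R_NormedModule)). eexists. apply is_derive_Rpower. exact Hx. Qed.

Lemma Rpower_lim_0 b : 0 < b -> filterlim (fun e => Rpower e b) (at_right 0) (locally 0).
Proof.
intros Hb. apply filterlim_locally. intros eps.
generalize (at_right_lt _ (Rpower_pos eps (/ b))). apply filter_imp. intros e [He1 He2].
change (Rabs (Rpower e b - 0) < eps). rewrite Rminus_0_r, Rabs_pos_eq by (left; apply Rpower_pos).
apply Rlt_le_trans with (Rpower (Rpower eps (/ b)) b).
- apply Rlt_Rpower_l; lra.
- rewrite Rpower_mult, Rinv_l, Rpower_1 by (try apply cond_pos; lra). lra.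
Qed.

Lemma Rpower_anti x y b : 0 < x -> x <= y -> b <= 0 -> Rpower y b <= Rpower x b.
Proof.
intros Hx Hxy Hb. replace b with (- (- b)) by ring. rewrite !(Rpower_Ropp _ (- b)).
apply Rinv_le_contravar; [apply Rpower_pos|]. apply Rle_Rpower_l; lra.
Qed.

Lemma Rpower_le_exponent x a b : 0 < x <= 1 -> a <= b -> Rpower x b <= Rpower x a.
Proof.
intros Hx Hab. replace b with (a + (b - a)) by ring. rewrite Rpower_plus.
rewrite <- (Rmult_1_r (Rpower x a)) at 2. apply Rmult_le_compat_l; [left; apply Rpower_pos|].
apply Rle_trans with (Rpower 1 (b - a)); [apply Rle_Rpower_l; lra|].
unfold Rpower. rewrite ln_1, Rmult_0_r, exp_0. lra.
Qed.

(** * Integrals with weak end-point singularities *)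

(* A 2 PI-periodic substitute for the distance from [x] to [2 PI Z]. *)
Definition pdist (x : R) : R := Rabs (sin (x / 2)).

Lemma pdist_pos x : 0 <= pdist x.
Proof. apply Rabs_pos. Qed.

Lemma pdist_opp x : pdist (- x) = pdist x.
Proof. unfold pdist. replace (- x / 2) with (- (x / 2)) by field. rewrite sin_neg. apply Rabs_Ropp. Qed.

Lemma pdist_period x : pdist (x + 2 * PI) = pdist x.
Proof.
unfold pdist. replace ((x + 2 * PI) / 2) with (x / 2 + PI) by field.
rewrite neg_sin. apply Rabs_Ropp.
Qed.

(** The addition formula of the sine, with both cosines bounded by 1. *)
Lemma pdist_triangle x y : pdist (x + y) <= pdist x + pdist y.
Proof.
unfold pdist. replace ((x + y) / 2) with (x / 2 + y / 2) by field. rewrite sin_plus.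
eapply Rle_trans; [apply Rabs_triang|]. rewrite !Rabs_mult.
assert (H : forall z, Rabs (cos z) <= 1) by (intros z; apply Rabs_le; pose proof (COS_bound z); lra).
pose proof (H (x / 2)); pose proof (H (y / 2)).
pose proof (Rabs_pos (sin (x / 2))); pose proof (Rabs_pos (sin (y / 2))). nra.
Qed.

Lemma pdist_le x : pdist x <= Rabs x / 2.
Proof.
assert (H : forall y, 0 <= y -> pdist y <= y / 2).
{ intros y Hy. unfold pdist. destruct (Rle_dec y 2) as [H2|H2].
  - assert (y / 2 <= PI) by (pose proof PI2_3_2; unfold PI2 in *; lra).
    rewrite Rabs_pos_eq by (apply sin_ge_0; lra).
    destruct (Req_dec y 0) as [->|Hy0]; [replace (0 / 2) with 0 by field; rewrite sin_0; lra|].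
    left. apply sin_lt_x. lra.
  - apply Rabs_le. pose proof (SIN_bound (y / 2)). lra. }
unfold Rabs at 1. destruct (Rcase_abs x).
- rewrite <- pdist_opp. apply H. lra.
- apply H. lra.
Qed.

(** For [x >= 0] put [u = x / 2], which is at most 2 on this range: then [sin u >= u - u ^ 3 / 6]
    leaves at least [u / 3 = x / 6]. *)
Lemma pdist_ge x : Rabs x <= PI -> Rabs x / 6 <= pdist x.
Proof.
assert (H : forall y, 0 <= y <= PI -> y / 6 <= pdist y).
{ intros y Hy. unfold pdist. pose proof PI_4.
  rewrite Rabs_pos_eq by (apply sin_ge_0; lra).
  destruct (sin_bound (y / 2) 0) as [H1 _]; [lra|lra|].
  eapply Rle_trans; [|exact H1].
  unfold sin_approx, sin_term, sum_f_R0. simpl. nra. }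
intros Hx. unfold Rabs in *. destruct (Rcase_abs x).
- rewrite <- (pdist_opp x). apply H. lra.
- apply H. lra.
Qed.

Lemma pdist_ge_l x : 0 <= x <= PI -> x / 6 <= pdist x.
Proof. intros Hx. pose proof (pdist_ge x) as H. rewrite Rabs_pos_eq in H; lra. Qed.

Lemma pdist_ge_r x : PI <= x <= 2 * PI -> (2 * PI - x) / 6 <= pdist x.
Proof.
intros Hx. replace x with (- (2 * PI - x) + 2 * PI) at 2 by ring.
rewrite pdist_period, pdist_opp. apply pdist_ge_l. lra.
Qed.

Lemma pdist_gt_0 x : 0 < x < 2 * PI -> 0 < pdist x.
Proof.
intros Hx. destruct (Rle_dec x PI).
- pose proof (pdist_ge_l x). lra.
- pose proof (pdist_ge_r x). lra.
Qed.

Lemma pdist_le_1 x : pdist x <= 1.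
Proof. unfold pdist. apply Rabs_le. pose proof (SIN_bound (x / 2)). lra. Qed.

(** Dominates the periodic weight by two powers with explicit antiderivatives, one for each end of
    the period. The exponent is at most 0, so the factor [/ 6] of the lower bounds turns into
    [6 ^ (1 - b)], which is at most 6. *)
Lemma pdist_power_le b x : 0 < b <= 1 -> 0 < x < 2 * PI ->
  Rpower (pdist x) (b - 1) <= 6 * (Rpower x (b - 1) + Rpower (2 * PI - x) (b - 1)).
Proof.
intros Hb Hx.
assert (H : forall y, 0 < y -> y / 6 <= pdist x -> Rpower (pdist x) (b - 1) <= 6 * Rpower y (b - 1)).
{ intros y Hy Hyx. eapply Rle_trans; [apply (Rpower_anti (y / 6)); lra|].
  unfold Rdiv. rewrite <- Rpower_mult_distr by lra. rewrite Rmult_comm.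
  apply Rmult_le_compat_r; [left; apply Rpower_pos|].
  replace (/ 6) with (Rpower 6 (- (1))) by (rewrite Rpower_Ropp, Rpower_1; lra). rewrite Rpower_mult.
  rewrite <- (Rpower_1 6) at 2 by lra. apply Rle_Rpower; lra. }
pose proof (Rpower_pos x (b - 1)); pose proof (Rpower_pos (2 * PI - x) (b - 1)).
destruct (Rle_dec x PI).
- pose proof (H x ltac:(lra) (pdist_ge_l x ltac:(lra))). lra.
- pose proof (H (2 * PI - x) ltac:(lra) (pdist_ge_r x ltac:(lra))). lra.
Qed.

Lemma filterlim_Cauchy_C {T : Type} (F : (T -> Prop) -> Prop) {FF : ProperFilter F} (f : T -> C) :
  (forall eps : posreal, exists P, F P /\ forall u v, P u -> P v -> Cmod (f u - f v) < eps) ->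
  exists l, filterlim f F (locally l).
Proof.
intros H. apply (proj1 (@filterlim_locally_cauchy T C_R_CompleteNormedModule F FF f)).
intros eps. destruct (H eps) as [P [HP1 HP2]]. exists P. split; [exact HP1|].
intros u v Hu Hv. apply (@norm_compat1 R_AbsRing C_R_NormedModule).
eapply Rle_lt_trans; [|exact (HP2 v u Hv Hu)].
rewrite norm_Cmod. apply Rle_refl.
Qed.

(** The tool behind the uniform estimates: [K] is fixed before [f], [s] and [B], so a pointwise
    bound with weight [pdist ^ (b - 1)] becomes a bound for the integral that is linear in [B] and
    independent of the base point. *)
Lemma improper_exists (b : R) : 0 < b <= 1 ->
  exists K, 0 <= K /\ forall f s B, 0 <= B ->
   (forall t, s < t < s + 2 * PI -> contC f t) ->
   (forall t, s < t < s + 2 * PI -> Cmod (f t) <= B * Rpower (pdist (t - s)) (b - 1)) ->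
   exists l, improper f s (s + 2 * PI) l /\ Cmod l <= K * B.
Proof.
intros Hb. set (T := 2 * PI).
assert (HT : 0 < T) by (unfold T; pose proof PI_RGT_0; lra).
exists (12 / b * Rpower T b).
assert (H12 : 0 < 12 / b) by (apply Rdiv_lt_0_compat; lra).
split; [apply Rmult_le_pos; [lra|left; apply Rpower_pos]|].
intros f s B HB Hc Hf.
(* [G] is an antiderivative of [g], the majorant of [Cmod (f t)] obtained from [pdist_power_le]. It
   stays bounded up to both ends because [b > 0]; its total increment is the source of
   [12 / b * Rpower T b]. *)
set (G := fun t => 6 * B / b * (Rpower (t - s) b - Rpower (s + T - t) b)).
set (g := fun t => 6 * B * (Rpower (t - s) (b - 1) + Rpower (s + T - t) (b - 1))).
assert (HG : forall t, s < t < s + T -> is_derive G t (g t)).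
{ intros t Ht. unfold G, g.
  replace (6 * B * (Rpower (t - s) (b - 1) + Rpower (s + T - t) (b - 1)))
    with (6 * B / b * (1 * (b * Rpower (t - s) (b - 1)) - (-1) * (b * Rpower (s + T - t) (b - 1)))) by (field; lra).
  apply (is_derive_scal (fun t => Rpower (t - s) b - Rpower (s + T - t) b)).
  apply (is_derive_minus (V := R_NormedModule)).
  - apply (is_derive_comp (V := R_NormedModule) (fun x => Rpower x b) (fun t => t - s)).
    + apply is_derive_Rpower. lra.
    + auto_derive; [trivial|ring].
  - apply (is_derive_comp (V := R_NormedModule) (fun x => Rpower x b) (fun t => s + T - t)).
    + apply is_derive_Rpower. lra.
    + auto_derive; [trivial|ring]. }
assert (Hg : forall t, s < t < s + T -> continuous g t).
{ intros t Ht. unfold g. apply (continuous_scal_r (V := R_NormedModule) (6 * B)).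
  apply (continuous_plus (V := R_NormedModule)).
  - apply (continuous_comp (fun t => t - s) (fun x => Rpower x (b - 1))).
    + apply (ex_derive_continuous (K := R_AbsRing) (V := R_NormedModule)). auto_derive; trivial.
    + apply continuous_Rpower. lra.
  - apply (continuous_comp (fun t => s + T - t) (fun x => Rpower x (b - 1))).
    + apply (ex_derive_continuous (K := R_AbsRing) (V := R_NormedModule)). auto_derive; trivial.
    + apply continuous_Rpower. lra. }
assert (Hfg : forall t, s < t < s + T -> Cmod (f t) <= g t).
{ intros t Ht. eapply Rle_trans; [apply Hf; exact Ht|].
  pose proof (pdist_power_le b (t - s) Hb ltac:(unfold T in *; lra)) as H.
  unfold g. replace (s + T - t) with (2 * PI - (t - s)) by (unfold T; ring). nra. }
assert (HI : forall x y, s < x -> x <= y -> y < s + T -> isI f x y (RIntC f x y)).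
{ intros x y Hx Hxy Hy. apply isI_cont; [exact Hxy|]. intros t Ht. apply Hc. unfold T in *; lra. }
assert (HIb : forall x y, s < x -> x <= y -> y < s + T -> Cmod (RIntC f x y) <= G y - G x).
{ intros x y Hx Hxy Hy. apply isI_bound with (f := f) (g := g) (a := x) (b := y); [exact Hxy| |auto|].
  - intros t Ht. apply Hfg. lra.
  - apply (is_RInt_derive (V := R_CompleteNormedModule)); rewrite Rmin_left, Rmax_right by exact Hxy;
      intros t Ht; [apply HG|apply Hg]; lra. }
set (I := fun e => RIntC f (s + e) (s + T - e)).
set (J := fun e => G (s + T - e) - G (s + e)).
assert (HJe : forall e, J e = 12 * B / b * (Rpower (T - e) b - Rpower e b)).
{ intros e. unfold J, G. replace (s + T - e - s) with (T - e) by ring.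
  replace (s + T - (s + T - e)) with e by ring. replace (s + e - s) with e by ring.
  replace (s + T - (s + e)) with (T - e) by ring. field. lra. }
(* Two truncated integrals differ by two end pieces, and the increments of [G] over these pieces add
   up to the change of [J]. Convergence of [J] thus carries the Cauchy criterion over to [I]. *)
assert (HIJ : forall e e', 0 < e -> e <= e' -> e' < T / 2 -> Cmod (I e - I e') <= Rabs (J e - J e')).
{ intros e e' He Hee' He'. unfold I.
  assert (H : RIntC f (s + e) (s + T - e) = (RIntC f (s + e) (s + e') + (RIntC f (s + e') (s + T - e') + RIntC f (s + T - e') (s + T - e)))%C).
  { apply isI_unique. apply isI_Chasles with (s + e'); [apply HI; lra|].
    apply isI_Chasles with (s + T - e'); apply HI; lra. }
  rewrite H. replace (_ - _)%C with (RIntC f (s + e) (s + e') + RIntC f (s + T - e') (s + T - e))%C by ring.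
  eapply Rle_trans; [apply Cmod_triangle|].
  eapply Rle_trans; [|apply Rle_abs].
  pose proof (HIb (s + e) (s + e') ltac:(lra) ltac:(lra) ltac:(lra)).
  pose proof (HIb (s + T - e') (s + T - e) ltac:(lra) ltac:(lra) ltac:(lra)).
  unfold J. lra. }
assert (HIJ' : forall e e', 0 < e < T / 2 -> 0 < e' < T / 2 -> Cmod (I e - I e') <= Rabs (J e - J e')).
{ intros e e' He He'. destruct (Rle_dec e e'); [apply HIJ; lra|].
  rewrite Cmod_minus_sym, Rabs_minus_sym. apply HIJ; lra. }
assert (HJl : filterlim J (at_right 0) (locally (12 * B / b * (Rpower T b - 0)))).
{ apply filterlim_ext with (fun e => 12 * B / b * (Rpower (T - e) b - Rpower e b)); [intros; symmetry; apply HJe|].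
  apply (filterlim_comp _ _ _ (fun e => Rpower (T - e) b - Rpower e b) (fun x => 12 * B / b * x) _ (locally (Rpower T b - 0)));
    [|apply (filterlim_scal_r (V := R_NormedModule) (12 * B / b))].
  apply (filterlim_comp_2 (fun e => Rpower (T - e) b) (fun e => - Rpower e b) Rplus (G := locally (Rpower T b)) (H := locally (- 0)));
    [| |apply (filterlim_plus (V := R_NormedModule))].
  - apply (filterlim_filter_le_1 (F := locally 0)); [intros P; apply filter_le_within|].
    assert (Hct : continuous (fun e => Rpower (T - e) b) 0).
    { apply (continuous_comp (fun e => T - e) (fun x => Rpower x b)).
      - apply (ex_derive_continuous (K := R_AbsRing) (V := R_NormedModule)). auto_derive; trivial.
      - apply continuous_Rpower. lra. }
    unfold continuous in Hct. rewrite Rminus_0_r in Hct. exact Hct.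
  - apply (filterlim_comp _ _ _ (fun e => Rpower e b) Ropp _ (locally 0)); [apply Rpower_lim_0; lra|].
    apply (filterlim_opp (V := R_NormedModule)). }
assert (HHT : 0 < T / 2) by lra.
destruct (filterlim_Cauchy_C (at_right 0) I) as [l Hl].
{ intros eps.
  destruct (proj2 (@filterlim_locally_cauchy R R_CompleteNormedModule (at_right 0) _ J) (ex_intro (fun y : R => filterlim J (at_right 0) (locally y)) _ HJl) eps) as [P [HP1 HP2]].
  exists (fun e => P e /\ 0 < e < T / 2). split.
  - apply filter_and; [exact HP1|apply at_right_lt; lra].
  - intros u v [Hu1 Hu2] [Hv1 Hv2]. eapply Rle_lt_trans; [apply HIJ'; assumption|].
    rewrite Rabs_minus_sym. exact (HP2 u v Hu1 Hv1). }
exists l. split.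
- exists I. split; [|exact Hl]. intros e He. unfold I. fold T. apply HI; fold T in He; lra.
- apply filterlim_Cmod_le with (2 := Hl); [apply at_right_proper_filter|].
  generalize (at_right_lt _ HHT). apply filter_imp. intros e He.
  unfold I. eapply Rle_trans; [apply HIb; lra|]. fold (J e). rewrite HJe.
  replace (12 / b * Rpower T b * B) with (12 * B / b * Rpower T b) by (field; lra).
  apply Rmult_le_compat_l; [apply Rmult_le_pos; [lra|left; apply Rinv_0_lt_compat; lra]|].
  pose proof (Rpower_pos e b).
  assert (Rpower (T - e) b <= Rpower T b) by (apply Rle_Rpower_l; lra). lra.
Qed.

(** Compactness with a gauge: within radius [f u v / (4 * L)] of [(u, v)] the Lipschitz condition
    keeps [f] above half of [f u v], and compactness supplies a positive lower bound [e] for the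
    radii in use. *)
Lemma lipschitz_pos_bound_2d (f : R -> R -> R) (a b c d L : R) : 0 < L ->
  (forall x y u v, Rabs (f x y - f u v) <= L * (Rabs (x - u) + Rabs (y - v))) ->
  (forall x y, a <= x <= b -> c <= y <= d -> 0 < f x y) ->
  exists m, 0 < m /\ forall x y, a <= x <= b -> c <= y <= d -> m <= f x y.
Proof.
intros HL Hf Hpos.
(* A gauge has to be positive everywhere; the default 1 is taken only where [f u v] is not positive,
   which does not happen on the rectangle. *)
assert (Hd : forall u v, 0 < Rmax (f u v / (4 * L)) (if Rlt_dec 0 (f u v) then 0 else 1)).
{ intros u v. destruct (Rlt_dec 0 (f u v)) as [H|H].
  - eapply Rlt_le_trans; [|apply Rmax_l]. apply Rdiv_lt_0_compat; lra.
  - eapply Rlt_le_trans; [|apply Rmax_r]. lra. }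
destruct (compactness_value_2d a b c d (fun u v => mkposreal _ (Hd u v))) as [e He].
exists (2 * L * e). pose proof (cond_pos e) as He0. split; [apply Rmult_lt_0_compat; lra|].
(* The covering statement is doubly negated, hence the proof by contradiction. With [q] the radius
   at [(u, v)], [f x y >= 4 * L * q - 2 * L * q >= 2 * L * e]. *)
intros x y Hx Hy. apply Rnot_lt_le. intros Hlt. apply (He x y Hx Hy).
intros (u & v & Hu & Hv & H1 & H2 & H3). simpl in H1, H2, H3.
pose proof (Hpos u v Hu Hv) as Hp.
destruct (Rlt_dec 0 (f u v)) as [_|]; [|lra].
assert (H0 : 0 < f u v / (4 * L)) by (apply Rdiv_lt_0_compat; lra).
rewrite Rmax_left in H1, H2, H3 by lra.
pose proof (Hf u v x y) as H. apply Rabs_le_between in H.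
rewrite (Rabs_minus_sym u), (Rabs_minus_sym v) in H.
assert (HH : f u v = 4 * L * (f u v / (4 * L))) by (field; lra).
set (q := f u v / (4 * L)) in *. nra.
Qed.

(** * Smooth Jordan curves *)

Lemma periodic2pi_Z {T : Type} (f : R -> T) (k : Z) t : periodic2pi f -> f (t + 2 * PI * IZR k) = f t.
Proof.
intros Hf.
assert (H : forall n t, f (t + 2 * PI * INR n) = f t).
{ induction n as [|n IH]; intros u.
  - simpl. f_equal. ring.
  - rewrite S_INR, <- (IH u), <- (Hf (u + 2 * PI * INR n)). f_equal. ring. }
destruct (Z_le_gt_dec 0 k) as [Hk|Hk].
- rewrite <- (Z2Nat.id k) by assumption. rewrite <- INR_IZR_INZ. apply H.
- rewrite <- (H (Z.to_nat (- k)) (t + 2 * PI * IZR k)). f_equal.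
  rewrite INR_IZR_INZ, Z2Nat.id by lia. rewrite opp_IZR. ring.
Qed.

Lemma mod_2pi (t : R) : exists k : Z, 0 <= t + 2 * PI * IZR k < 2 * PI.
Proof.
pose proof PI_RGT_0. exists (- Int_part (t / (2 * PI)))%Z. rewrite opp_IZR.
destruct (base_Int_part (t / (2 * PI))) as [H1 H2]. set (p := IZR (Int_part (t / (2 * PI)))) in *.
assert (Ht : t = 2 * PI * (t / (2 * PI))) by (field; lra).
rewrite Ht at 1 2. split; nra.
Qed.

Lemma mod_2pi_centered (s t : R) : exists k : Z, Rabs (t + 2 * PI * IZR k - s) <= PI.
Proof.
destruct (mod_2pi (t - s + PI)) as [k Hk]. exists k. apply Rabs_le. lra.
Qed.

Lemma pdist_Z x k : pdist (x + 2 * PI * IZR k) = pdist x.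
Proof. apply periodic2pi_Z. intros t. apply pdist_period. Qed.

Lemma periodic_contC_bounded f : periodic2pi f -> (forall t, contC f t) ->
  exists B, 0 < B /\ forall t, Cmod (f t) <= B.
Proof.
intros Hp Hc. pose proof PI_RGT_0.
destruct (contC_bounded f 0 (2 * PI) ltac:(lra) ltac:(auto)) as [B [HB0 HB]].
exists (B + 1). split; [lra|]. intros t. destruct (mod_2pi t) as [k Hk].
rewrite <- (periodic2pi_Z f k t Hp). apply Rle_trans with B; [apply HB|]; lra.
Qed.

Lemma periodic_contC_lower_bound f : periodic2pi f -> (forall t, contC f t) -> (forall t, f t <> RtoC 0) ->
  exists m, 0 < m /\ forall t, m <= Cmod (f t).
Proof.
intros Hp Hc Hnz. pose proof PI_RGT_0.
destruct (continuity_ab_min (fun t => Cmod (f t)) 0 (2 * PI) ltac:(lra)) as [x [Hx _]].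
{ intros t Ht. apply continuity_pt_filterlim. apply contC_Cmod. auto. }
exists (Cmod (f x)). split; [apply Cmod_gt_0, Hnz|].
intros t. destruct (mod_2pi t) as [k Hk].
rewrite <- (periodic2pi_Z f k t Hp). apply Hx. lra.
Qed.

Lemma derC_unique f t l l' : derC f t l -> derC f t l' -> l = l'.
Proof.
intros H H'. apply derC_components in H. apply derC_components in H'.
destruct H as [H1 H2], H' as [H1' H2'].
apply injective_projections.
- rewrite <- (is_derive_unique _ _ _ H1). apply is_derive_unique. exact H1'.
- rewrite <- (is_derive_unique _ _ _ H2). apply is_derive_unique. exact H2'.
Qed.

Lemma derC_periodic f f' : periodic2pi f -> (forall t, derC f t (f' t)) -> periodic2pi f'.
Proof.
intros Hp Hd t. apply derC_unique with f t; [|apply Hd].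
unfold derC. apply (is_derive_ext (fun x => f (x + 2 * PI))); [apply Hp|].
pose proof (@is_derive_comp R_AbsRing C_R_NormedModule f (fun x => x + 2 * PI) t (f' (t + 2 * PI)) 1 (Hd (t + 2 * PI))) as H.
rewrite <- (@scal_one R_AbsRing C_R_NormedModule (f' (t + 2 * PI))).
apply H. auto_derive; [trivial|ring].
Qed.

(** For complex values there is no intermediate point; instead the increment is the integral of [f']
    and is bounded by length times supremum. *)
Lemma derC_mean_value f f' s t B : (forall x, derC f x (f' x)) -> (forall x, contC f' x) ->
  (forall x, Rabs (x - s) <= Rabs (t - s) -> Cmod (f' x) <= B) ->
  Cmod (f t - f s) <= B * Rabs (t - s).
Proof.
intros Hd Hc HB.
destruct (Rle_dec s t) as [Hst|Hst].
- rewrite Rabs_pos_eq in * by lra.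
  rewrite Rmult_comm. apply isI_const_bound with (f := f'); [exact Hst| |apply isI_derC; auto].
  intros x Hx. apply HB. apply Rabs_le. lra.
- rewrite Cmod_minus_sym, Rabs_minus_sym. rewrite Rabs_left in HB by lra. rewrite Rabs_pos_eq by lra.
  rewrite Rmult_comm. apply isI_const_bound with (f := f'); [lra| |apply isI_derC; auto; lra].
  intros x Hx. apply HB. apply Rabs_le. lra.
Qed.

Lemma derC_minus_linear f f' c t : derC f t (f' t) -> derC (fun x => f x - RtoC x * c)%C t (f' t - c)%C.
Proof.
intros H.
assert (Hl : derC (fun x => RtoC x * c)%C t c).
{ unfold derC.
  apply (is_derive_ext (fun x : R => @scal R_AbsRing C_R_NormedModule x c)).
  - intros x. apply injective_projections; simpl; unfold scal; simpl; unfold mult; simpl; ring.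
  - exact (eq_ind _ (fun z => @is_derive R_AbsRing C_R_NormedModule (fun x : R => @scal R_AbsRing C_R_NormedModule x c) t z)
      (@is_derive_scal_l R_AbsRing C_R_NormedModule (fun x => x) t 1 c (@is_derive_id R_AbsRing t))
      c (@scal_one R_AbsRing C_R_NormedModule c)). }
exact (@is_derive_minus R_AbsRing C_R_NormedModule _ _ t _ _ H Hl).
Qed.

Record jordan_curve (e e' : R -> C) : Prop := {
  jc_per : periodic2pi e;
  jc_der : forall t, derC e t (e' t);
  jc_C2 : exists e'' : R -> C, (forall t, derC e' t (e'' t)) /\ (forall t, contC e'' t);
  jc_nz : forall t, e' t <> RtoC 0;
  jc_simple : forall s t, 0 <= s < 2 * PI -> 0 <= t < 2 * PI -> e s = e t -> s = t }.

(* [cb_transversal] is the chord-arc inequality for [d = 0]; in general it says that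
   points on the normal through [e s] are transversally separated from the curve. *)
Record curve_bounds (e e' : R -> C) (L c d0 : R) : Prop := {
  cb_L : 0 < L; cb_c : 0 < c; cb_d0 : 0 < d0;
  cb_der_bound : forall t, Cmod (e' t) <= L;
  cb_der_lip : forall s t, Cmod (e' t - e' s) <= L * Rabs (t - s);
  cb_lip : forall s t, Cmod (e t - e s) <= L * Rabs (t - s);
  cb_taylor : forall s t, Cmod (e t - e s - RtoC (t - s) * e' s) <= L * (t - s) ^ 2;
  cb_transversal : forall s t d, Rabs d <= d0 ->
    c * (pdist (t - s) + Rabs d) <= Cmod (e t - e s - Ci * RtoC d * e' s) }.

Lemma jc_per' e e' : jordan_curve e e' -> periodic2pi e'.
Proof. intros H. apply derC_periodic with e; apply H. Qed.

Lemma jc_cont e e' t : jordan_curve e e' -> contC e t.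
Proof. intros H. eapply derC_cont. apply H. Qed.

Lemma jc_cont' e e' t : jordan_curve e e' -> contC e' t.
Proof. intros H. destruct (jc_C2 _ _ H) as [e'' [H1 _]]. eapply derC_cont. apply H1. Qed.

Lemma jc_simple_mod e e' s t : jordan_curve e e' -> e s = e t -> exists k : Z, t = s + 2 * PI * IZR k.
Proof.
intros H Hst. destruct (mod_2pi s) as [i Hi]. destruct (mod_2pi t) as [j Hj].
exists (i - j)%Z. rewrite minus_IZR.
enough (s + 2 * PI * IZR i = t + 2 * PI * IZR j) by lra.
apply (jc_simple _ _ H); try assumption.
rewrite !periodic2pi_Z by apply H. exact Hst.
Qed.

Lemma Ci_Cmod : Cmod Ci = 1.
Proof. unfold Cmod, Ci; simpl. replace (0 * (0 * 1) + 1 * (1 * 1)) with 1 by ring. apply sqrt_1. Qed.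

(** Only the transversal bound is more than a mean value estimate. For parameters closer than [r]
    the tangent dominates the quadratic Taylor remainder. For the others, simplicity and compactness
    bound the chord from below, and [d0] is so small that the normal displacement uses up at most
    half of that bound. *)
Lemma jordan_curve_bounds e e' : jordan_curve e e' -> exists L c d0, curve_bounds e e' L c d0.
Proof.
intros H. pose proof (jc_per _ _ H) as Hp. pose proof (jc_per' _ _ H) as Hp'.
pose proof PI_RGT_0 as HPI.
destruct (jc_C2 _ _ H) as [e'' [H2 H2c]].
pose proof (derC_periodic _ _ Hp' H2) as Hp''.
destruct (periodic_contC_bounded e' Hp' (fun t => jc_cont' _ _ t H)) as [L1 [HL1 HL1b]].
destruct (periodic_contC_bounded e'' Hp'' H2c) as [L2 [HL2 HL2b]].
destruct (periodic_contC_lower_bound e' Hp' (fun t => jc_cont' _ _ t H) (jc_nz _ _ H)) as [m [Hm Hmb]].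
set (L := L1 + L2).
assert (Hlip' : forall s t, Cmod (e' t - e' s) <= L * Rabs (t - s)).
{ intros s t. apply derC_mean_value with e''; auto. intros x _. unfold L. pose proof (HL2b x). lra. }
assert (Hlip : forall s t, Cmod (e t - e s) <= L * Rabs (t - s)).
{ intros s t. apply derC_mean_value with e'; [apply H|intros; eapply jc_cont'; eauto|].
  intros x _. unfold L. pose proof (HL1b x). lra. }
assert (Htay : forall s t, Cmod (e t - e s - RtoC (t - s) * e' s) <= L * (t - s) ^ 2).
{ intros s t. rewrite <- pow2_abs.
  replace (e t - e s - RtoC (t - s) * e' s)%C with ((e t - RtoC t * e' s) - (e s - RtoC s * e' s))%C
    by (rewrite RtoC_minus; ring).
  replace (L * Rabs (t - s) ^ 2) with (L * Rabs (t - s) * Rabs (t - s)) by ring.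
  apply (derC_mean_value (fun x => e x - RtoC x * e' s)%C (fun x => e' x - e' s)%C).
  - intros x. apply derC_minus_linear. apply H.
  - intros x. apply contC_minus; [eapply jc_cont'; eauto|apply contC_const].
  - intros x Hx. eapply Rle_trans; [apply Hlip'|]. apply Rmult_le_compat_l; [unfold L; lra|exact Hx]. }
(* This radius makes the Taylor remainder [L * tau ^ 2] at most [m / 4 * Rabs tau], where [m] bounds
   the speed from below. *)
set (r := Rmin PI (m / (4 * L))).
assert (HL : 0 < L) by (unfold L; lra).
assert (Hr : 0 < r) by (unfold r; apply Rmin_pos; [lra|apply Rdiv_lt_0_compat; lra]).
assert (HrPI : r <= PI) by apply Rmin_l.
assert (HrL : L * r <= m / 4).
{ apply Rle_trans with (L * (m / (4 * L))); [apply Rmult_le_compat_l; [lra|apply Rmin_r]|]. right; field; lra. }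
(* Pairs of points are described by a base point and a gap in [[r, PI]]; a zero would make the gap a
   positive multiple of [2 * PI]. *)
destruct (lipschitz_pos_bound_2d (fun x y => Cmod (e (x + y)%R - e x)) 0 (2 * PI) r PI (2 * L)) as [m2 [Hm2 Hm2b]].
{ lra. }
{ intros x y u v.
  assert (HH : Cmod ((e (x + y)%R - e x) - (e (u + v)%R - e u)) <= 2 * L * (Rabs (x - u) + Rabs (y - v))).
  { replace ((e (x + y)%R - e x) - (e (u + v)%R - e u))%C with ((e (x + y)%R - e (u + v)%R) - (e x - e u))%C by ring.
    eapply Rle_trans; [apply Cmod_triangle|]. rewrite Cmod_opp.
    pose proof (Hlip (u + v) (x + y)) as A1. pose proof (Hlip u x) as A2.
    assert (A3 : Rabs (x + y - (u + v)) <= Rabs (x - u) + Rabs (y - v)).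
    { replace (x + y - (u + v)) with ((x - u) + (y - v)) by ring. apply Rabs_triang. }
    pose proof (Rabs_pos (y - v)). nra. }
  eapply Rle_trans; [|exact HH].
  pose proof (Cmod_triangle ((e (x + y)%R - e x) - (e (u + v)%R - e u)) (e (u + v)%R - e u)) as T1.
  pose proof (Cmod_triangle (- ((e (x + y)%R - e x) - (e (u + v)%R - e u))) (e (x + y)%R - e x)) as T2.
  rewrite Cmod_opp in T2.
  replace ((e (x + y)%R - e x) - (e (u + v)%R - e u) + (e (u + v)%R - e u))%C with (e (x + y)%R - e x)%C in T1 by ring.
  replace (- ((e (x + y)%R - e x) - (e (u + v)%R - e u)) + (e (x + y)%R - e x))%C with (e (u + v)%R - e u)%C in T2 by ring.
  apply Rabs_le. lra. }
{ intros x y Hx Hy. apply Cmod_gt_0. intros Heq.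
  assert (E : e (x + y)%R = e x) by (rewrite <- (Cplus_0_r (e x)), <- Heq; ring).
  destruct (jc_simple_mod _ _ _ _ H E) as [k Hk].
  assert (Hk' : 2 * PI * IZR (- k) = y) by (rewrite opp_IZR; lra).
  assert (K1 : (0 < - k)%Z) by (apply lt_IZR; nra).
  assert (K2 : 1 <= IZR (- k)) by (apply IZR_le; lia).
  nra. }
assert (Hfar : forall s t, r <= Rabs (t - s) <= PI -> m2 <= Cmod (e t - e s)).
{ assert (Hf1 : forall s t, r <= t - s <= PI -> m2 <= Cmod (e t - e s)).
  { intros s t Hst. destruct (mod_2pi s) as [k Hk].
    pose proof (Hm2b (s + 2 * PI * IZR k) (t - s) ltac:(lra) Hst) as Q. simpl in Q.
    replace (s + 2 * PI * IZR k + (t - s)) with (t + 2 * PI * IZR k) in Q by ring.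
    rewrite !(periodic2pi_Z e) in Q by apply Hp. exact Q. }
  intros s t Hst. destruct (Rle_dec s t).
  - rewrite Rabs_pos_eq in Hst by lra. auto.
  - rewrite Rabs_left in Hst by lra. rewrite Cmod_minus_sym. apply Hf1. lra. }
(* Near the point, [m / 2] from the linear part minus [m / 4] from the remainder leaves [m / 4].
   Away from it, [m2 - m2 / 2] remains while [pdist + Rabs d] is at most 2, which gives [m2 / 4]. *)
exists L, (Rmin (m / 4) (m2 / 4)), (Rmin 1 (m2 / (2 * L))).
constructor.
- exact HL.
- apply Rmin_pos; lra.
- apply Rmin_pos; [lra|apply Rdiv_lt_0_compat; lra].
- intros t. pose proof (HL1b t). unfold L. lra.
- exact Hlip'.
- exact Hlip.
- exact Htay.
- intros s t d Hd.
  assert (Hd1 : Rabs d <= 1) by (eapply Rle_trans; [exact Hd|apply Rmin_l]).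
  assert (HdL : L * Rabs d <= m2 / 2).
  { apply Rle_trans with (L * (m2 / (2 * L))).
    - apply Rmult_le_compat_l; [lra|]. eapply Rle_trans; [exact Hd|apply Rmin_r].
    - right; field; lra. }
  destruct (mod_2pi_centered s t) as [k Hk].
  rewrite <- (periodic2pi_Z e k t Hp), <- (pdist_Z (t - s) k).
  replace (t - s + 2 * PI * IZR k) with (t + 2 * PI * IZR k - s) by ring.
  set (u := t + 2 * PI * IZR k) in *.
  pose proof (pdist_le (u - s)) as Q1. pose proof (pdist_le_1 (u - s)) as Q2. pose proof (pdist_pos (u - s)) as Q3.
  pose proof (Rabs_pos d) as Q4. pose proof (Rabs_pos (u - s)) as Q5.
  pose proof (Rmin_l (m / 4) (m2 / 4)) as M1. pose proof (Rmin_r (m / 4) (m2 / 4)) as M2.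
  destruct (Rle_dec (Rabs (u - s)) r) as [Hn|Hn].
  + pose proof (Htay s u) as T.
    set (X := (e u - e s - Ci * RtoC d * e' s)%C).
    pose proof (Cmod_triangle X (- (e u - e s - RtoC (u - s) * e' s))) as T2.
    rewrite Cmod_opp in T2.
    replace (X + - (e u - e s - RtoC (u - s) * e' s))%C with ((RtoC (u - s) - Ci * RtoC d) * e' s)%C in T2
      by (unfold X; ring).
    rewrite Cmod_mult in T2.
    set (w := (RtoC (u - s) - Ci * RtoC d)%C) in *.
    assert (W1 : Rabs (u - s) <= Cmod w).
    { eapply Rle_trans; [|apply Rabs_fst_Cmod]. right. f_equal. unfold w. simpl. ring. }
    assert (W2 : Rabs d <= Cmod w).
    { eapply Rle_trans; [|apply Rabs_snd_Cmod]. rewrite <- (Rabs_Ropp d). right. f_equal. unfold w. simpl. ring. }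
    pose proof (Hmb s) as Hs.
    (* [Cmod w] dominates [Rabs (u - s)] and [Rabs d], hence their mean. *)
    assert (W3 : m * (Rabs (u - s) + Rabs d) / 2 <= Cmod w * Cmod (e' s)).
    { apply Rle_trans with (Cmod w * m); [nra|]. apply Rmult_le_compat_l; [apply Cmod_ge_0|exact Hs]. }
    rewrite <- pow2_abs in T.
    assert (W4 : L * Rabs (u - s) ^ 2 <= m / 4 * Rabs (u - s)).
    { replace (L * Rabs (u - s) ^ 2) with (L * Rabs (u - s) * Rabs (u - s)) by ring.
      apply Rmult_le_compat_r; [exact Q5|]. apply Rle_trans with (L * r); [|exact HrL].
      apply Rmult_le_compat_l; lra. }
    assert (W5 : Rmin (m / 4) (m2 / 4) * (pdist (u - s) + Rabs d) <= m / 4 * (Rabs (u - s) + Rabs d)).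
    { apply Rmult_le_compat; try lra. apply Rmin_glb; lra. }
    assert (0 <= m * Rabs d) by (apply Rmult_le_pos; lra). lra.
  + pose proof (Hfar s u ltac:(lra)) as T.
    pose proof (Cmod_triangle (e u - e s - Ci * RtoC d * e' s) (Ci * RtoC d * e' s)) as T2.
    replace (e u - e s - Ci * RtoC d * e' s + Ci * RtoC d * e' s)%C with (e u - e s)%C in T2 by ring.
    rewrite !Cmod_mult, Ci_Cmod, Cmod_R in T2.
    assert (W : Rabs d * Cmod (e' s) <= Rabs d * L).
    { apply Rmult_le_compat_l; [lra|]. unfold L. pose proof (HL1b s). lra. }
    assert (W5 : Rmin (m / 4) (m2 / 4) * (pdist (u - s) + Rabs d) <= m2 / 4 * 2).
    { apply Rmult_le_compat; try lra. apply Rmin_glb; lra. }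
    lra.
Qed.

(** * Principal value of the Cauchy kernel *)

Lemma isI_periodic_shift f s : periodic2pi f -> (forall t, contC f t) ->
  isI f s (s + 2 * PI) (RIntC f 0 (2 * PI)).
Proof.
intros Hp Hc.
assert (HI : forall a b, isI f a b (RIntC f a b)).
{ intros a b. apply (@RInt_correct C_R_CompleteNormedModule).
  apply (@ex_RInt_continuous C_R_CompleteNormedModule). intros z _. apply Hc. }
assert (Hs : isI f (2 * PI) (s + 2 * PI) (RIntC f 0 s)).
{ pose proof (@is_RInt_comp_lin C_R_NormedModule f 1 (2 * PI) 0 s (RIntC f (1 * 0 + 2 * PI) (1 * s + 2 * PI)) (HI _ _)) as H.
  apply (@is_RInt_ext C_R_NormedModule _ f) in H.
  - apply (@is_RInt_unique C_R_CompleteNormedModule) in H. unfold RIntC. rewrite H.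
    replace (1 * 0 + 2 * PI) with (2 * PI) by ring. replace (1 * s + 2 * PI) with (s + 2 * PI) by ring. apply HI.
  - intros x _. rewrite Rmult_1_l, Hp. apply (@scal_one R_AbsRing C_R_NormedModule). }
replace (RIntC f 0 (2 * PI)) with (- RIntC f 0 s + (RIntC f 0 (2 * PI) + RIntC f 0 s))%C by ring.
apply isI_Chasles with 0.
- exact (@is_RInt_swap C_R_NormedModule f s 0 _ (HI 0 s)).
- apply isI_Chasles with (2 * PI); [apply HI|exact Hs].
Qed.

Definition cauchy_kernel (e e' : R -> C) (z : C) (t : R) : C := (e' t / (e t - z))%C.

(** On a period that starts at the singular parameter the singularity is met at both ends, hence one
    pole near 0 and one near [2 * PI]. For the point [e s + i d e' s], dividing numerator and
    denominator of the Cauchy kernel by [e' s] gives [1 / (tau - i d)] to leading order. *)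
Definition pole_model (d tau : R) : C :=
  (/ (RtoC tau - Ci * RtoC d) + / (RtoC (tau - 2 * PI) - Ci * RtoC d))%C.

Lemma Cmod_pole_ge_l tau d : Rabs tau <= Cmod (RtoC tau - Ci * RtoC d).
Proof. eapply Rle_trans; [|apply Rabs_fst_Cmod]. right. f_equal. simpl. ring. Qed.

Lemma pole_nz tau d : tau <> 0 \/ d <> 0 -> (RtoC tau - Ci * RtoC d)%C <> RtoC 0.
Proof.
intros H E. pose proof (f_equal fst E) as E1. pose proof (f_equal snd E) as E2. simpl in E1, E2.
destruct H; lra.
Qed.

Lemma pole_inv_components tau d : tau <> 0 \/ d <> 0 ->
  (/ (RtoC tau - Ci * RtoC d))%C = (tau / (tau ^ 2 + d ^ 2), d / (tau ^ 2 + d ^ 2)).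
Proof.
intros H. assert (tau ^ 2 + d ^ 2 <> 0) by (destruct H; nra).
apply injective_projections; simpl; field; repeat split; nra.
Qed.

Lemma pow2_plus_pow2_nz x d : d <> 0 -> x ^ 2 + d ^ 2 <> 0.
Proof. intros Hd. pose proof (pow2_gt_0 d Hd). pose proof (pow2_ge_0 x). lra. Qed.

(** This is where the jump comes from: the value tends to [PI] or [- PI] as [d] tends to 0 from
    above or from below. *)
Lemma isI_pole_model_snd s d : d <> 0 ->
  is_RInt (fun t => d / ((t - s) ^ 2 + d ^ 2) + d / ((t - s - 2 * PI) ^ 2 + d ^ 2)) s (s + 2 * PI)
    (2 * atan (2 * PI / d)).
Proof.
intros Hd.
replace (2 * atan (2 * PI / d)) with
  (minus (atan ((s + 2 * PI - s) / d) + atan ((s + 2 * PI - s - 2 * PI) / d)) (atan ((s - s) / d) + atan ((s - s - 2 * PI) / d))).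
- apply (is_RInt_derive (V := R_CompleteNormedModule) (fun t => atan ((t - s) / d) + atan ((t - s - 2 * PI) / d))).
  + intros x _. auto_derive; [trivial|]. field. repeat split; auto using pow2_plus_pow2_nz.
  + intros x _. apply (ex_derive_continuous (K := R_AbsRing) (V := R_NormedModule)). auto_derive. repeat split; apply pow2_plus_pow2_nz; exact Hd.
- unfold minus, plus, opp; simpl.
  replace ((s + 2 * PI - s) / d) with (2 * PI / d) by (field; auto).
  replace ((s + 2 * PI - s - 2 * PI) / d) with 0 by (field; auto).
  replace ((s - s) / d) with 0 by (field; auto).
  replace ((s - s - 2 * PI) / d) with (- (2 * PI / d)) by (field; auto).
  rewrite atan_opp, atan_0. ring.
Qed.

(** The logarithmic antiderivative takes equal values at the two ends, by reflection in the midpoint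
    [s + PI]. The truncation [e] is carried along so that the principal value at [d = 0] is covered
    too. *)
Lemma isI_pole_model_fst s d e : 0 <= e < PI -> d <> 0 \/ 0 < e ->
  is_RInt (fun t => (t - s) / ((t - s) ^ 2 + d ^ 2) + (t - s - 2 * PI) / ((t - s - 2 * PI) ^ 2 + d ^ 2))
    (s + e) (s + 2 * PI - e) 0.
Proof.
intros He Hd. pose proof PI_RGT_0.
assert (Hpos : forall t, s + e <= t <= s + 2 * PI - e -> 0 < (t - s) ^ 2 + d ^ 2 /\ 0 < (t - s - 2 * PI) ^ 2 + d ^ 2).
{ intros t Ht. destruct Hd as [Hd|Hd].
  - assert (0 < d ^ 2) by (apply pow2_gt_0; exact Hd). pose proof (pow2_ge_0 (t - s)). pose proof (pow2_ge_0 (t - s - 2 * PI)). lra.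
  - assert (0 < (t - s) ^ 2) by (apply pow2_gt_0; lra). assert (0 < (t - s - 2 * PI) ^ 2) by (apply pow2_gt_0; lra).
    pose proof (pow2_ge_0 d). lra. }
set (G := fun t => / 2 * ln ((t - s) ^ 2 + d ^ 2) + / 2 * ln ((t - s - 2 * PI) ^ 2 + d ^ 2)).
replace 0 with (minus (G (s + 2 * PI - e)) (G (s + e))).
- apply (is_RInt_derive (V := R_CompleteNormedModule) G).
  + intros x Hx. rewrite Rmin_left, Rmax_right in Hx by lra. destruct (Hpos x Hx) as [P1 P2].
    unfold G. auto_derive; [simpl in P1, P2; split; [|split; [|trivial]]; lra|]. field. split; lra.
  + intros x Hx. rewrite Rmin_left, Rmax_right in Hx by lra. destruct (Hpos x Hx) as [P1 P2].
    apply (ex_derive_continuous (K := R_AbsRing) (V := R_NormedModule)). auto_derive. simpl in P1, P2. repeat split; lra.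
- unfold G, minus, plus, opp; simpl.
  replace ((s + 2 * PI - e - s) * ((s + 2 * PI - e - s) * 1)) with ((s + e - s - 2 * PI) * ((s + e - s - 2 * PI) * 1)) by ring.
  replace ((s + 2 * PI - e - s - 2 * PI) * ((s + 2 * PI - e - s - 2 * PI) * 1)) with ((s + e - s) * ((s + e - s) * 1)) by ring.
  ring.
Qed.

Lemma improper_pole_model_0 s : improper (fun t => pole_model 0 (t - s)) s (s + 2 * PI) (RtoC 0).
Proof.
exists (fun _ => RtoC 0). split; [|apply filterlim_const].
intros e He. replace (s + 2 * PI - s) with (2 * PI) in He by ring.
apply isI_components. split.
- apply (is_RInt_ext (V := R_NormedModule)) with (2 := isI_pole_model_fst s 0 e ltac:(lra) ltac:(lra)).
  rewrite Rmin_left, Rmax_right by lra. intros t Ht. unfold pole_model.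
  rewrite !pole_inv_components by (left; lra). reflexivity.
- apply (is_RInt_ext (V := R_NormedModule) (fun _ => 0)).
  + rewrite Rmin_left, Rmax_right by lra. intros t Ht. unfold pole_model.
    rewrite !pole_inv_components by (left; lra). simpl. unfold Rdiv. ring.
  + replace (snd (RtoC 0)) with (scal (s + 2 * PI - e - (s + e)) 0) by (unfold scal; simpl; unfold mult; simpl; ring).
    apply (is_RInt_const (V := R_NormedModule)).
Qed.

Lemma isI_pole_model s d : d <> 0 ->
  isI (fun t => pole_model d (t - s)) s (s + 2 * PI) (Ci * RtoC (2 * atan (2 * PI / d)))%C.
Proof.
intros Hd. pose proof PI_RGT_0. apply isI_components. split.
- pose proof (isI_pole_model_fst s d 0 ltac:(lra) ltac:(auto)) as P.
  rewrite Rplus_0_r, Rminus_0_r in P.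
  replace (fst (Ci * RtoC (2 * atan (2 * PI / d)))%C) with 0 by (simpl; ring).
  apply (is_RInt_ext (V := R_NormedModule)) with (2 := P).
  intros t Ht. unfold pole_model. rewrite !pole_inv_components by (right; exact Hd). reflexivity.
- replace (snd (Ci * RtoC (2 * atan (2 * PI / d)))%C) with (2 * atan (2 * PI / d)) by (simpl; ring).
  apply (is_RInt_ext (V := R_NormedModule)) with (2 := isI_pole_model_snd s d Hd).
  intros t Ht. unfold pole_model. rewrite !pole_inv_components by (right; exact Hd). reflexivity.
Qed.

Lemma Cmod_div_le (x y : C) (a b : R) : 0 < b -> Cmod x <= a -> b <= Cmod y -> Cmod (x / y) <= a / b.
Proof.
intros Hb Hx Hy. assert (Hy0 : y <> 0) by (intros ->; rewrite Cmod_0 in Hy; lra).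
rewrite Cmod_div by exact Hy0. pose proof (Cmod_ge_0 x).
apply Rmult_le_compat; try assumption.
- left. apply Rinv_0_lt_compat. lra.
- apply Rinv_le_contravar; assumption.
Qed.

(** Trades a bounded estimate and a small but too singular one for something in between, since
    [min(1, x) <= x ^ a] for [0 <= a <= 1]. *)
Lemma Rpower_interpolate y B x a : 0 <= B -> 0 < x -> 0 <= a <= 1 -> y <= B -> y <= B * x -> y <= B * Rpower x a.
Proof.
intros HB Hx Ha H1 H2. destruct (Rle_dec x 1) as [Hx1|Hx1].
- eapply Rle_trans; [exact H2|]. apply Rmult_le_compat_l; [exact HB|].
  rewrite <- (Rpower_1 x Hx) at 1. replace (Rpower x 1) with (Rpower x (a + (1 - a))) by (f_equal; ring).
  rewrite Rpower_plus. rewrite <- (Rmult_1_r (Rpower x a)) at 2.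
  apply Rmult_le_compat_l; [left; apply Rpower_pos|].
  apply Rle_trans with (Rpower 1 (1 - a)); [apply Rle_Rpower_l; lra|].
  unfold Rpower. rewrite ln_1, Rmult_0_r, exp_0. lra.
- eapply Rle_trans; [exact H1|]. rewrite <- (Rmult_1_r B) at 1. apply Rmult_le_compat_l; [exact HB|].
  rewrite <- (Rpower_O x Hx). apply Rle_Rpower; lra.
Qed.

Lemma filterlim_two_values {T : Type} (F : (T -> Prop) -> Prop) {FF : ProperFilter F} (f : T -> C) (l a b : C) :
  filterlim f F (locally l) -> F (fun x => f x = a \/ f x = b) -> l = a \/ l = b.
Proof.
intros Hl Hab. destruct (classic (l = a)) as [Ha|Ha]; [left; exact Ha|]. destruct (classic (l = b)) as [Hb|Hb]; [right; exact Hb|]. exfalso.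
assert (Ha' : 0 < Cmod (a - l)) by (apply Cmod_gt_0; intros E; apply Ha; rewrite <- (Cplus_0_r l), <- E; ring).
assert (Hb' : 0 < Cmod (b - l)) by (apply Cmod_gt_0; intros E; apply Hb; rewrite <- (Cplus_0_r l), <- E; ring).
pose proof (proj1 (filterlim_Cmod F f l) Hl (mkposreal _ (Rmin_pos _ _ Ha' Hb'))) as H.
destruct (filter_ex _ (filter_and _ _ H Hab)) as [x [Hx1 Hx2]]. simpl in Hx1.
pose proof (Rmin_l (Cmod (a - l)) (Cmod (b - l))). pose proof (Rmin_r (Cmod (a - l)) (Cmod (b - l))).
destruct Hx2 as [E|E]; rewrite E in Hx1; lra.
Qed.

Section Kernel.
Context (e e' : R -> C) (L c d0 : R).
Context (J : jordan_curve e e') (B : curve_bounds e e' L c d0).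

(** A point of the normal at [e s]: multiplication by [Ci] turns the tangent a quarter to the left,
    and the sign of [d] selects the side. *)
Let z (s d : R) : C := (e s + Ci * RtoC d * e' s)%C.

Lemma normal_separation s d t : Rabs d <= d0 -> c * (pdist (t - s) + Rabs d) <= Cmod (e t - z s d).
Proof.
intros Hd. unfold z. replace (e t - _)%C with (e t - e s - Ci * RtoC d * e' s)%C by ring.
apply (cb_transversal _ _ _ _ _ B). exact Hd.
Qed.

Lemma chord_arc s t : c * pdist (t - s) <= Cmod (e t - e s).
Proof.
pose proof (cb_transversal _ _ _ _ _ B s t 0) as H. rewrite Rabs_R0, Rplus_0_r in H.
replace (e t - e s - Ci * RtoC 0 * e' s)%C with (e t - e s)%C in H by ring.
apply H. left. apply (cb_d0 _ _ _ _ _ B).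
Qed.

Lemma chord_nz s t : s < t < s + 2 * PI -> (e t - e s)%C <> RtoC 0.
Proof.
intros Ht E. pose proof (chord_arc s t) as H. rewrite E, Cmod_0 in H.
pose proof (pdist_gt_0 (t - s) ltac:(lra)). pose proof (cb_c _ _ _ _ _ B). nra.
Qed.

Lemma normal_nz s d t : d <> 0 -> Rabs d <= d0 -> (e t - z s d)%C <> RtoC 0.
Proof.
intros Hd0 Hd E. pose proof (normal_separation s d t Hd) as H. rewrite E, Cmod_0 in H.
pose proof (Rabs_pos_lt d Hd0). pose proof (pdist_pos (t - s)). pose proof (cb_c _ _ _ _ _ B). nra.
Qed.

(** Over a common denominator the numerator is [(e'(s + tau) - e' s) (tau - i d)] minus the
    first-order Taylor remainder of [e]. Both terms are at most [L |tau| (|tau| + |d|)], and the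
    denominator is at least [c / 6] times [|tau| (|tau| + |d|)]; so the constant is 2 times 6, the 6
    coming from [pdist_ge]. *)
Lemma kernel_minus_pole_bound s d tau : Rabs d <= d0 -> Rabs tau <= PI -> tau <> 0 ->
  Cmod (cauchy_kernel e e' (z s d) (s + tau) - / (RtoC tau - Ci * RtoC d)) <= 12 * L / c.
Proof.
intros Hd Ht Ht0. pose proof (cb_c _ _ _ _ _ B) as Hc. pose proof (cb_L _ _ _ _ _ B) as HL.
pose proof (Rabs_pos_lt tau Ht0) as Htp. pose proof (Rabs_pos d) as Hdp.
pose proof (normal_separation s d (s + tau) Hd) as HN. replace (s + tau - s) with tau in HN by ring.
pose proof (pdist_ge tau Ht) as Hp.
assert (HN' : c / 6 * (Rabs tau + Rabs d) <= Cmod (e (s + tau) - z s d)) by nra.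
pose proof (Cmod_pole_ge_l tau d) as HP.
assert (nz1 : (e (s + tau)%R - z s d)%C <> RtoC 0) by (intros E; rewrite E, Cmod_0 in HN'; nra).
assert (nz2 : (RtoC tau - Ci * RtoC d)%C <> RtoC 0) by (apply pole_nz; auto).
unfold cauchy_kernel.
replace (e' (s + tau)%R / (e (s + tau)%R - z s d) - / (RtoC tau - Ci * RtoC d))%C with
  (((e' (s + tau)%R - e' s) * (RtoC tau - Ci * RtoC d) - (e (s + tau)%R - e s - RtoC tau * e' s))
    / ((e (s + tau)%R - z s d) * (RtoC tau - Ci * RtoC d)))%C
  by (unfold z in *; field; split; assumption).
replace (12 * L / c) with (2 * L * Rabs tau * (Rabs tau + Rabs d) / (c / 6 * (Rabs tau + Rabs d) * Rabs tau))
  by (field; repeat split; lra).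
apply Cmod_div_le.
- apply Rmult_lt_0_compat; [|exact Htp]. apply Rmult_lt_0_compat; lra.
- eapply Rle_trans; [apply Cmod_triangle|]. rewrite Cmod_opp, Cmod_mult.
  pose proof (cb_der_lip _ _ _ _ _ B s (s + tau)) as D1. pose proof (cb_taylor _ _ _ _ _ B s (s + tau)) as D2.
  replace (s + tau - s) with tau in D1, D2 by ring. rewrite <- pow2_abs in D2.
  assert (D3 : Cmod (RtoC tau - Ci * RtoC d) <= Rabs tau + Rabs d).
  { eapply Rle_trans; [apply Cmod_triangle|]. rewrite Cmod_opp, Cmod_mult, Ci_Cmod, !Cmod_R. lra. }
  assert (D4 : Cmod (e' (s + tau)%R - e' s) * Cmod (RtoC tau - Ci * RtoC d) <= L * Rabs tau * (Rabs tau + Rabs d)).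
  { apply Rmult_le_compat; try apply Cmod_ge_0; assumption. }
  assert (0 <= L * Rabs tau * Rabs d) by (repeat apply Rmult_le_pos; lra).
  lra.
- rewrite Cmod_mult. apply Rmult_le_compat; try assumption; [|lra].
  apply Rmult_le_pos; lra.
Qed.

Lemma cauchy_kernel_period w t : cauchy_kernel e e' w (t + 2 * PI) = cauchy_kernel e e' w t.
Proof. unfold cauchy_kernel. rewrite (jc_per _ _ J), (jc_per' _ _ J). reflexivity. Qed.

(** The nearer pole is compared with the kernel; the other one is at distance at least 1 and
    accounts for the summand 1. In the second half of the period the kernel is first moved back by
    [2 * PI]. *)
Lemma kernel_minus_model_bound s d t : Rabs d <= d0 -> s < t < s + 2 * PI ->
  Cmod (cauchy_kernel e e' (z s d) t - pole_model d (t - s)) <= 12 * L / c + 1.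
Proof.
intros Hd Ht. pose proof PI2_3_2 as HPI. unfold PI2 in HPI.
assert (Hinv : forall x, 1 <= Rabs x -> Cmod (/ (RtoC x - Ci * RtoC d)) <= 1).
{ intros x Hx. pose proof (Cmod_pole_ge_l x d) as H.
  assert (x <> 0) by (intros ->; rewrite Rabs_R0 in Hx; lra).
  rewrite Cmod_inv by (apply pole_nz; auto). rewrite <- Rinv_1. apply Rinv_le_contravar; lra. }
unfold pole_model. destruct (Rle_dec (t - s) PI) as [Hle|Hgt].
- replace (cauchy_kernel e e' (z s d) t - _)%C with
    ((cauchy_kernel e e' (z s d) (s + (t - s)) - / (RtoC (t - s) - Ci * RtoC d)) + - (/ (RtoC (t - s - 2 * PI) - Ci * RtoC d)))%C
    by (replace (s + (t - s)) with t by ring; ring).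
  eapply Rle_trans; [apply Cmod_triangle|]. rewrite Cmod_opp. apply Rplus_le_compat.
  + apply kernel_minus_pole_bound; [exact Hd| |lra]. apply Rabs_le. lra.
  + apply Hinv. rewrite Rabs_left; lra.
- replace (cauchy_kernel e e' (z s d) t - _)%C with
    ((cauchy_kernel e e' (z s d) (s + (t - s - 2 * PI)) - / (RtoC (t - s - 2 * PI) - Ci * RtoC d)) + - (/ (RtoC (t - s) - Ci * RtoC d)))%C.
  2: { rewrite <- (cauchy_kernel_period (z s d) (s + (t - s - 2 * PI))).
       replace (s + (t - s - 2 * PI) + 2 * PI) with t by ring. ring. }
  eapply Rle_trans; [apply Cmod_triangle|]. rewrite Cmod_opp. apply Rplus_le_compat.
  + apply kernel_minus_pole_bound; [exact Hd| |lra]. apply Rabs_le. lra.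
  + apply Hinv. rewrite Rabs_pos_eq; lra.
Qed.

Lemma z_0 s : z s 0 = e s.
Proof. unfold z. apply injective_projections; simpl; ring. Qed.

(** Allows [d] to tend to 0 under the integral. The expression is bounded, and it is also of order
    [|d| / p ^ 2] with [p = pdist (t - s)], which is small in [d] but not integrable. Interpolation
    with exponent 1/4 yields the rate [|d| ^ (1/4)] against the integrable weight [p ^ (-1/2)]. *)
Lemma kernel_difference_bound s d t : Rabs d <= d0 -> d <> 0 -> s < t < s + 2 * PI ->
  Cmod ((cauchy_kernel e e' (z s d) t - pole_model d (t - s)) - (cauchy_kernel e e' (e s) t - pole_model 0 (t - s)))
  <= (2 * (12 * L / c + 1) + (L * L / (c * c) + 2)) * (Rpower (Rabs d) (/ 4) * Rpower (pdist (t - s)) (/ 2 - 1)).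
Proof.
intros Hd Hd0 Ht. pose proof (cb_c _ _ _ _ _ B) as Hc. pose proof (cb_L _ _ _ _ _ B) as HL.
pose proof (pdist_gt_0 (t - s) ltac:(lra)) as Hp. pose proof (Rabs_pos_lt d Hd0) as Hdp.
set (p := pdist (t - s)) in *.
assert (Q1 : 0 < 12 * L / c) by (apply Rdiv_lt_0_compat; lra).
assert (Hcc : 0 < c * c) by (apply Rmult_lt_0_compat; lra).
assert (Hpp : 0 < p * p) by (apply Rmult_lt_0_compat; lra).
assert (HLL : 0 < L * L) by (apply Rmult_lt_0_compat; lra).
assert (Q2 : 0 < L * L / (c * c)) by (apply Rdiv_lt_0_compat; assumption).
replace (Rpower (Rabs d) (/ 4) * Rpower p (/ 2 - 1)) with (Rpower (Rabs d / (p * p)) (/ 4)).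
2: { unfold Rdiv. rewrite <- Rpower_mult_distr; [|lra|apply Rinv_0_lt_compat; lra]. f_equal.
     replace (/ (p * p)) with (Rpower p (- (2))).
     - rewrite Rpower_mult. f_equal. field.
     - rewrite Rpower_Ropp. f_equal. replace 2 with (1 + 1) by ring. rewrite Rpower_plus, Rpower_1 by exact Hp. reflexivity. }
apply Rpower_interpolate; [lra|apply Rdiv_lt_0_compat; lra|lra| |].
- eapply Rle_trans; [apply Cmod_triangle|]. rewrite Cmod_opp.
  pose proof (kernel_minus_model_bound s d t Hd Ht) as K1.
  pose proof (kernel_minus_model_bound s 0 t ltac:(rewrite Rabs_R0; left; apply (cb_d0 _ _ _ _ _ B)) Ht) as K2.
  rewrite z_0 in K2. lra.
- assert (nz1 := normal_nz s d t Hd0 Hd). assert (nz2 := chord_nz s t Ht).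
  assert (Hdiff : (cauchy_kernel e e' (z s d) t - cauchy_kernel e e' (e s) t)%C =
      ((e' t * (Ci * RtoC d * e' s)) / ((e t - z s d) * (e t - e s)))%C).
  { unfold cauchy_kernel. unfold z in *. field. split; assumption. }
  assert (Hpole : forall x, x <> 0 -> (/ (RtoC x - Ci * RtoC d) - / (RtoC x - Ci * RtoC 0))%C = ((Ci * RtoC d) / ((RtoC x - Ci * RtoC d) * (RtoC x - Ci * RtoC 0)))%C).
  { intros x Hx. field.
    split; first [apply pole_nz; auto | intros E; apply Hx; exact (f_equal fst E)]. }
  assert (HpoleB : forall x, x <> 0 -> p <= Rabs x -> Cmod (/ (RtoC x - Ci * RtoC d) - / (RtoC x - Ci * RtoC 0)) <= Rabs d / (p * p)).
  { intros x Hx Hpx. rewrite Hpole by exact Hx. apply Cmod_div_le; [lra| |].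
    - rewrite Cmod_mult, Ci_Cmod, Cmod_R. lra.
    - rewrite Cmod_mult. pose proof (Cmod_pole_ge_l x d). pose proof (Cmod_pole_ge_l x 0).
      apply Rmult_le_compat; lra. }
  unfold pole_model.
  replace (_ - _)%C with ((cauchy_kernel e e' (z s d) t - cauchy_kernel e e' (e s) t)
     + - ((/ (RtoC (t - s) - Ci * RtoC d) - / (RtoC (t - s) - Ci * RtoC 0))
     + (/ (RtoC (t - s - 2 * PI) - Ci * RtoC d) - / (RtoC (t - s - 2 * PI) - Ci * RtoC 0))))%C by ring.
  eapply Rle_trans; [apply Cmod_triangle|]. rewrite Cmod_opp.
  assert (P1 : p <= Rabs (t - s)) by (unfold p; pose proof (pdist_le (t - s)); pose proof (Rabs_pos (t - s)); lra).
  assert (P2 : p <= Rabs (t - s - 2 * PI)).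
  { unfold p. replace (pdist (t - s)) with (pdist (t - s - 2 * PI)) by (rewrite <- pdist_period; f_equal; ring).
    pose proof (pdist_le (t - s - 2 * PI)); pose proof (Rabs_pos (t - s - 2 * PI)); lra. }
  assert (A1 : Cmod (cauchy_kernel e e' (z s d) t - cauchy_kernel e e' (e s) t) <= L * L / (c * c) * (Rabs d / (p * p))).
  { rewrite Hdiff. replace (L * L / (c * c) * (Rabs d / (p * p))) with ((L * (Rabs d * L)) / ((c * p) * (c * p))) by (field; lra).
    apply Cmod_div_le.
    - apply Rmult_lt_0_compat; apply Rmult_lt_0_compat; lra.
    - rewrite !Cmod_mult, Ci_Cmod, Cmod_R, Rmult_1_l. pose proof (cb_der_bound _ _ _ _ _ B t). pose proof (cb_der_bound _ _ _ _ _ B s).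
      apply Rmult_le_compat; try assumption; [apply Cmod_ge_0| |].
      + apply Rmult_le_pos; [lra|apply Cmod_ge_0].
      + apply Rmult_le_compat_l; lra.
    - rewrite Cmod_mult. pose proof (normal_separation s d t Hd) as S1. pose proof (chord_arc s t) as S2. fold p in S1, S2.
      assert (0 <= c * p) by (apply Rmult_le_pos; lra).
      apply Rmult_le_compat; try assumption. nra. }
  pose proof (Cmod_triangle (/ (RtoC (t - s) - Ci * RtoC d) - / (RtoC (t - s) - Ci * RtoC 0))
     (/ (RtoC (t - s - 2 * PI) - Ci * RtoC d) - / (RtoC (t - s - 2 * PI) - Ci * RtoC 0))) as A2.
  pose proof (HpoleB (t - s) ltac:(lra) P1) as A3.
  pose proof (HpoleB (t - s - 2 * PI) ltac:(lra) P2) as A4.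
  assert (0 < Rabs d / (p * p)) by (apply Rdiv_lt_0_compat; lra).
  assert (0 < 12 * L / c * (Rabs d / (p * p))) by (apply Rmult_lt_0_compat; lra).
  lra.
Qed.

Lemma contC_cauchy_kernel w t : (e t - w)%C <> RtoC 0 -> contC (cauchy_kernel e e' w) t.
Proof.
intros H. unfold cauchy_kernel. apply contC_div; [exact H|eapply jc_cont'; eauto|].
apply contC_minus; [eapply jc_cont; eauto|apply contC_const].
Qed.

Lemma contC_pole_model s d t : t - s <> 0 -> t - s <> 2 * PI -> contC (fun t => pole_model d (t - s)) t.
Proof.
intros H1 H2. unfold pole_model.
assert (Hr : forall a, contC (fun t => RtoC (t - a)) t).
{ intros a. apply contC_RtoC. apply (ex_derive_continuous (K := R_AbsRing) (V := R_NormedModule)). auto_derive; trivial. }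
assert (Hp : forall a, t - a <> 0 -> contC (fun t => / (RtoC (t - a) - Ci * RtoC d))%C t).
{ intros a Ha. apply filterlim_Cinv; [apply pole_nz; auto|].
  apply filterlim_Cminus; [apply locally_filter|apply Hr|apply filterlim_const]. }
apply contC_plus; [apply Hp; exact H1|].
assert (Q := Hp (s + 2 * PI) ltac:(lra)). unfold contC in *.
replace (t - s - 2 * PI) with (t - (s + 2 * PI)) by ring.
eapply filterlim_ext; [|exact Q]. intros x. simpl. replace (x - s - 2 * PI) with (x - (s + 2 * PI)) by ring. reflexivity.
Qed.

Lemma improper_cauchy_kernel s :
  (forall w, (forall t, w <> e t) -> RIntC (cauchy_kernel e e' w) 0 (2 * PI) = RtoC 0
     \/ RIntC (cauchy_kernel e e' w) 0 (2 * PI) = (- (RtoC (2 * PI) * Ci))%C) ->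
  improper (cauchy_kernel e e' (e s)) s (s + 2 * PI) (- (RtoC PI * Ci))%C.
Proof.
intros HW. pose proof PI_RGT_0 as HPI. pose proof (cb_c _ _ _ _ _ B) as Hc. pose proof (cb_L _ _ _ _ _ B) as HL.
pose proof (cb_d0 _ _ _ _ _ B) as Hd0.
assert (Q1 : 0 < 12 * L / c) by (apply Rdiv_lt_0_compat; lra).
assert (Q2 : 0 < L * L / (c * c)) by (apply Rdiv_lt_0_compat; apply Rmult_lt_0_compat; lra).
destruct (improper_exists 1 ltac:(lra)) as [K1 [_ HK1]].
destruct (HK1 (fun t => cauchy_kernel e e' (e s) t - pole_model 0 (t - s))%C s (12 * L / c + 1)) as [E0 [HE0 _]].
{ lra. }
{ intros t Ht. apply contC_minus; [apply contC_cauchy_kernel, chord_nz, Ht|apply contC_pole_model; lra]. }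
{ intros t Ht. rewrite Rminus_diag, Rpower_O, Rmult_1_r by (apply pdist_gt_0; lra).
  rewrite <- (z_0 s). apply kernel_minus_model_bound; [rewrite Rabs_R0; lra|exact Ht]. }
(* The model with [d = 0] has principal value 0, so the integral [E0] of the bounded remainder is
   already the principal value of the kernel. *)
assert (HPV : improper (cauchy_kernel e e' (e s)) s (s + 2 * PI) E0).
{ pose proof (improper_plus _ _ _ _ _ _ HE0 (improper_pole_model_0 s)) as H.
  rewrite Cplus_0_r in H. eapply improper_ext; [|exact H]. intros t _. simpl. ring. }
destruct (improper_exists (/ 2) ltac:(lra)) as [K2 [HK20 HK2]].
set (C3 := 2 * (12 * L / c + 1) + (L * L / (c * c) + 2)).
assert (Hmain : forall d, d <> 0 -> Rabs d <= d0 ->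
  Cmod (RIntC (cauchy_kernel e e' (z s d)) 0 (2 * PI) - Ci * RtoC (2 * atan (2 * PI / d)) - E0) <= K2 * (C3 * Rpower (Rabs d) (/ 4))).
{ intros d Hdn Hd.
  set (W := RIntC (cauchy_kernel e e' (z s d)) 0 (2 * PI)).
  assert (HWi : improper (cauchy_kernel e e' (z s d)) s (s + 2 * PI) W).
  { assert (Hct : forall t, contC (cauchy_kernel e e' (z s d)) t) by (intros t; apply contC_cauchy_kernel, normal_nz; assumption).
    pose proof (isI_periodic_shift _ s (cauchy_kernel_period (z s d)) Hct) as H.
    unfold W. rewrite <- (isI_unique _ _ _ _ H). apply improper_proper; [lra|auto]. }
  assert (Hmi : improper (fun t => pole_model d (t - s)) s (s + 2 * PI) (Ci * RtoC (2 * atan (2 * PI / d)))%C).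
  { rewrite <- (isI_unique _ _ _ _ (isI_pole_model s d Hdn)). apply improper_proper; [lra|].
    intros t _. unfold pole_model.
    assert (Hr : forall a, contC (fun t => / (RtoC (t - a) - Ci * RtoC d))%C t).
    { intros a. apply filterlim_Cinv; [apply pole_nz; auto|].
      apply filterlim_Cminus; [apply locally_filter| |apply filterlim_const].
      apply (contC_RtoC (fun t => t - a) t). apply (ex_derive_continuous (K := R_AbsRing) (V := R_NormedModule)). auto_derive; trivial. }
    apply contC_plus; [apply Hr|]. pose proof (Hr (s + 2 * PI)) as Q. unfold contC in *.
    replace (t - s - 2 * PI) with (t - (s + 2 * PI)) by ring.
    eapply filterlim_ext; [|exact Q]. intros x. simpl. replace (x - s - 2 * PI) with (x - (s + 2 * PI)) by ring. reflexivity. }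
  pose proof (improper_minus _ _ _ _ _ _ (improper_minus _ _ _ _ _ _ HWi Hmi) HE0) as HD.
  destruct (HK2 (fun t => (cauchy_kernel e e' (z s d) t - pole_model d (t - s)) - (cauchy_kernel e e' (e s) t - pole_model 0 (t - s)))%C
    s (C3 * Rpower (Rabs d) (/ 4))) as [l [Hl1 Hl2]].
  { apply Rmult_le_pos; [unfold C3; lra|left; apply Rpower_pos]. }
  { intros t Ht. apply contC_minus; apply contC_minus.
    - apply contC_cauchy_kernel, normal_nz; assumption.
    - apply contC_pole_model; lra.
    - apply contC_cauchy_kernel, chord_nz; assumption.
    - apply contC_pole_model; lra. }
  { intros t Ht. rewrite Rmult_assoc. apply kernel_difference_bound; assumption. }
  assert (Hss : s < s + 2 * PI) by lra.
  rewrite (improper_unique _ _ _ _ _ Hss HD Hl1). exact Hl2. }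
(* [sg] is the side of the curve. There the model contributes [i sg PI] in the limit, and the
   remainder tends to [E0] at the rate [d ^ (1/4)]. *)
assert (Hlim : forall sg, sg = 1 \/ sg = -1 ->
  filterlim (fun d => RIntC (cauchy_kernel e e' (z s (sg * d))) 0 (2 * PI)) (at_right 0) (locally (Ci * RtoC (sg * PI) + E0)%C)).
{ intros sg Hsg.
  assert (Hab : forall d, 0 < d -> Rabs (sg * d) = d) by (intros d Hd; destruct Hsg as [-> | ->]; [rewrite Rmult_1_l|replace (-1 * d) with (- d) by ring; rewrite Rabs_Ropp]; apply Rabs_pos_eq; lra).
  assert (Hat : filterlim (fun d => 2 * atan (2 * PI / (sg * d))) (at_right 0) (locally (sg * PI))).
  { apply filterlim_ext_loc with (fun d => sg * (PI - 2 * atan (d / (2 * PI)))).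
    - generalize (at_right_lt 1 Rlt_0_1). apply filter_imp. intros d Hd.
      assert (Hi : atan (2 * PI / d) = PI / 2 - atan (d / (2 * PI))).
      { replace (2 * PI / d) with (/ (d / (2 * PI))) by (field; lra). apply atan_inv. apply Rdiv_lt_0_compat; lra. }
      destruct Hsg as [-> | ->].
      + rewrite !Rmult_1_l, Hi. field.
      + replace (2 * PI / (-1 * d)) with (- (2 * PI / d)) by (field; lra). rewrite atan_opp, Hi. field.
    - apply (filterlim_filter_le_1 (F := locally 0)); [intros P; apply filter_le_within|].
      assert (Hcont : continuous (fun d => sg * (PI - 2 * atan (d / (2 * PI)))) 0).
      { apply (ex_derive_continuous (K := R_AbsRing) (V := R_NormedModule)). auto_derive. lra. }
      unfold continuous in Hcont. replace (sg * (PI - 2 * atan (0 / (2 * PI)))) with (sg * PI) in Hcont; [exact Hcont|].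
      unfold Rdiv. rewrite Rmult_0_l, atan_0. ring. }
  assert (Hrest : filterlim (fun d => RIntC (cauchy_kernel e e' (z s (sg * d))) 0 (2 * PI) - Ci * RtoC (2 * atan (2 * PI / (sg * d))) - E0)%C (at_right 0) (locally (RtoC 0))).
  { apply filterlim_Cmod; [apply at_right_proper_filter|]. intros eps.
    assert (HP : filterlim (fun d => K2 * (C3 * Rpower d (/ 4))) (at_right 0) (locally (K2 * (C3 * 0)))).
    { apply (filterlim_comp _ _ _ (fun d => Rpower d (/ 4)) (fun x => K2 * (C3 * x)) _ (locally 0)); [apply Rpower_lim_0; lra|].
      apply (ex_derive_continuous (K := R_AbsRing) (V := R_NormedModule) (fun x => K2 * (C3 * x))). auto_derive. trivial. }
    generalize (filter_and _ _ (at_right_lt d0 Hd0) (proj1 (filterlim_locally _ _) HP eps)).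
    apply filter_imp. intros d [Hd HB]. change (Rabs (K2 * (C3 * Rpower d (/ 4)) - K2 * (C3 * 0)) < eps) in HB.
    pose proof (Hmain (sg * d) ltac:(destruct Hsg as [-> | ->]; lra) ltac:(rewrite Hab; lra)) as HM.
    rewrite Hab in HM by lra.
    replace (_ - RtoC 0)%C with (RIntC (cauchy_kernel e e' (z s (sg * d))) 0 (2 * PI) - Ci * RtoC (2 * atan (2 * PI / (sg * d))) - E0)%C
      by (apply injective_projections; simpl; ring).
    eapply Rle_lt_trans; [exact HM|]. apply Rabs_lt_between in HB. lra. }
  pose proof (filterlim_Cplus (at_right 0) _ _ _ _ (filterlim_Cplus (at_right 0) _ _ _ _ Hrest (filterlim_Cmult (at_right 0) _ _ _ _ (filterlim_Cconst (at_right 0) Ci) (filterlim_RtoC (at_right 0) _ _ Hat))) (filterlim_Cconst (at_right 0) E0)) as H.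
  replace (RtoC 0 + Ci * RtoC (sg * PI) + E0)%C with (Ci * RtoC (sg * PI) + E0)%C in H by ring.
  eapply filterlim_ext; [|exact H]. intros d. simpl. ring. }
assert (Hval : forall sg, sg = 1 \/ sg = -1 ->
  (Ci * RtoC (sg * PI) + E0)%C = RtoC 0 \/ (Ci * RtoC (sg * PI) + E0)%C = (- (RtoC (2 * PI) * Ci))%C).
{ intros sg Hsg. eapply filterlim_two_values; [|apply (Hlim sg Hsg)|]; [apply at_right_proper_filter|].
  generalize (at_right_lt d0 Hd0). apply filter_imp. intros d Hd.
  apply HW. intros t E. apply (normal_nz s (sg * d) t).
  - destruct Hsg as [-> | ->]; lra.
  - destruct Hsg as [-> | ->]; [rewrite Rmult_1_l, Rabs_pos_eq|replace (-1 * d) with (- d) by ring; rewrite Rabs_Ropp, Rabs_pos_eq]; lra.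
  - rewrite E. ring. }
enough (HE : E0 = (- (RtoC PI * Ci))%C) by (rewrite <- HE; exact HPV).
destruct E0 as [x y].
(* The two limits differ by [2 PI i] and each of them is [0] or [- 2 PI i], so the first is [0] and
   the second [- 2 PI i]; the other three combinations are contradictory. *)
destruct (Hval 1 ltac:(auto)) as [H1|H1]; destruct (Hval (-1) ltac:(auto)) as [H2|H2];
  pose proof (f_equal fst H1) as F1; pose proof (f_equal snd H1) as F2;
  pose proof (f_equal fst H2) as F3; pose proof (f_equal snd H2) as F4; simpl in F1, F2, F3, F4;
  apply injective_projections; simpl; lra.
Qed.

End Kernel.

(** * Boundary behaviour of Cauchy integrals *)

(** [Rpower 0 al] equals 1, so the estimate is stated for parameters that differ modulo [2 * PI];
    for the others periodicity makes the left side 0. Measuring with [pdist] makes the condition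
    independent of the choice of period. *)
Record holder_periodic (phi : R -> C) (K al : R) : Prop := {
  hp_per : periodic2pi phi;
  hp_K : 0 <= K;
  hp_al : 0 < al <= 1;
  hp_le : forall s t, 0 < pdist (t - s) -> Cmod (phi t - phi s) <= K * Rpower (pdist (t - s)) al }.

Lemma pdist_le_Rabs x : pdist x <= Rabs x.
Proof. pose proof (pdist_le x). pose proof (Rabs_pos x). lra. Qed.

Lemma pdist_gt_0_centered x : x <> 0 -> Rabs x <= PI -> 0 < pdist x.
Proof. intros Hx H. pose proof (pdist_ge x H). pose proof (Rabs_pos_lt x Hx). lra. Qed.

Lemma holder_periodic_le phi K al s t : holder_periodic phi K al -> s <> t -> Rabs (t - s) <= PI ->
  Cmod (phi t - phi s) <= K * Rpower (Rabs (t - s)) al.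
Proof.
intros H Hst Ht. assert (Hp : 0 < pdist (t - s)) by (apply pdist_gt_0_centered; lra).
eapply Rle_trans; [apply (hp_le _ _ _ H); exact Hp|]. apply Rmult_le_compat_l; [apply H|].
apply Rle_Rpower_l; [left; apply H|]. split; [exact Hp|apply pdist_le_Rabs].
Qed.

Lemma holder_periodic_cont phi K al t : holder_periodic phi K al -> contC phi t.
Proof.
intros H. pose proof (hp_K _ _ _ H) as HK. pose proof (hp_al _ _ _ H) as Hal. pose proof PI_RGT_0.
apply filterlim_Cmod; [apply locally_filter|]. intros eps. pose proof (cond_pos eps) as He.
set (r := Rpower (eps / (K + 1)) (/ al)).
assert (Hr : 0 < Rmin PI r) by (apply Rmin_pos; [lra|apply Rpower_pos]).
exists (mkposreal _ Hr). intros x Hx. change (Rabs (x - t) < Rmin PI r) in Hx.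
destruct (Req_dec x t) as [->|Hxt].
- replace (phi t - phi t)%C with (RtoC 0) by ring. rewrite Cmod_0. exact He.
- pose proof (Rmin_l PI r). pose proof (Rmin_r PI r).
  eapply Rle_lt_trans; [apply (holder_periodic_le _ _ _ _ _ H); [auto|lra]|].
  assert (Rpower (Rabs (x - t)) al < eps / (K + 1)).
  { apply Rlt_le_trans with (Rpower r al).
    - apply Rlt_Rpower_l; [lra|]. split; [apply Rabs_pos_lt; lra|lra].
    - unfold r. rewrite Rpower_mult, Rinv_l, Rpower_1; [lra|apply Rdiv_lt_0_compat; lra|lra]. }
  apply Rle_lt_trans with (K * (eps / (K + 1))); [apply Rmult_le_compat_l; lra|].
  apply Rlt_le_trans with ((K + 1) * (eps / (K + 1))).
  + apply Rmult_lt_compat_r; [apply Rdiv_lt_0_compat; lra|lra].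
  + right. field. lra.
Qed.

(** Both factors are bounded by powers of [p + d] whose exponents add up to 1. A denominator [p + d]
    can thus absorb a share of [p] and a share of [d]. *)
Lemma Rpower_weighted_mean p d b : 0 < p -> 0 < d -> 0 <= b <= 1 -> Rpower d (1 - b) * Rpower p b <= p + d.
Proof.
intros Hp Hd Hb. apply Rle_trans with (Rpower (p + d) (1 - b) * Rpower (p + d) b).
- apply Rmult_le_compat; try (left; apply Rpower_pos); apply Rle_Rpower_l; lra.
- rewrite <- Rpower_plus. replace (1 - b + b) with 1 by ring. rewrite Rpower_1; lra.
Qed.

Section Density.
Context (e e' : R -> C) (L c d0 : R) (phi : R -> C) (K al : R).
Context (J : jordan_curve e e') (B : curve_bounds e e' L c d0) (H : holder_periodic phi K al).

Let cauchy z := RIntC (fun t => phi t * cauchy_kernel e e' z t)%C 0 (2 * PI).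
Let W z := RIntC (cauchy_kernel e e' z) 0 (2 * PI).
Let reg s t := ((phi t - phi s) * cauchy_kernel e e' (e s) t)%C.

(** The Hoelder numerator cancels the power [al] of the simple pole, and the remaining exponent
    [al - 1 > -1] is integrable. *)
Lemma regularized_bound s t : s < t < s + 2 * PI ->
  Cmod (reg s t) <= K * L / c * Rpower (pdist (t - s)) (al - 1).
Proof.
intros Ht. pose proof (cb_c _ _ _ _ _ B) as Hc. pose proof (cb_L _ _ _ _ _ B) as HL. pose proof (hp_K _ _ _ H) as HK.
pose proof (pdist_gt_0 (t - s) ltac:(lra)) as Hp.
unfold reg, cauchy_kernel.
replace ((phi t - phi s) * (e' t / (e t - e s)))%C with (((phi t - phi s) * e' t) / (e t - e s))%C
  by (field; apply (chord_nz e e' L c d0 B); exact Ht).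
replace (K * L / c * Rpower (pdist (t - s)) (al - 1)) with ((K * Rpower (pdist (t - s)) al * L) / (c * pdist (t - s))).
- apply Cmod_div_le.
  + apply Rmult_lt_0_compat; lra.
  + rewrite Cmod_mult. apply Rmult_le_compat; try apply Cmod_ge_0.
    * apply (hp_le _ _ _ H); exact Hp.
    * apply (cb_der_bound _ _ _ _ _ B).
  + apply (chord_arc e e' L c d0 B).
- replace (al - 1) with (al + - (1)) by ring. rewrite Rpower_plus, Rpower_Ropp, Rpower_1 by exact Hp. field. lra.
Qed.

Lemma contC_density_kernel (a w : C) t : (e t - w)%C <> RtoC 0 -> contC (fun t => (phi t - a) * cauchy_kernel e e' w t)%C t.
Proof.
intros Hw. apply contC_mult.
- apply contC_minus; [eapply holder_periodic_cont; eauto|apply contC_const].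
- eapply contC_cauchy_kernel; eauto.
Qed.

Lemma regularized_exists : exists M, 0 <= M /\ forall s, exists l, improper (reg s) s (s + 2 * PI) l /\ Cmod l <= M.
Proof.
pose proof (cb_c _ _ _ _ _ B) as Hc. pose proof (cb_L _ _ _ _ _ B) as HL. pose proof (hp_K _ _ _ H) as HK.
assert (H0 : 0 <= K * L / c) by (apply Rmult_le_pos; [apply Rmult_le_pos; lra|left; apply Rinv_0_lt_compat; lra]).
destruct (improper_exists al (hp_al _ _ _ H)) as [M [HM1 HM2]].
exists (M * (K * L / c)). split; [apply Rmult_le_pos; lra|].
intros s. apply HM2; [exact H0| |].
- intros t Ht. apply contC_density_kernel. apply (chord_nz e e' L c d0 B). exact Ht.
- intros t Ht. apply regularized_bound. exact Ht.
Qed.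

Lemma separation_nz c' s z d t : 0 < c' -> 0 < d -> c' * (pdist (t - s) + d) <= Cmod (e t - z) -> (e t - z)%C <> RtoC 0.
Proof. intros Hc' Hd Hs E. rewrite E, Cmod_0 in Hs. pose proof (pdist_pos (t - s)). nra. Qed.

(** Puts the density [phi t - phi s] under the integral, over the period that starts at [s], so that
    a pointwise comparison with [reg s] becomes possible. *)
Lemma cauchy_difference_improper s z : (forall t, (e t - z)%C <> RtoC 0) ->
  improper (fun t => (phi t - phi s) * cauchy_kernel e e' z t)%C s (s + 2 * PI) (cauchy z - phi s * W z)%C.
Proof.
intros Hz. pose proof PI_RGT_0.
assert (Hct : forall t, contC (cauchy_kernel e e' z) t) by (intros t; eapply contC_cauchy_kernel; eauto).
assert (Hct2 : forall t, contC (fun t => phi t * cauchy_kernel e e' z t)%C t).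
{ intros t. apply contC_mult; [eapply holder_periodic_cont; eauto|apply Hct]. }
assert (H1 : improper (fun t => phi t * cauchy_kernel e e' z t)%C s (s + 2 * PI) (cauchy z)).
{ assert (Hp : periodic2pi (fun t => phi t * cauchy_kernel e e' z t)%C).
  { intros t. rewrite (hp_per _ _ _ H), (cauchy_kernel_period e e' J). reflexivity. }
  unfold cauchy. rewrite <- (isI_unique _ _ _ _ (isI_periodic_shift _ s Hp Hct2)). apply improper_proper; [lra|auto]. }
assert (H2 : improper (cauchy_kernel e e' z) s (s + 2 * PI) (W z)).
{ unfold W. rewrite <- (isI_unique _ _ _ _ (isI_periodic_shift _ s (cauchy_kernel_period e e' J z) Hct)). apply improper_proper; [lra|auto]. }
pose proof (improper_minus _ _ _ _ _ _ H1 (improper_Cmult (phi s) _ _ _ _ H2)) as H3.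
eapply improper_ext; [|exact H3]. intros t _. simpl. ring.
Qed.

(** Here [d] is any scale that separates [z] from the curve and bounds its offset from [e s], not
    necessarily a distance; this freedom lets one [z] be used with several base points. [M] is fixed
    before [s], [z] and [d]. *)
Lemma cauchy_nontangential c' C0 : 0 < c' -> 0 < C0 -> exists M, 0 <= M /\
  forall s z d l, 0 < d -> (forall t, c' * (pdist (t - s) + d) <= Cmod (e t - z)) -> Cmod (z - e s) <= C0 * d ->
  improper (reg s) s (s + 2 * PI) l ->
  Cmod (cauchy z - phi s * W z - l) <= M * Rpower d (al / 2).
Proof.
intros Hc' HC0. pose proof (cb_c _ _ _ _ _ B) as Hc. pose proof (cb_L _ _ _ _ _ B) as HL.
pose proof (hp_K _ _ _ H) as HK. pose proof (hp_al _ _ _ H) as Hal.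
destruct (improper_exists (al / 2) ltac:(lra)) as [M [HM1 HM2]].
set (D := K * L * C0 / (c' * c)).
assert (Hcc : 0 < c' * c) by (apply Rmult_lt_0_compat; assumption).
assert (HD : 0 <= D).
{ unfold D. apply Rmult_le_pos; [|left; apply Rinv_0_lt_compat; exact Hcc]. apply Rmult_le_pos; [apply Rmult_le_pos|]; lra. }
exists (M * D). split; [apply Rmult_le_pos; lra|].
intros s z d l Hd Hsep Hz Hl.
assert (Hnz : forall t, (e t - z)%C <> RtoC 0) by (intros t; apply (separation_nz c' s z d t); auto).
pose proof (improper_minus _ _ _ _ _ _ (cauchy_difference_improper s z Hnz) Hl) as HI.
destruct (HM2 (fun t => (phi t - phi s) * cauchy_kernel e e' z t - reg s t)%C s (D * Rpower d (al / 2))) as [l' [Hl1 Hl2]].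
{ apply Rmult_le_pos; [exact HD|left; apply Rpower_pos]. }
{ intros t Ht. apply contC_minus; apply contC_density_kernel; [apply Hnz|]. apply (chord_nz e e' L c d0 B). exact Ht. }
{ intros t Ht. pose proof (pdist_gt_0 (t - s) ltac:(lra)) as Hp.
  pose proof (hp_le _ _ _ H s t Hp) as Hphi. pose proof (chord_arc e e' L c d0 B s t) as Hch. pose proof (Hsep t) as Hst.
  assert (nz2 := chord_nz e e' L c d0 B s t Ht).
  set (p := pdist (t - s)) in *.
  replace ((phi t - phi s) * cauchy_kernel e e' z t - reg s t)%C with
    (((phi t - phi s) * e' t * (z - e s)) / ((e t - z) * (e t - e s)))%C
    by (unfold reg, cauchy_kernel; field; split; [exact nz2|apply Hnz]).
  apply Rle_trans with ((K * Rpower p al * L * (C0 * d)) / ((c' * (p + d)) * (c * p))).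
  - apply Cmod_div_le.
    + repeat apply Rmult_lt_0_compat; lra.
    + rewrite !Cmod_mult. apply Rmult_le_compat; try apply Cmod_ge_0; [apply Rmult_le_pos; apply Cmod_ge_0| |exact Hz].
      apply Rmult_le_compat; try apply Cmod_ge_0; [exact Hphi|apply (cb_der_bound _ _ _ _ _ B)].
    + rewrite Cmod_mult. apply Rmult_le_compat; try assumption; apply Rmult_le_pos; lra.
  (* Split [p ^ al = p ^ (al/2) p ^ (al/2)] and [d = d ^ (al/2) d ^ (1 - al/2)]: the factors
     [p ^ (al/2)] and [d ^ (1 - al/2)] are absorbed by [p + d], and [d ^ (al/2) p ^ (al/2 - 1)] is
     left. *)
  - pose proof (Rpower_weighted_mean p d (al / 2) Hp Hd ltac:(lra)) as HW.
    replace ((K * Rpower p al * L * (C0 * d)) / ((c' * (p + d)) * (c * p))) with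
      (D * Rpower d (al / 2) * Rpower p (al / 2 - 1) * ((Rpower d (1 - al / 2) * Rpower p (al / 2)) / (p + d))).
    + apply Rle_trans with (D * Rpower d (al / 2) * Rpower p (al / 2 - 1) * 1); [apply Rmult_le_compat_l|right; ring].
      * apply Rmult_le_pos; [apply Rmult_le_pos; [exact HD|]|]; left; apply Rpower_pos.
      * apply Rmult_le_reg_r with (p + d); [lra|]. unfold Rdiv. rewrite Rmult_assoc, Rinv_l, Rmult_1_r, Rmult_1_l by lra. exact HW.
    + replace (Rpower p al) with (Rpower p (al / 2) * Rpower p (al / 2)) by (rewrite <- Rpower_plus; f_equal; field).
      unfold Rminus. rewrite !Rpower_plus, !Rpower_Ropp, !Rpower_1 by assumption.
      unfold D. pose proof (Rpower_pos d (al / 2)). field. repeat split; lra. }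
assert (Hss : s < s + 2 * PI) by (pose proof PI_RGT_0; lra).
rewrite (improper_unique _ _ _ _ _ Hss HI Hl1). rewrite Rmult_assoc. exact Hl2.
Qed.

Context (HW : forall w, (forall t, w <> e t) -> W w = RtoC 0 \/ W w = (- (RtoC (2 * PI) * Ci))%C).

Lemma winding_bound z : (forall t, (e t - z)%C <> RtoC 0) -> Cmod (W z) <= 2 * PI.
Proof.
intros Hz. pose proof PI_RGT_0.
destruct (HW z) as [E|E].
- intros t E. apply (Hz t). rewrite E. ring.
- rewrite E, Cmod_0. lra.
- rewrite E, Cmod_opp, Cmod_mult, Ci_Cmod, Cmod_R, Rabs_pos_eq by lra. lra.
Qed.

(* Compare both values with the Cauchy integral at the point of the normal through [e s1]
   whose distance from the curve is comparable to [s1 - s2]. *)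
Lemma regularized_holder : exists M r, 0 <= M /\ 0 < r <= 1 /\
  forall s1 s2 l1 l2, s1 <> s2 -> Rabs (s1 - s2) <= r ->
  improper (reg s1) s1 (s1 + 2 * PI) l1 -> improper (reg s2) s2 (s2 + 2 * PI) l2 ->
  Cmod (l1 - l2) <= M * Rpower (Rabs (s1 - s2)) (al / 2).
Proof.
pose proof (cb_c _ _ _ _ _ B) as Hc. pose proof (cb_L _ _ _ _ _ B) as HL. pose proof (cb_d0 _ _ _ _ _ B) as Hd0.
pose proof (hp_K _ _ _ H) as HK. pose proof (hp_al _ _ _ H) as Hal. pose proof PI2_3_2 as HPI; unfold PI2 in HPI.
(* At [s1] the constants [c] and [L] would do; moving the base point to [s2] costs at most [d / 2]
   in [pdist] and [L * d] in the offset, which [c / 2] and [2 * L] absorb. *)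
destruct (cauchy_nontangential (c / 2) (2 * L) ltac:(lra) ltac:(lra)) as [M [HM0 HM]].
(* One [M] for each base point, and [2 * PI * K] for [phi s1 - phi s2] times a winding integral of
   modulus at most [2 * PI]. *)
exists (2 * M + 2 * PI * K), (Rmin 1 d0).
assert (HPK : 0 <= 2 * PI * K) by (apply Rmult_le_pos; lra).
split; [lra|]. split; [split; [apply Rmin_pos; lra|apply Rmin_l]|].
intros s1 s2 l1 l2 Hs Hr Hl1 Hl2.
set (d := Rabs (s1 - s2)) in *.
assert (Hd : 0 < d) by (apply Rabs_pos_lt; lra).
assert (Hd1 : d <= 1) by (eapply Rle_trans; [exact Hr|apply Rmin_l]).
assert (Hdd : d <= d0) by (eapply Rle_trans; [exact Hr|apply Rmin_r]).
set (z := (e s1 + Ci * RtoC d * e' s1)%C).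
assert (Hsep : forall t, c * (pdist (t - s1) + d) <= Cmod (e t - z)).
{ intros t. pose proof (normal_separation e e' L c d0 B s1 d t) as HN. rewrite Rabs_pos_eq in HN by lra. apply HN. exact Hdd. }
assert (Hz1 : Cmod (z - e s1) <= L * d).
{ unfold z. replace (_ - e s1)%C with (Ci * RtoC d * e' s1)%C by ring.
  rewrite !Cmod_mult, Ci_Cmod, Cmod_R, Rabs_pos_eq by lra. pose proof (cb_der_bound _ _ _ _ _ B s1). nra. }
assert (Hz2 : Cmod (z - e s2) <= 2 * L * d).
{ pose proof (Cmod_minus_triangle z (e s1) (e s2)) as HT. pose proof (cb_lip _ _ _ _ _ B s2 s1) as HLi. fold d in HLi. lra. }
assert (A1 : Cmod (cauchy z - phi s1 * W z - l1) <= M * Rpower d (al / 2)).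
{ apply HM with (1 := Hd); [| |exact Hl1].
  - intros t. pose proof (Hsep t). pose proof (pdist_pos (t - s1)). nra.
  - pose proof (Rmult_lt_0_compat L d HL Hd). lra. }
assert (A2 : Cmod (cauchy z - phi s2 * W z - l2) <= M * Rpower d (al / 2)).
{ apply HM with (1 := Hd); [|exact Hz2|exact Hl2].
  intros t. pose proof (Hsep t). pose proof (pdist_pos (t - s1)).
  pose proof (pdist_triangle (t - s1) (s1 - s2)) as HT. replace (t - s1 + (s1 - s2)) with (t - s2) in HT by ring.
  pose proof (pdist_le (s1 - s2)) as HP. fold d in HP. nra. }
assert (Hnz : forall t, (e t - z)%C <> RtoC 0) by (intros t; apply (separation_nz c s1 z d t); auto).
pose proof (winding_bound z Hnz) as HWb.
assert (Hphi : Cmod (phi s1 - phi s2) <= K * Rpower d (al / 2)).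
{ eapply Rle_trans; [apply (holder_periodic_le _ _ _ _ _ H); [auto|fold d; lra]|]. fold d.
  apply Rmult_le_compat_l; [exact HK|]. apply Rpower_le_exponent; lra. }
replace (l1 - l2)%C with (- (cauchy z - phi s1 * W z - l1) + ((cauchy z - phi s2 * W z - l2) + - ((phi s1 - phi s2) * W z)))%C by ring.
eapply Rle_trans; [apply Cmod_triangle|]. rewrite Cmod_opp.
eapply Rle_trans; [apply Rplus_le_compat_l, Cmod_triangle|]. rewrite Cmod_opp, Cmod_mult.
assert (Cmod (phi s1 - phi s2) * Cmod (W z) <= K * Rpower d (al / 2) * (2 * PI)) by (apply Rmult_le_compat; try apply Cmod_ge_0; assumption).
lra.
Qed.

Lemma nearest_point s z : exists t, Rabs (t - s) <= PI /\ forall u, Cmod (e t - z) <= Cmod (e u - z).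
Proof.
pose proof PI_RGT_0.
destruct (continuity_ab_min (fun t => Cmod (e t - z)) (s - PI) (s + PI) ltac:(lra)) as [t [Ht1 Ht2]].
{ intros t Ht. apply continuity_pt_filterlim. apply (contC_Cmod (fun t => e t - z)%C).
  apply contC_minus; [eapply jc_cont; eauto|apply contC_const]. }
exists t. split; [apply Rabs_le; lra|].
intros u. destruct (mod_2pi_centered s u) as [k Hk]. apply Rabs_le_between in Hk.
rewrite <- (periodic2pi_Z e k u (jc_per _ _ J)). apply Ht1. lra.
Qed.

(* For a tangential approach, pass through the point of the curve nearest to [z]. *)
Lemma cauchy_boundary_estimate : exists M r, 0 <= M /\ 0 < r /\
  forall s z l, (forall t, z <> e t) -> Cmod (z - e s) <= r ->
  improper (reg s) s (s + 2 * PI) l ->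
  Cmod (cauchy z - phi s * W z - l) <= M * Rpower (Cmod (z - e s)) (al / 2).
Proof.
pose proof (cb_c _ _ _ _ _ B) as Hc. pose proof (hp_K _ _ _ H) as HK. pose proof (hp_al _ _ _ H) as Hal.
pose proof PI2_3_2 as HPI; unfold PI2 in HPI.
(* With [t] nearest to [z], [Cmod (e u - z)] is at least [d]; it is also at least half of the chord
   [Cmod (e u - e t)], which is at most [Cmod (e u - z) + d]. The mean of the two bounds gives
   [c / 4] and [1 / 2]. *)
set (c' := Rmin (c / 4) (/ 2)).
assert (Hc' : 0 < c') by (apply Rmin_pos; lra).
destruct (cauchy_nontangential c' 1 Hc' Rlt_0_1) as [M1 [HM10 HM1]].
destruct regularized_holder as [M2 [r2 [HM20 [Hr2 HM2]]]].
destruct regularized_exists as [M3 [_ HM3]].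
set (q := Rpower (12 / c) (al / 2)).
assert (Hq : 0 < q) by apply Rpower_pos.
assert (HPK : 0 <= 2 * PI * K) by (apply Rmult_le_pos; lra).
assert (H12 : 0 < 12 / c) by (apply Rdiv_lt_0_compat; lra).
assert (HM2q : 0 <= (M2 + 2 * PI * K) * q) by (apply Rmult_le_pos; lra).
exists (M1 + (M2 + 2 * PI * K) * q), (r2 * (c / 12)).
split; [lra|]. split; [apply Rmult_lt_0_compat; lra|].
intros s z l Hz Hzr Hl.
destruct (nearest_point s z) as [t [Ht Hmin]].
set (D := Cmod (z - e s)) in *. set (d := Cmod (e t - z)).
assert (Hnz : forall u, (e u - z)%C <> RtoC 0).
{ intros u E. apply (Hz u). rewrite <- (Cplus_0_r z), <- E. ring. }
assert (Hd : 0 < d) by (apply Cmod_gt_0, Hnz).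
assert (HdD : d <= D) by (unfold d, D; rewrite (Cmod_minus_sym z); apply Hmin).
destruct (HM3 t) as [lt [Hlt _]].
assert (Hsep : forall u, c' * (pdist (u - t) + d) <= Cmod (e u - z)).
{ intros u. pose proof (Hmin u) as Hm. fold d in Hm.
  pose proof (chord_arc e e' L c d0 B t u) as Hch.
  pose proof (Cmod_minus_triangle (e u) z (e t)) as HT. rewrite (Cmod_minus_sym z) in HT. fold d in HT.
  pose proof (pdist_pos (u - t)) as Hpp.
  pose proof (Rmin_l (c / 4) (/ 2)) as R1. pose proof (Rmin_r (c / 4) (/ 2)) as R2. fold c' in R1, R2.
  pose proof (Rmult_le_compat_r _ _ _ Hpp R1). pose proof (Rmult_le_compat_r d _ _ ltac:(lra) R2). lra. }
assert (A : Cmod (cauchy z - phi t * W z - lt) <= M1 * Rpower d (al / 2)).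
{ apply HM1 with (1 := Hd); [exact Hsep|rewrite Rmult_1_l, Cmod_minus_sym; apply Rle_refl|exact Hlt]. }
assert (Hdp : Rpower d (al / 2) <= Rpower D (al / 2)) by (apply Rle_Rpower_l; lra).
assert (A' : M1 * Rpower d (al / 2) <= M1 * Rpower D (al / 2)) by (apply Rmult_le_compat_l; assumption).
destruct (Req_dec t s) as [->|Hts].
- assert (Hss : s < s + 2 * PI) by lra. rewrite (improper_unique _ _ _ _ _ Hss Hl Hlt).
  pose proof (Rmult_le_pos _ _ HM2q (Rlt_le _ _ (Rpower_pos D (al / 2)))). lra.
(* The chord from [e s] to [e t] is at most [d + D <= 2 * D] and at least [c / 6] times the
   parameter distance, hence [12 / c]. The radius [r2 * (c / 12)] then brings [t] and [s] within
   reach of [regularized_holder]. *)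
- assert (Hdist : Rabs (t - s) <= 12 / c * D).
  { pose proof (chord_arc e e' L c d0 B s t) as Hch. pose proof (pdist_ge (t - s) Ht) as Hp.
    pose proof (Cmod_minus_triangle (e t) z (e s)) as HT. fold d in HT. fold D in HT.
    apply Rmult_le_reg_l with (c / 6); [lra|]. replace (c / 6 * (12 / c * D)) with (2 * D) by (field; lra). nra. }
  assert (Hr : Rabs (t - s) <= r2).
  { eapply Rle_trans; [exact Hdist|]. apply Rle_trans with (12 / c * (r2 * (c / 12))).
    - apply Rmult_le_compat_l; lra.
    - right. field. lra. }
  assert (Hpos : 0 < Rabs (t - s)) by (apply Rabs_pos_lt; lra).
  set (y := Rpower (Rabs (t - s)) (al / 2)).
  assert (Hy : y <= q * Rpower D (al / 2)).
  { unfold q, y. rewrite Rpower_mult_distr by lra. apply Rle_Rpower_l; lra. }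
  pose proof (HM2 t s lt l Hts Hr Hlt Hl) as A2. fold y in A2.
  assert (Hphi : Cmod (phi t - phi s) <= K * y).
  { eapply Rle_trans; [apply (holder_periodic_le _ _ _ _ _ H); [auto|lra]|].
    apply Rmult_le_compat_l; [exact HK|]. unfold y. apply Rpower_le_exponent; lra. }
  pose proof (winding_bound z Hnz) as HWb.
  replace (cauchy z - phi s * W z - l)%C with ((cauchy z - phi t * W z - lt) + ((lt - l) + (phi t - phi s) * W z))%C by ring.
  eapply Rle_trans; [apply Cmod_triangle|].
  eapply Rle_trans; [apply Rplus_le_compat_l, Cmod_triangle|]. rewrite Cmod_mult.
  assert (Cmod (phi t - phi s) * Cmod (W z) <= K * y * (2 * PI)) by (apply Rmult_le_compat; try apply Cmod_ge_0; assumption).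
  assert ((M2 + 2 * PI * K) * y <= (M2 + 2 * PI * K) * (q * Rpower D (al / 2))) by (apply Rmult_le_compat_l; [lra|exact Hy]).
  lra.
Qed.

End Density.

(** * Cauchy integrals off the curve, Hoelder functions *)

Lemma locally_Cmod (z : C) (r : R) : 0 < r -> locally z (fun w => Cmod (w - z) < r).
Proof. intros Hr. exact (proj1 (@filterlim_Cmod C (locally z) _ (fun x => x) z) (fun P H => H) (mkposreal _ Hr)). Qed.

(** A complex first-order expansion with quadratic remainder: it passes to sums and multiples with
    explicit constants, and yields both complex differentiability and continuity. *)
Definition C_expansion (f : C -> C) (z l : C) : Prop :=
  exists M r, 0 <= M /\ 0 < r /\
    forall w, Cmod (w - z) < r -> Cmod (f w - f z - l * (w - z)) <= M * Cmod (w - z) ^ 2.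

Lemma C_expansion_const a z : C_expansion (fun _ => a) z (RtoC 0).
Proof.
exists 0, 1. repeat split; try lra. intros w _.
replace (a - a - RtoC 0 * (w - z))%C with (RtoC 0) by ring. rewrite Cmod_0. lra.
Qed.

Lemma C_expansion_plus f g z l l' : C_expansion f z l -> C_expansion g z l' ->
  C_expansion (fun w => f w + g w)%C z (l + l')%C.
Proof.
intros [M [r [HM [Hr H]]]] [M' [r' [HM' [Hr' H']]]].
exists (M + M'), (Rmin r r'). repeat split; [lra|apply Rmin_pos; assumption|].
intros w Hw. pose proof (Rmin_l r r'). pose proof (Rmin_r r r').
replace (f w + g w - (f z + g z) - (l + l') * (w - z))%C with ((f w - f z - l * (w - z)) + (g w - g z - l' * (w - z)))%C by ring.
eapply Rle_trans; [apply Cmod_triangle|]. specialize (H w ltac:(lra)). specialize (H' w ltac:(lra)). lra.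
Qed.

Lemma C_expansion_scal a f z l : C_expansion f z l -> C_expansion (fun w => a * f w)%C z (a * l)%C.
Proof.
intros [M [r [HM [Hr H]]]]. exists (Cmod a * M), r.
split; [apply Rmult_le_pos; [apply Cmod_ge_0|exact HM]|]. split; [exact Hr|].
intros w Hw. replace (a * f w - a * f z - a * l * (w - z))%C with (a * (f w - f z - l * (w - z)))%C by ring.
rewrite Cmod_mult, Rmult_assoc. apply Rmult_le_compat_l; [apply Cmod_ge_0|auto].
Qed.

Lemma C_expansion_sumC m (f : nat -> C -> C) z : (forall k, (k < m)%nat -> exists l, C_expansion (f k) z l) ->
  exists l, C_expansion (fun w => sumC m (fun k => f k w)) z l.
Proof.
induction m as [|m IH]; intros H; simpl.
- exists (RtoC 0). apply C_expansion_const.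
- destruct IH as [l Hl]; [intros k Hk; apply H; lia|]. destruct (H m ltac:(lia)) as [l' Hl'].
  exists (l + l')%C. apply C_expansion_plus; assumption.
Qed.

Lemma C_expansion_ex_derive f z l : C_expansion f z l -> ex_derive (K := C_AbsRing) (V := C_NormedModule) f z.
Proof.
intros [M [r [HM [Hr H]]]]. exists l. split; [apply (@is_linear_scal_l C_AbsRing C_NormedModule)|].
intros z' Hz' eps.
apply (@is_filter_lim_locally_unique C_AbsRing (AbsRing_NormedModule C_AbsRing)) in Hz'. subst z'.
pose proof (cond_pos eps) as He.
assert (Hd : 0 < Rmin r (eps / (M + 1))) by (apply Rmin_pos; [exact Hr|apply Rdiv_lt_0_compat; lra]).
exists (mkposreal _ Hd). intros w Hw.
change (Cmod (w - z) < Rmin r (eps / (M + 1))) in Hw.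
change (Cmod (f w - f z - (w - z) * l) <= eps * Cmod (w - z)).
pose proof (Rmin_l r (eps / (M + 1))). pose proof (Rmin_r r (eps / (M + 1))).
rewrite (Cmult_comm _ l). eapply Rle_trans; [apply H; lra|].
replace (M * Cmod (w - z) ^ 2) with (M * Cmod (w - z) * Cmod (w - z)) by ring.
apply Rmult_le_compat_r; [apply Cmod_ge_0|].
apply Rle_trans with ((M + 1) * (eps / (M + 1))).
- pose proof (Cmod_ge_0 (w - z)). apply Rmult_le_compat; lra.
- right. field. lra.
Qed.

Lemma C_expansion_filterlim f z l : C_expansion f z l -> filterlim f (locally z) (locally (f z)).
Proof.
intros [M [r [HM [Hr H]]]]. apply filterlim_Cmod; [apply locally_filter|]. intros eps.
pose proof (cond_pos eps) as He. pose proof (Cmod_ge_0 l) as Hl.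
set (q := M + Cmod l + 1).
assert (Hd : 0 < Rmin (Rmin r 1) (eps / q)) by (apply Rmin_pos; [apply Rmin_pos; lra|apply Rdiv_lt_0_compat; unfold q; lra]).
generalize (locally_Cmod z _ Hd). apply filter_imp. intros w Hw.
pose proof (Rmin_l (Rmin r 1) (eps / q)). pose proof (Rmin_r (Rmin r 1) (eps / q)).
pose proof (Rmin_l r 1). pose proof (Rmin_r r 1).
specialize (H w ltac:(lra)). pose proof (Cmod_ge_0 (w - z)) as Hp.
replace (f w - f z)%C with ((f w - f z - l * (w - z)) + l * (w - z))%C by ring.
eapply Rle_lt_trans; [apply Cmod_triangle|]. rewrite (Cmod_mult l).
assert (E : Cmod (w - z) * q < eps).
{ apply Rlt_le_trans with (eps / q * q); [apply Rmult_lt_compat_r; [unfold q|]; lra|]. right; field. unfold q; lra. }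
assert (M * Cmod (w - z) ^ 2 <= M * Cmod (w - z)) by (apply Rmult_le_compat_l; [exact HM|]; nra).
unfold q in E. lra.
Qed.

Section OffCurve.
Context (e e' : R -> C) (J : jordan_curve e e') (phi : R -> C) (Hper : periodic2pi phi) (Hphi : forall t, contC phi t).

Let cauchy z := RIntC (fun t => phi t * cauchy_kernel e e' z t)%C 0 (2 * PI).

Lemma cauchy_isI z : (forall t, (e t - z)%C <> RtoC 0) ->
  isI (fun t => phi t * cauchy_kernel e e' z t)%C 0 (2 * PI) (cauchy z).
Proof.
intros Hz. pose proof PI_RGT_0. apply isI_cont; [lra|]. intros t _.
apply contC_mult; [apply Hphi|]. eapply contC_cauchy_kernel; eauto.
Qed.

Lemma cauchy_numerator_bound : exists M, 0 <= M /\ forall t, Cmod (phi t * e' t) <= M.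
Proof.
destruct (periodic_contC_bounded (fun t => phi t * e' t)%C) as [M [HM HMb]].
- intros t. rewrite Hper, (jc_per' _ _ J). reflexivity.
- intros t. apply contC_mult; [apply Hphi|eapply jc_cont'; eauto].
- exists M. split; [lra|exact HMb].
Qed.

(** Differentiation under the integral sign, by [1/(e-w) - 1/(e-z) - (w-z)/(e-z)^2 =
    (w-z)^2/((e-w)(e-z)^2)]. With [d] the distance from [z] to the curve, [e - w] stays above
    [d / 2] for [w] within [d / 2] of [z]. *)
Lemma cauchy_off_curve_expansion z : (forall t, (e t - z)%C <> RtoC 0) -> exists l, C_expansion cauchy z l.
Proof.
intros Hz. pose proof PI_RGT_0.
destruct cauchy_numerator_bound as [M [HM HMb]].
destruct (nearest_point e e' J 0 z) as [t0 [_ Ht0]].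
set (d := Cmod (e t0 - z)) in *.
assert (Hd : 0 < d) by (apply Cmod_gt_0, Hz).
set (l := RIntC (fun t => phi t * (cauchy_kernel e e' z t / (e t - z)))%C 0 (2 * PI)).
exists l. exists (2 * PI * (M / (d / 2 * (d * d)))), (d / 2).
assert (Hden : 0 < d / 2 * (d * d)) by (repeat apply Rmult_lt_0_compat; lra).
split; [apply Rmult_le_pos; [lra|apply Rmult_le_pos; [lra|left; apply Rinv_0_lt_compat; lra]]|].
split; [lra|]. intros w Hw.
assert (Hwt : forall t, d / 2 <= Cmod (e t - w)).
{ intros t. pose proof (Cmod_minus_triangle (e t) w z). pose proof (Ht0 t). lra. }
assert (Hwnz : forall t, (e t - w)%C <> RtoC 0).
{ intros t E. pose proof (Hwt t) as H1. rewrite E, Cmod_0 in H1. lra. }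
assert (Hl : isI (fun t => phi t * (cauchy_kernel e e' z t / (e t - z)))%C 0 (2 * PI) l).
{ apply isI_cont; [lra|]. intros t _. apply contC_mult; [apply Hphi|].
  apply contC_div; [apply Hz|eapply contC_cauchy_kernel; eauto|].
  apply contC_minus; [eapply jc_cont; eauto|apply contC_const]. }
pose proof (isI_minus _ _ _ _ _ _ (isI_minus _ _ _ _ _ _ (cauchy_isI w Hwnz) (cauchy_isI z Hz)) (isI_Cmult (w - z)%C _ _ _ _ Hl)) as HI.
replace (l * (w - z))%C with ((w - z) * l)%C by ring.
replace (2 * PI * (M / (d / 2 * (d * d))) * Cmod (w - z) ^ 2) with ((2 * PI - 0) * (M * Cmod (w - z) ^ 2 / (d / 2 * (d * d)))) by (field; lra).
apply isI_const_bound with (3 := HI); [lra|]. intros t _.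
replace (phi t * cauchy_kernel e e' w t - phi t * cauchy_kernel e e' z t - (w - z) * (phi t * (cauchy_kernel e e' z t / (e t - z))))%C
  with ((phi t * e' t * ((w - z) * (w - z))) / ((e t - w) * ((e t - z) * (e t - z))))%C
  by (unfold cauchy_kernel; field; split; [apply Hz|apply Hwnz]).
apply Cmod_div_le; [exact Hden| |].
- rewrite Cmod_mult, (Cmod_mult (w - z)). replace (Cmod (w - z) ^ 2) with (Cmod (w - z) * Cmod (w - z)) by ring.
  apply Rmult_le_compat_r; [apply Rmult_le_pos; apply Cmod_ge_0|apply HMb].
- rewrite !Cmod_mult. pose proof (Ht0 t). apply Rmult_le_compat; [lra|apply Rmult_le_pos; lra|apply Hwt|].
  apply Rmult_le_compat; lra.
Qed.

(** Meant for [z] and [w] on another boundary curve: there the Cauchy integral is a bounded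
    Lipschitz function, with a constant that depends on the position only through the distance
    [d]. *)
Lemma cauchy_off_curve_lipschitz d : 0 < d -> exists M, 0 <= M /\
  forall z w, (forall t, d <= Cmod (e t - z)) -> (forall t, d <= Cmod (e t - w)) ->
   Cmod (cauchy z) <= M /\ Cmod (cauchy z - cauchy w) <= M * Cmod (z - w).
Proof.
intros Hd. pose proof PI_RGT_0. destruct cauchy_numerator_bound as [M [HM HMb]].
assert (H1 : 0 <= M / d) by (apply Rmult_le_pos; [lra|left; apply Rinv_0_lt_compat; lra]).
assert (Hdd : 0 < d * d) by (apply Rmult_lt_0_compat; lra).
assert (H2 : 0 <= M / (d * d)) by (apply Rmult_le_pos; [lra|left; apply Rinv_0_lt_compat; lra]).
assert (P1 : 0 <= 2 * PI * (M / d)) by (apply Rmult_le_pos; lra).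
assert (P2 : 0 <= 2 * PI * (M / (d * d))) by (apply Rmult_le_pos; lra).
exists (2 * PI * (M / d) + 2 * PI * (M / (d * d))).
split; [lra|]. intros z w Hz Hw.
assert (nz : forall x, (forall t, d <= Cmod (e t - x)) -> forall t, (e t - x)%C <> RtoC 0).
{ intros x Hx t E. specialize (Hx t). rewrite E, Cmod_0 in Hx. lra. }
split.
- apply Rle_trans with ((2 * PI - 0) * (M / d)); [|lra].
  apply isI_const_bound with (3 := cauchy_isI z (nz z Hz)); [lra|]. intros t _.
  replace (phi t * cauchy_kernel e e' z t)%C with ((phi t * e' t) / (e t - z))%C by (unfold cauchy_kernel; field; apply nz, Hz).
  apply Cmod_div_le; auto.
- pose proof (Cmod_ge_0 (z - w)).
  apply Rle_trans with ((2 * PI - 0) * (M * Cmod (z - w) / (d * d))).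
  2: { apply Rle_trans with (2 * PI * (M / (d * d)) * Cmod (z - w)); [right; field; lra|apply Rmult_le_compat_r; lra]. }
  apply isI_const_bound with (3 := isI_minus _ _ _ _ _ _ (cauchy_isI z (nz z Hz)) (cauchy_isI w (nz w Hw))); [lra|].
  intros t _.
  replace (phi t * cauchy_kernel e e' z t - phi t * cauchy_kernel e e' w t)%C with ((phi t * e' t * (z - w)) / ((e t - z) * (e t - w)))%C
    by (unfold cauchy_kernel; field; split; [apply (nz w), Hw|apply (nz z), Hz]).
  apply Cmod_div_le; [exact Hdd| |].
  + rewrite Cmod_mult. apply Rmult_le_compat_r; auto.
  + rewrite Cmod_mult. apply Rmult_le_compat; auto; lra.
Qed.

End OffCurve.

(** The radius is at most 1 so that the exponent can be lowered with the same constant; the global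
    bound serves for products and recovers the estimate for distant points. *)
Definition loc_holder (g : R -> C) (b : R) : Prop :=
  exists K r, 0 <= K /\ 0 < r <= 1 /\ (forall s, Cmod (g s) <= K) /\
    forall s t, s <> t -> Rabs (s - t) <= r -> Cmod (g s - g t) <= K * Rpower (Rabs (s - t)) b.

Lemma loc_holder_weaken g a b : a <= b -> loc_holder g b -> loc_holder g a.
Proof.
intros Hab [K [r [HK [Hr [HB H]]]]]. exists K, r. repeat split; try tauto.
intros s t Hst Hr'. eapply Rle_trans; [apply H; assumption|]. apply Rmult_le_compat_l; [exact HK|].
apply Rpower_le_exponent; [split; [apply Rabs_pos_lt; lra|lra]|exact Hab].
Qed.

Lemma loc_holder_const a b : loc_holder (fun _ => a) b.
Proof.
exists (Cmod a), 1. pose proof (Cmod_ge_0 a).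
split; [lra|]. split; [lra|]. split; [intros s; lra|]. intros s t _ _. replace (a - a)%C with (RtoC 0) by ring. rewrite Cmod_0.
apply Rmult_le_pos; [assumption|left; apply Rpower_pos].
Qed.

Lemma loc_holder_plus f g b : loc_holder f b -> loc_holder g b -> loc_holder (fun t => f t + g t)%C b.
Proof.
intros [K [r [HK [Hr [HB H]]]]] [K' [r' [HK' [Hr' [HB' H']]]]].
exists (K + K'), (Rmin r r'). pose proof (Rmin_l r r'). pose proof (Rmin_r r r').
split; [lra|]. split; [split; [apply Rmin_pos|]; lra|]. split.
- intros s. eapply Rle_trans; [apply Cmod_triangle|]. specialize (HB s). specialize (HB' s). lra.
- intros s t Hst Hd. replace (f s + g s - (f t + g t))%C with ((f s - f t) + (g s - g t))%C by ring.
  eapply Rle_trans; [apply Cmod_triangle|]. specialize (H s t Hst ltac:(lra)). specialize (H' s t Hst ltac:(lra)). lra.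
Qed.

Lemma loc_holder_mult f g b : loc_holder f b -> loc_holder g b -> loc_holder (fun t => f t * g t)%C b.
Proof.
intros [K [r [HK [Hr [HB H]]]]] [K' [r' [HK' [Hr' [HB' H']]]]].
exists (2 * (K * K')), (Rmin r r'). pose proof (Rmin_l r r'). pose proof (Rmin_r r r').
assert (HKK : 0 <= K * K') by (apply Rmult_le_pos; assumption).
split; [lra|]. split; [split; [apply Rmin_pos|]; lra|]. split.
- intros s. rewrite Cmod_mult. apply Rle_trans with (K * K'); [|lra]. apply Rmult_le_compat; auto using Cmod_ge_0.
- intros s t Hst Hd. replace (f s * g s - f t * g t)%C with ((f s - f t) * g s + f t * (g s - g t))%C by ring.
  eapply Rle_trans; [apply Cmod_triangle|]. rewrite !Cmod_mult.
  specialize (H s t Hst ltac:(lra)). specialize (H' s t Hst ltac:(lra)).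
  set (y := Rpower (Rabs (s - t)) b) in *.
  assert (Cmod (f s - f t) * Cmod (g s) <= K * y * K') by (apply Rmult_le_compat; auto using Cmod_ge_0).
  assert (Cmod (f t) * Cmod (g s - g t) <= K * (K' * y)) by (apply Rmult_le_compat; auto using Cmod_ge_0).
  lra.
Qed.

Lemma loc_holder_inv f b m : 0 < m -> (forall t, m <= Cmod (f t)) -> loc_holder f b -> loc_holder (fun t => / f t)%C b.
Proof.
intros Hm Hf [K [r [HK [Hr [HB H]]]]].
assert (nz : forall t, f t <> RtoC 0) by (intros t E; specialize (Hf t); rewrite E, Cmod_0 in Hf; lra).
assert (Hmm : 0 < m * m) by (apply Rmult_lt_0_compat; lra).
assert (H1 : 0 < / m) by (apply Rinv_0_lt_compat; lra).
assert (H2 : 0 <= K / (m * m)) by (apply Rmult_le_pos; [lra|left; apply Rinv_0_lt_compat; lra]).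
exists (/ m + K / (m * m)), r. split; [lra|]. split; [exact Hr|]. split.
- intros s. rewrite Cmod_inv by apply nz. apply Rle_trans with (/ m); [apply Rinv_le_contravar; auto|lra].
- intros s t Hst Hd. replace (/ f s - / f t)%C with (- (f s - f t) / (f s * f t))%C by (field; auto).
  pose proof (Rpower_pos (Rabs (s - t)) b).
  apply Rle_trans with ((K * Rpower (Rabs (s - t)) b) / (m * m)).
  + apply Cmod_div_le; [exact Hmm|rewrite Cmod_opp; auto|]. rewrite Cmod_mult. apply Rmult_le_compat; auto; lra.
  + apply Rle_trans with (K / (m * m) * Rpower (Rabs (s - t)) b); [right; field; lra|apply Rmult_le_compat_r; lra].
Qed.

Lemma loc_holder_lipschitz f L B b : b <= 1 -> (forall s, Cmod (f s) <= B) ->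
  (forall s t, Cmod (f s - f t) <= L * Rabs (s - t)) -> loc_holder f b.
Proof.
intros Hb HB HL. exists (Rmax B (Rmax L 0)), 1.
pose proof (Rmax_l B (Rmax L 0)). pose proof (Rmax_r B (Rmax L 0)). pose proof (Rmax_l L 0). pose proof (Rmax_r L 0).
split; [lra|]. split; [lra|]. split; [intros s; specialize (HB s); lra|].
intros s t Hst Hd. assert (Hp : 0 < Rabs (s - t)) by (apply Rabs_pos_lt; lra).
eapply Rle_trans; [apply HL|]. apply Rle_trans with (Rmax B (Rmax L 0) * Rabs (s - t)); [apply Rmult_le_compat_r; lra|].
apply Rmult_le_compat_l; [lra|]. rewrite <- (Rpower_1 (Rabs (s - t))) at 1 by exact Hp. apply Rpower_le_exponent; lra.
Qed.

Lemma loc_holder_sumC m (f : nat -> R -> C) b : (forall k, (k < m)%nat -> loc_holder (f k) b) ->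
  loc_holder (fun t => sumC m (fun k => f k t)) b.
Proof.
induction m as [|m IH]; intros H; simpl; [apply loc_holder_const|].
apply loc_holder_plus; [apply IH; intros k Hk|]; apply H; lia.
Qed.

Lemma loc_holder_global g b : loc_holder g b -> 0 < b -> exists K, 0 <= K /\
  forall s t, s <> t -> Cmod (g s - g t) <= K * Rpower (Rabs (s - t)) b.
Proof.
intros [K [r [HK [Hr [HB H]]]]] Hb. pose proof (Rpower_pos r b) as Hp.
assert (HQ : 0 <= 2 * K / Rpower r b) by (apply Rmult_le_pos; [lra|left; apply Rinv_0_lt_compat; lra]).
exists (K + 2 * K / Rpower r b). split; [lra|].
intros s t Hst. pose proof (Rpower_pos (Rabs (s - t)) b) as Hp'.
destruct (Rle_dec (Rabs (s - t)) r) as [Hd|Hd].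
- eapply Rle_trans; [apply H; assumption|]. apply Rmult_le_compat_r; lra.
- apply Rle_trans with (2 * K).
  + eapply Rle_trans; [apply Cmod_triangle|]. rewrite Cmod_opp. pose proof (HB s). pose proof (HB t). lra.
  + apply Rle_trans with (2 * K / Rpower r b * Rpower (Rabs (s - t)) b); [|apply Rmult_le_compat_r; lra].
    apply Rle_trans with (2 * K / Rpower r b * Rpower r b); [right; field; lra|].
    apply Rmult_le_compat_l; [exact HQ|]. apply Rle_Rpower_l; lra.
Qed.

Lemma loc_holder_periodic g b : periodic2pi g -> 0 < b <= 1 -> loc_holder g b -> exists K, holder_periodic g K b.
Proof.
intros Hp Hb H. destruct (loc_holder_global g b H ltac:(lra)) as [K [HK HKb]].
pose proof (Rpower_pos 6 b) as H6.
exists (K * Rpower 6 b). constructor; [exact Hp|apply Rmult_le_pos; lra|exact Hb|].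
intros s t Hst. destruct (mod_2pi_centered s t) as [k Hk].
rewrite <- (periodic2pi_Z g k t Hp). rewrite <- (pdist_Z (t - s) k) in Hst |- *.
replace (t - s + 2 * PI * IZR k) with (t + 2 * PI * IZR k - s) in * by ring.
set (u := t + 2 * PI * IZR k) in *.
assert (Hus : u <> s).
{ intros E. rewrite E, Rminus_diag in Hst. pose proof (pdist_le 0) as H0. rewrite Rabs_R0 in H0. lra. }
eapply Rle_trans; [apply HKb; exact Hus|]. rewrite Rmult_assoc. apply Rmult_le_compat_l; [exact HK|].
rewrite Rpower_mult_distr by lra. pose proof (pdist_ge _ Hk). apply Rle_Rpower_l; [lra|].
split; [apply Rabs_pos_lt; lra|lra].
Qed.

(** The hypothesis compares points of one period. A pair that straddles [2 * PI] is joined through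
    [u (2 * PI) = u 0], and the two pieces account for the factor 2. *)
Lemma Holder_on_J_loc_holder u : Holder_on_J u -> periodic2pi u -> exists b, 0 < b <= 1 /\ loc_holder (fun t => RtoC (u t)) b.
Proof.
intros [al [K [Hal [HK H]]]] Hp. pose proof PI2_3_2 as HPI; unfold PI2 in HPI.
assert (H2pi : u (2 * PI) = u 0) by (rewrite <- (Hp 0); f_equal; ring).
assert (Hmain : forall s t, 0 <= s < 2 * PI -> s < t <= s + 1 -> Rabs (u s - u t) <= 2 * K * Rpower (Rabs (s - t)) al).
{ intros s t Hs Ht. rewrite (Rabs_minus_sym s), (Rabs_pos_eq (t - s)) by lra.
  assert (Hq : 0 <= K * Rpower (t - s) al) by (apply Rmult_le_pos; [exact HK|left; apply Rpower_pos]).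
  assert (Hle : forall x y, 0 <= x <= 2 * PI -> 0 <= y <= 2 * PI -> x < y -> y - x <= t - s -> Rabs (u x - u y) <= K * Rpower (t - s) al).
  { intros x y Hx Hy Hxy Hd. eapply Rle_trans; [apply H; assumption|].
    apply Rmult_le_compat_l; [exact HK|]. rewrite Rabs_minus_sym, Rabs_pos_eq by lra. apply Rle_Rpower_l; lra. }
  destruct (Rle_dec t (2 * PI)) as [Htp|Htp].
  - pose proof (Hle s t ltac:(lra) ltac:(lra) ltac:(lra) ltac:(lra)). lra.
  - replace (u t) with (u (t - 2 * PI)) by (rewrite <- Hp; f_equal; ring).
    replace (u s - u (t - 2 * PI)) with ((u s - u (2 * PI)) + (u 0 - u (t - 2 * PI))) by lra.
    eapply Rle_trans; [apply Rabs_triang|].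
    pose proof (Hle s (2 * PI) ltac:(lra) ltac:(lra) ltac:(lra) ltac:(lra)).
    pose proof (Hle 0 (t - 2 * PI) ltac:(lra) ltac:(lra) ltac:(lra) ltac:(lra)). lra. }
assert (Hmain' : forall s t, s < t <= s + 1 -> Rabs (u s - u t) <= 2 * K * Rpower (Rabs (s - t)) al).
{ intros s t Hst. destruct (mod_2pi s) as [k Hk].
  rewrite <- (periodic2pi_Z u k s Hp), <- (periodic2pi_Z u k t Hp).
  replace (s - t) with ((s + 2 * PI * IZR k) - (t + 2 * PI * IZR k)) by ring. apply Hmain; lra. }
assert (HB : forall s, Rabs (u s) <= Rabs (u 0) + K * Rpower (2 * PI) al).
{ intros s. destruct (mod_2pi s) as [k Hk]. rewrite <- (periodic2pi_Z u k s Hp).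
  set (x := s + 2 * PI * IZR k) in *.
  assert (Hq : 0 <= K * Rpower (2 * PI) al) by (apply Rmult_le_pos; [exact HK|left; apply Rpower_pos]).
  destruct (Req_dec x 0) as [->|Hx]; [lra|].
  replace (u x) with (u 0 + (u x - u 0)) by ring. eapply Rle_trans; [apply Rabs_triang|].
  apply Rplus_le_compat_l. eapply Rle_trans; [apply H; lra|]. apply Rmult_le_compat_l; [exact HK|].
  rewrite Rminus_0_r, Rabs_pos_eq by lra. apply Rle_Rpower_l; lra. }
exists al. split; [exact Hal|].
assert (HKp : 0 <= K * Rpower (2 * PI) al) by (apply Rmult_le_pos; [exact HK|left; apply Rpower_pos]).
pose proof (Rabs_pos (u 0)).
exists (Rabs (u 0) + K * Rpower (2 * PI) al + 2 * K), 1.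
split; [lra|]. split; [lra|]. split.
- intros s. rewrite Cmod_R. pose proof (HB s). lra.
- intros s t Hst Hd. rewrite <- RtoC_minus, Cmod_R. pose proof (Rpower_pos (Rabs (s - t)) al).
  apply Rle_trans with (2 * K * Rpower (Rabs (s - t)) al); [|apply Rmult_le_compat_r; lra].
  destruct (Rlt_dec s t).
  + apply Hmain'. rewrite Rabs_left in Hd; lra.
  + rewrite Rabs_minus_sym, (Rabs_minus_sym s). apply Hmain'. rewrite Rabs_pos_eq in Hd; lra.
Qed.

(** * Several curves *)

(** [PVint] is a choice, known only through its specification: existence of the limit makes
    [epsilon_spec] applicable, and uniqueness of limits identifies the chosen value. *)
Lemma PVint_fst (F : R -> C) (G : R -> R) s l : (forall t, G t = fst (F t)) ->
  improper F s (s + 2 * PI) l -> PVint G s = fst l.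
Proof.
intros HG [I [H1 H2]]. pose proof PI_RGT_0.
assert (H0 : filterlim (fun e => RInt G (s + e) (s + 2 * PI - e)) (at_right 0) (locally (fst l))).
{ apply filterlim_C_components in H2; [|apply at_right_proper_filter]. destruct H2 as [H2 _].
  apply filterlim_ext_loc with (2 := H2). assert (HP : 0 < (s + 2 * PI - s) / 2) by lra.
  generalize (at_right_lt _ HP). apply filter_imp. intros e He. symmetry. apply is_RInt_unique.
  apply (is_RInt_ext (V := R_NormedModule)) with (2 := proj1 (proj1 (isI_components _ _ _ _) (H1 e He))).
  intros t _. symmetry. apply HG. }
unfold PVint. set (Q := fun l0 : R => _).
pose proof (epsilon_spec (inhabits 0) Q (ex_intro Q _ H0)) as HE. unfold Q at 1 in HE.
exact (filterlim_locally_unique (V := R_NormedModule) _ _ _ HE H0).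
Qed.

Lemma PVint_snd (F : R -> C) (G : R -> R) s l : (forall t, G t = snd (F t)) ->
  improper F s (s + 2 * PI) l -> PVint G s = snd l.
Proof.
intros HG H.
replace (snd l) with (fst (- Ci * l)%C) by (simpl; ring).
apply PVint_fst with (fun t => - Ci * F t)%C; [|apply improper_Cmult; exact H].
intros t. rewrite HG. simpl. ring.
Qed.

Lemma is_RInt_periodic_shift (F : R -> R) a b l : periodic2pi F ->
  is_RInt F (a + 2 * PI) (b + 2 * PI) l <-> is_RInt F a b l.
Proof.
assert (Hs : forall (G : R -> R) T a b, is_RInt G (a + T) (b + T) l -> is_RInt (fun t => G (t + T)) a b l).
{ intros G T a' b' H. rewrite <- (Rmult_1_l a'), <- (Rmult_1_l b') in H.
  apply (is_RInt_comp_lin (V := R_NormedModule) G 1 T a' b' l) in H.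
  apply (is_RInt_ext (V := R_NormedModule)) with (2 := H). intros t _.
  unfold scal; simpl; unfold mult; simpl. rewrite !Rmult_1_l. reflexivity. }
intros HF. split; intros H.
- apply Hs in H. apply (is_RInt_ext (V := R_NormedModule)) with (2 := H). intros t _. apply HF.
- replace a with (a + 2 * PI + - (2 * PI)) in H by ring. replace b with (b + 2 * PI + - (2 * PI)) in H by ring.
  apply Hs in H. apply (is_RInt_ext (V := R_NormedModule)) with (2 := H).
  intros t _. rewrite <- HF. f_equal. ring.
Qed.

(** Holds whether or not the limits exist: the predicates [is_RInt] over the two periods are
    equivalent, hence equal, so the truncated integrals and then the two choices are literally the
    same. *)
Lemma PVint_periodic (F : R -> R) s : periodic2pi F -> PVint F (s + 2 * PI) = PVint F s.
Proof.
intros HF. unfold PVint.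
replace (fun e => RInt F (s + 2 * PI + e) (s + 2 * PI + 2 * PI - e)) with (fun e => RInt F (s + e) (s + 2 * PI - e)); [reflexivity|].
apply functional_extensionality. intros e. unfold RInt. f_equal.
apply functional_extensionality. intros l. apply propositional_extensionality.
replace (s + 2 * PI + e) with ((s + e) + 2 * PI) by ring.
replace (s + 2 * PI + 2 * PI - e) with ((s + 2 * PI - e) + 2 * PI) by ring.
symmetry. apply is_RInt_periodic_shift. exact HF.
Qed.

Lemma sumR_fst m V : sumR m (fun k => fst (V k)) = fst (sumC m V).
Proof. induction m as [|m IH]; simpl; [reflexivity|]. rewrite IH. reflexivity. Qed.

Lemma sumR_snd m V : sumR m (fun k => snd (V k)) = snd (sumC m V).
Proof. induction m as [|m IH]; simpl; [reflexivity|]. rewrite IH. reflexivity. Qed.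

Lemma sumR_ext m f g : (forall k, (k < m)%nat -> f k = g k) -> sumR m f = sumR m g.
Proof. induction m as [|m IH]; intros H; simpl; [reflexivity|]. rewrite IH, H by auto with arith. reflexivity. Qed.

Lemma sumC_ext m f g : (forall k, (k < m)%nat -> f k = g k) -> sumC m f = sumC m g.
Proof. induction m as [|m IH]; intros H; simpl; [reflexivity|]. rewrite IH, H by auto with arith. reflexivity. Qed.

Lemma sumC_plus m f g : sumC m (fun k => f k + g k)%C = (sumC m f + sumC m g)%C.
Proof. induction m as [|m IH]; simpl; [ring|]. rewrite IH. ring. Qed.

Lemma sumC_scal m a f : sumC m (fun k => a * f k)%C = (a * sumC m f)%C.
Proof. induction m as [|m IH]; simpl; [ring|]. rewrite IH. ring. Qed.

Lemma sumC_update m j a f : (j < m)%nat ->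
  sumC m (fun k => if Nat.eqb k j then (f k + a)%C else f k) = (sumC m f + a)%C.
Proof.
assert (H0 : forall m, (m <= j)%nat -> sumC m (fun k => if Nat.eqb k j then (f k + a)%C else f k) = sumC m f).
{ intros n Hn. apply sumC_ext. intros k Hk. destruct (Nat.eqb_spec k j); [lia|reflexivity]. }
induction m as [|m IH]; intros Hj; [lia|]. simpl.
destruct (Nat.eqb_spec m j) as [->|Hm].
- rewrite H0 by lia. ring.
- rewrite IH by lia. ring.
Qed.

Lemma filterlim_sumC {T : Type} (F : (T -> Prop) -> Prop) {FF : Filter F} m (f : nat -> T -> C) (V : nat -> C) :
  (forall k, (k < m)%nat -> filterlim (f k) F (locally (V k))) ->
  filterlim (fun x => sumC m (fun k => f k x)) F (locally (sumC m V)).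
Proof.
induction m as [|m IH]; intros H; simpl; [apply filterlim_const|].
apply filterlim_Cplus; [exact FF|apply IH; intros; apply H; lia|apply H; lia].
Qed.

Lemma PI_Ci_nz : (RtoC (2 * PI) * Ci)%C <> RtoC 0.
Proof. intros E. pose proof (f_equal snd E) as H. simpl in H. pose proof PI_RGT_0. lra. Qed.

Definition cauchy_integral (phi : R -> C) (e e' : R -> C) (z : C) : C :=
  RIntC (fun t => phi t * cauchy_kernel e e' z t)%C 0 (2 * PI).

Definition winding_integral (e e' : R -> C) (z : C) : C := RIntC (cauchy_kernel e e' z) 0 (2 * PI).

Definition regularized (phi : R -> C) (e e' : R -> C) (s t : R) : C :=
  ((phi t - phi s) * cauchy_kernel e e' (e s) t)%C.

(** The side of the curve is encoded in the filter [F], along which the winding integral has the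
    constant value [w0]; [cauchy_boundary_estimate] does the rest. *)
Lemma cauchy_boundary_limit e e' phi K al s P w0 (F : (C -> Prop) -> Prop) {FF : Filter F} :
  jordan_curve e e' -> holder_periodic phi K al ->
  (forall w, (forall t, w <> e t) -> winding_integral e e' w = RtoC 0
     \/ winding_integral e e' w = (- (RtoC (2 * PI) * Ci))%C) ->
  improper (regularized phi e e' s) s (s + 2 * PI) P ->
  filter_le F (locally (e s)) ->
  F (fun z => (forall t, z <> e t) /\ winding_integral e e' z = w0) ->
  filterlim (cauchy_integral phi e e') F (locally (P + phi s * w0)%C).
Proof.
intros J H HW HP HF Hw0. destruct (jordan_curve_bounds _ _ J) as [L [c [d0 B]]].
destruct (cauchy_boundary_estimate e e' L c d0 phi K al J B H HW) as [M [r [HM [Hr HE]]]].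
pose proof (hp_al _ _ _ H) as Hal.
apply filterlim_Cmod; [exact FF|]. intros eps. pose proof (cond_pos eps) as He.
set (q := Rpower (eps / (M + 1)) (/ (al / 2))).
assert (Hq : 0 < Rmin r q) by (apply Rmin_pos; [exact Hr|apply Rpower_pos]).
generalize (filter_and _ _ Hw0 (HF _ (locally_Cmod (e s) _ Hq))). apply filter_imp.
intros z [[Hz1 Hz2] Hz3]. pose proof (Rmin_l r q). pose proof (Rmin_r r q).
specialize (HE s z P Hz1 ltac:(lra) HP).
replace (cauchy_integral phi e e' z - (P + phi s * w0))%C with (cauchy_integral phi e e' z - phi s * winding_integral e e' z - P)%C
  by (rewrite Hz2; ring).
eapply Rle_lt_trans; [exact HE|].
assert (Hp : 0 < Cmod (z - e s)) by (apply Cmod_gt_0; intros E; apply (Hz1 s); rewrite <- (Cplus_0_r (e s)), <- E; ring).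
assert (Hpow : Rpower (Cmod (z - e s)) (al / 2) <= eps / (M + 1)).
{ apply Rle_trans with (Rpower q (al / 2)); [apply Rle_Rpower_l; lra|].
  unfold q. rewrite Rpower_mult, Rinv_l, Rpower_1; [lra|apply Rdiv_lt_0_compat; lra|lra]. }
assert (Hd : 0 < eps / (M + 1)) by (apply Rdiv_lt_0_compat; lra).
apply Rle_lt_trans with (M * (eps / (M + 1))); [apply Rmult_le_compat_l; lra|].
apply Rlt_le_trans with ((M + 1) * (eps / (M + 1))); [lra|right; field; lra].
Qed.

Section MultiplyConnected.
Context (m : nat) (eta eta' : nat -> R -> C)
  (HJ : forall k, (k < m)%nat -> jordan_curve (eta k) (eta' k))
  (Hdisj : forall j k s t, (j < m)%nat -> (k < m)%nat -> j <> k -> eta j s <> eta k t)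
  (Hcw : forall k z, (k < m)%nat -> (forall t, z <> eta k t) ->
      winding_integral (eta k) (eta' k) z = RtoC 0 \/ winding_integral (eta k) (eta' k) z = (- (RtoC (2 * PI) * Ci))%C)
  (Hnest : forall j k t, (j < m)%nat -> (k < m)%nat -> j <> k -> winding_integral (eta k) (eta' k) (eta j t) = RtoC 0).

Lemma wind_eq_0 k z : wind eta eta' k z = RtoC 0 <-> winding_integral (eta k) (eta' k) z = RtoC 0.
Proof.
change (wind eta eta' k z) with (/ (RtoC (2 * PI) * Ci) * winding_integral (eta k) (eta' k) z)%C.
pose proof PI_Ci_nz. split; intros E.
- replace (winding_integral (eta k) (eta' k) z) with ((RtoC (2 * PI) * Ci) * (/ (RtoC (2 * PI) * Ci) * winding_integral (eta k) (eta' k) z))%C.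
  + rewrite E. ring.
  + rewrite Cmult_assoc, Cinv_r by assumption. ring.
- rewrite E. ring.
Qed.

Lemma eta_sep_nz j k s t : (j < m)%nat -> (k < m)%nat -> j <> k -> (eta k t - eta j s)%C <> RtoC 0.
Proof.
intros Hj Hk Hjk E. apply (Hdisj j k s t Hj Hk Hjk). rewrite <- (Cplus_0_r (eta j s)), <- E. ring.
Qed.

Lemma eta_dist j k : (j < m)%nat -> (k < m)%nat -> j <> k -> exists d, 0 < d /\ forall s t, d <= Cmod (eta k t - eta j s).
Proof.
intros Hj Hk Hjk.
destruct (jordan_curve_bounds _ _ (HJ j Hj)) as [Lj [cj [dj Bj]]].
destruct (jordan_curve_bounds _ _ (HJ k Hk)) as [Lk [ck [dk Bk]]].
pose proof (cb_L _ _ _ _ _ Bj). pose proof (cb_L _ _ _ _ _ Bk).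
destruct (lipschitz_pos_bound_2d (fun x y => Cmod (eta k y - eta j x)) 0 (2 * PI) 0 (2 * PI) (Lj + Lk)) as [d [Hd Hdb]].
- lra.
- intros x y u v.
  assert (HH : forall x y u v, Cmod (eta k y - eta j x) - Cmod (eta k v - eta j u) <= (Lj + Lk) * (Rabs (x - u) + Rabs (y - v))).
  { intros x' y' u' v'.
    pose proof (Cmod_triangle ((eta k y' - eta k v') - (eta j x' - eta j u')) (eta k v' - eta j u')) as T.
    replace (eta k y' - eta k v' - (eta j x' - eta j u') + (eta k v' - eta j u'))%C with (eta k y' - eta j x')%C in T by ring.
    pose proof (Cmod_triangle (eta k y' - eta k v') (- (eta j x' - eta j u'))) as T2. rewrite Cmod_opp in T2.
    pose proof (cb_lip _ _ _ _ _ Bj u' x'). pose proof (cb_lip _ _ _ _ _ Bk v' y').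
    pose proof (Rabs_pos (x' - u')). pose proof (Rabs_pos (y' - v')).
    unfold Cminus in *. nra. }
  apply Rabs_le. split; [|apply HH].
  pose proof (HH u v x y) as H1. rewrite (Rabs_minus_sym u), (Rabs_minus_sym v) in H1. lra.
- intros x y _ _. apply Cmod_gt_0. apply eta_sep_nz; assumption.
- exists d. split; [exact Hd|]. intros s t.
  destruct (mod_2pi s) as [a Ha]. destruct (mod_2pi t) as [b Hb].
  rewrite <- (periodic2pi_Z (eta j) a s), <- (periodic2pi_Z (eta k) b t) by (eapply jc_per; eauto).
  apply Hdb; lra.
Qed.

(** The winding integral of the curve [k] is continuous at [eta j s], where it vanishes, and its
    only other value has modulus [2 * PI]; hence it vanishes nearby. Continuity comes from the
    Cauchy integral with density 1. *)
Lemma winding_other_curve_eventually j k s : (j < m)%nat -> (k < m)%nat -> j <> k ->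
  locally (eta j s) (fun z => (forall t, z <> eta k t) -> winding_integral (eta k) (eta' k) z = RtoC 0).
Proof.
intros Hj Hk Hjk. pose proof PI_RGT_0.
destruct (cauchy_off_curve_expansion (eta k) (eta' k) (HJ k Hk) (fun _ => RtoC 1) (fun t => eq_refl) (contC_const _) (eta j s)) as [l Hl].
{ intros t. apply eta_sep_nz; assumption. }
apply C_expansion_filterlim in Hl.
assert (Hone : forall z, RIntC (fun t => RtoC 1 * cauchy_kernel (eta k) (eta' k) z t)%C 0 (2 * PI) = winding_integral (eta k) (eta' k) z).
{ intros z. unfold winding_integral. f_equal. apply functional_extensionality. intros t. ring. }
pose proof (proj1 (filterlim_Cmod _ _ _) Hl (mkposreal _ H)) as HL.
revert HL. apply filter_imp. intros z Hz Hoff. rewrite !Hone, (Hnest j k s Hj Hk Hjk) in Hz. simpl in Hz.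
destruct (Hcw k z Hk Hoff) as [E|E]; [exact E|exfalso].
rewrite E in Hz. replace (- (RtoC (2 * PI) * Ci) - RtoC 0)%C with (- (RtoC (2 * PI) * Ci))%C in Hz by ring.
rewrite Cmod_opp, Cmod_mult, Ci_Cmod, Cmod_R, Rabs_pos_eq in Hz by lra. lra.
Qed.

Lemma off_all_curves z : ~ onGamma m eta z -> forall k t, (k < m)%nat -> z <> eta k t.
Proof. intros Hz k t Hk E. apply Hz. exists k, t. split; assumption. Qed.

Lemma regionG_winding j s : (j < m)%nat -> within (regionG m eta eta') (locally (eta j s))
  (fun z => (forall t, z <> eta j t) /\ winding_integral (eta j) (eta' j) z = RtoC 0).
Proof.
intros Hj. unfold within. apply filter_forall. intros z [Hz1 Hz2]. split.
- intros t. apply off_all_curves; assumption.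
- apply wind_eq_0. auto.
Qed.

(** Close to the curve [j] the other curves have winding integral 0. If the curve [j] did as well,
    the point would lie in [regionG]; so only [- 2 PI i] remains. *)
Lemma regionGm_winding j s : (j < m)%nat -> within (regionGm m eta eta') (locally (eta j s))
  (fun z => (forall t, z <> eta j t) /\ winding_integral (eta j) (eta' j) z = (- (RtoC (2 * PI) * Ci))%C).
Proof.
intros Hj. unfold within.
assert (Hall : locally (eta j s) (fun z => forall k, (k < m)%nat -> k <> j -> (forall t, z <> eta k t) -> winding_integral (eta k) (eta' k) z = RtoC 0)).
{ assert (Hn : forall n, (n <= m)%nat -> locally (eta j s) (fun z => forall k, (k < n)%nat -> k <> j -> (forall t, z <> eta k t) -> winding_integral (eta k) (eta' k) z = RtoC 0)).
  { induction n as [|n IH]; intros Hn.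
    - apply filter_forall. intros z k Hk. lia.
    - destruct (Nat.eq_dec n j) as [->|Hnj].
      + generalize (IH ltac:(lia)). apply filter_imp. intros z Hz k Hk Hkj. apply Hz; lia.
      + generalize (filter_and (F := locally (eta j s)) _ _ (IH ltac:(lia)) (winding_other_curve_eventually j n s Hj ltac:(lia) (not_eq_sym Hnj))).
        apply filter_imp. intros z [Hz1 Hz2] k Hk Hkj. destruct (Nat.eq_dec k n) as [->|Hkn]; [exact Hz2|apply Hz1; lia]. }
  apply Hn. lia. }
revert Hall. apply filter_imp. intros z Hz [Hoff HnG].
assert (Hoffj : forall k, (k < m)%nat -> forall t, z <> eta k t) by (intros k Hk t; apply off_all_curves; assumption).
split; [apply Hoffj, Hj|].
destruct (Hcw j z Hj (Hoffj j Hj)) as [E|E]; [exfalso|exact E].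
apply HnG. split; [exact Hoff|]. intros k Hk. apply wind_eq_0.
destruct (Nat.eq_dec k j) as [->|Hkj]; [exact E|]. apply Hz; auto.
Qed.

(** * Boundary values of the sum of Cauchy integrals over all curves *)

Section Density.
Context (phi : nat -> R -> C) (Hphi : forall k, (k < m)%nat -> exists K al, holder_periodic (phi k) K al).

Lemma phi_cont k t : (k < m)%nat -> contC (phi k) t.
Proof. intros Hk. destruct (Hphi k Hk) as [K [al H]]. eapply holder_periodic_cont; eauto. Qed.

Lemma phi_per k : (k < m)%nat -> periodic2pi (phi k).
Proof. intros Hk. destruct (Hphi k Hk) as [K [al H]]. apply H. Qed.

(** Only the curve through [eta j s] is singular there. If [R] is its regularized integral, then
    taking [R], [R - i PI phi] or [R - 2 PI i phi] for [P] gives the limit from [G], the principal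
    value, or the limit from [G^-]. *)
Definition boundary_term (j : nat) (s : R) (P : C) (k : nat) : C :=
  if Nat.eqb k j then P else cauchy_integral (phi k) (eta k) (eta' k) (eta j s).

(** On the curve itself [phi(t) = (phi(t) - phi(s)) + phi(s)], and the second part contributes
    [phi(s)] times the principal value [- i PI]. *)
Lemma improper_boundary_term j k s P : (j < m)%nat -> (k < m)%nat ->
  improper (regularized (phi j) (eta j) (eta' j) s) s (s + 2 * PI) P ->
  improper (fun t => phi k t * cauchy_kernel (eta k) (eta' k) (eta j s) t)%C s (s + 2 * PI)
    (boundary_term j s (P + phi j s * - (RtoC PI * Ci)) k).
Proof.
intros Hj Hk HP. pose proof PI_RGT_0. unfold boundary_term. destruct (Nat.eqb_spec k j) as [->|Hkj].
- destruct (jordan_curve_bounds _ _ (HJ j Hj)) as [L [c [d0 B]]].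
  pose proof (improper_cauchy_kernel _ _ L c d0 (HJ j Hj) B s (fun w Hw => Hcw j w Hj Hw)) as HK.
  pose proof (improper_plus _ _ _ _ _ _ HP (improper_Cmult (phi j s) _ _ _ _ HK)) as HI.
  eapply improper_ext; [|exact HI]. intros t _. unfold regularized. ring.
- assert (Hc : forall t, contC (fun t => phi k t * cauchy_kernel (eta k) (eta' k) (eta j s) t)%C t).
  { intros t. apply contC_mult; [apply phi_cont; exact Hk|].
    eapply contC_cauchy_kernel; [apply HJ; exact Hk|apply eta_sep_nz; auto]. }
  assert (Hp : periodic2pi (fun t => phi k t * cauchy_kernel (eta k) (eta' k) (eta j s) t)%C).
  { intros t. rewrite (phi_per k Hk), (cauchy_kernel_period _ _ (HJ k Hk)). reflexivity. }
  unfold cauchy_integral. rewrite <- (isI_unique _ _ _ _ (isI_periodic_shift _ s Hp Hc)).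
  apply improper_proper; [lra|auto].
Qed.

Lemma filterlim_boundary_term j k s P w0 (D : C -> Prop) : (j < m)%nat -> (k < m)%nat ->
  improper (regularized (phi j) (eta j) (eta' j) s) s (s + 2 * PI) P ->
  within D (locally (eta j s)) (fun z => (forall t, z <> eta j t) /\ winding_integral (eta j) (eta' j) z = w0) ->
  filterlim (cauchy_integral (phi k) (eta k) (eta' k)) (within D (locally (eta j s)))
    (locally (boundary_term j s (P + phi j s * w0) k)).
Proof.
intros Hj Hk HP Hw. unfold boundary_term. destruct (Nat.eqb_spec k j) as [->|Hkj].
- destruct (Hphi j Hj) as [K [al H]].
  eapply cauchy_boundary_limit; eauto; [apply within_filter, locally_filter|].
  intros Q. apply filter_le_within.
- apply (filterlim_filter_le_1 (F := locally (eta j s))); [intros Q; apply filter_le_within|].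
  destruct (cauchy_off_curve_expansion (eta k) (eta' k) (HJ k Hk) (phi k) (phi_per k Hk) (fun t => phi_cont k t Hk) (eta j s)) as [l Hl].
  + intros t. apply eta_sep_nz; auto.
  + exact (C_expansion_filterlim _ _ _ Hl).
Qed.

Lemma regularized_choice j : (j < m)%nat -> exists P : R -> C,
  forall s, improper (regularized (phi j) (eta j) (eta' j) s) s (s + 2 * PI) (P s).
Proof.
intros Hj. destruct (Hphi j Hj) as [K [al H]].
destruct (jordan_curve_bounds _ _ (HJ j Hj)) as [L [c [d0 B]]].
destruct (regularized_exists _ _ _ _ _ _ _ _ (HJ j Hj) B H) as [M [_ HM]].
exists (fun s => epsilon (inhabits (RtoC 0)) (improper (regularized (phi j) (eta j) (eta' j) s) s (s + 2 * PI))).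
intros s. apply epsilon_spec. destruct (HM s) as [l [Hl _]]. exists l. exact Hl.
Qed.

(** The source of [h] being in [H]: the regularized value is Hoelder with half the exponent of
    [phi j], and the other curves contribute Lipschitz functions of [s]. *)
Lemma loc_holder_boundary_sum j P w0 : (j < m)%nat ->
  (forall s, improper (regularized (phi j) (eta j) (eta' j) s) s (s + 2 * PI) (P s)) ->
  exists b, 0 < b <= 1 /\ loc_holder (fun s => sumC m (boundary_term j s (P s + phi j s * w0))) b.
Proof.
intros Hj HP. destruct (Hphi j Hj) as [K [al H]]. pose proof (hp_al _ _ _ H) as Hal. pose proof (hp_K _ _ _ H) as HK0.
pose proof PI2_3_2 as HPI; unfold PI2 in HPI.
destruct (jordan_curve_bounds _ _ (HJ j Hj)) as [L [c [d0 B]]].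
exists (al / 2). split; [lra|]. apply loc_holder_sumC. intros k Hk.
unfold boundary_term. destruct (Nat.eqb_spec k j) as [->|Hkj].
- apply loc_holder_plus.
  + destruct (regularized_exists _ _ _ _ _ _ _ _ (HJ j Hj) B H) as [M [HM0 HM]].
    destruct (regularized_holder _ _ _ _ _ _ _ _ (HJ j Hj) B H (fun w Hw => Hcw j w Hj Hw)) as [M' [r [HM0' [Hr HM']]]].
    exists (M + M'), r. split; [lra|]. split; [exact Hr|]. split.
    * intros s. destruct (HM s) as [l [Hl1 Hl2]].
      assert (Hss : s < s + 2 * PI) by lra. rewrite (improper_unique _ _ _ _ _ Hss (HP s) Hl1). lra.
    * intros s t Hst Hd. pose proof (Rpower_pos (Rabs (s - t)) (al / 2)).
      eapply Rle_trans; [exact (HM' s t _ _ Hst Hd (HP s) (HP t))|]. apply Rmult_le_compat_r; lra.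
  + apply loc_holder_mult; [|apply loc_holder_const]. apply loc_holder_weaken with al; [lra|].
    destruct (periodic_contC_bounded (phi j) (phi_per j Hj) (fun t => phi_cont j t Hj)) as [M [HM HMb]].
    exists (M + K), 1. split; [lra|]. split; [lra|]. split; [intros s; specialize (HMb s); lra|].
    intros s t Hst Hd. pose proof (Rpower_pos (Rabs (s - t)) al).
    eapply Rle_trans; [apply (holder_periodic_le _ _ _ _ _ H); [auto|lra]|]. apply Rmult_le_compat_r; lra.
- destruct (eta_dist j k Hj Hk ltac:(auto)) as [d [Hd Hdb]].
  destruct (cauchy_off_curve_lipschitz (eta k) (eta' k) (HJ k Hk) (phi k) (phi_per k Hk) (fun t => phi_cont k t Hk) d Hd) as [M [HM HMb]].
  apply loc_holder_lipschitz with (L := M * L) (B := M); [lra| |].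
  + intros s. apply (HMb (eta j s) (eta j s)); intros t; apply Hdb.
  + intros s t. eapply Rle_trans; [apply (HMb (eta j s) (eta j t)); intros x; apply Hdb|].
    rewrite Rmult_assoc. apply Rmult_le_compat_l; [exact HM|]. apply (cb_lip _ _ _ _ _ B).
Qed.

End Density.

(** * The operators [Mop] and [Nop] as real and imaginary part of one principal value *)

Section Operators.
Context (A : nat -> R -> C).

Lemma operators_improper u j s V :
  (forall k, (k < m)%nat -> improper (fun t => (RtoC (u k t) / A k t) * cauchy_kernel (eta k) (eta' k) (eta j s) t)%C s (s + 2 * PI) (V k)) ->
  Mop m A eta eta' u j s = fst (RtoC (/ PI) * A j s * sumC m V)%C /\
  Nop m A eta eta' u j s = snd (RtoC (/ PI) * A j s * sumC m V)%C.
Proof.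
intros HV.
assert (HF : forall k, (k < m)%nat -> improper (fun t => kernelMN A eta eta' j s k t * RtoC (u k t))%C s (s + 2 * PI) (RtoC (/ PI) * A j s * V k)%C).
{ intros k Hk. eapply improper_ext; [|exact (improper_Cmult (RtoC (/ PI) * A j s)%C _ _ _ _ (HV k Hk))].
  intros t _. unfold kernelMN, cauchy_kernel, Cdiv. ring. }
rewrite <- sumC_scal, <- sumR_fst, <- sumR_snd.
split; apply sumR_ext; intros k Hk.
- eapply PVint_fst; [|exact (HF k Hk)]. intros t. unfold Mker. simpl. ring.
- eapply PVint_snd; [|exact (HF k Hk)]. intros t. unfold Nker. simpl. ring.
Qed.

(** [inH] asks for periodicity on the whole line, whereas the integral equation is given on one
    period; periodicity of [h] is therefore read off the operators themselves. *)
Lemma operators_periodic (HA : forall k, (k < m)%nat -> periodic2pi (A k)) u j s : (j < m)%nat ->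
  (forall k, (k < m)%nat -> periodic2pi (u k)) ->
  Mop m A eta eta' u j (s + 2 * PI) = Mop m A eta eta' u j s /\
  Nop m A eta eta' u j (s + 2 * PI) = Nop m A eta eta' u j s.
Proof.
intros Hj Hu. split; apply sumR_ext; intros k Hk; unfold Mker, Nker, kernelMN;
  rewrite (HA j Hj), (jc_per _ _ (HJ j Hj)); apply PVint_periodic; intros t;
  rewrite (HA k Hk), (jc_per _ _ (HJ k Hk)), (jc_per' _ _ (HJ k Hk)), (Hu k Hk); reflexivity.
Qed.

End Operators.

End MultiplyConnected.

(** The function [a] is Lipschitz by the mean value estimate and, by periodicity, bounded away from
    0, so [1 / a] is as regular as [u]. *)
Lemma holder_quotient u a a' : Holder_on_J u -> periodic2pi u -> periodic2pi a ->
  (forall t, derC a t (a' t)) -> (forall t, contC a' t) -> (forall t, a t <> RtoC 0) ->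
  exists b, 0 < b <= 1 /\ loc_holder (fun t => RtoC (u t) / a t)%C b.
Proof.
intros Hu Hup Ha Hda Hca Hnz.
destruct (Holder_on_J_loc_holder u Hu Hup) as [b [Hb Hul]].
exists b. split; [exact Hb|]. apply loc_holder_mult; [exact Hul|].
destruct (periodic_contC_lower_bound a Ha (fun t => derC_cont _ _ _ (Hda t)) Hnz) as [m0 [Hm0 Hmb]].
apply loc_holder_inv with m0; auto.
destruct (periodic_contC_bounded a Ha (fun t => derC_cont _ _ _ (Hda t))) as [B [HB HBb]].
destruct (periodic_contC_bounded a' (derC_periodic _ _ Ha Hda) Hca) as [L [HL HLb]].
apply loc_holder_lipschitz with (L := L) (B := B); auto; [lra|].
intros s t. apply derC_mean_value with a'; auto.
Qed.

Lemma boundary_term_sum_shift m eta eta' phi j s P a : (j < m)%nat ->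
  sumC m (boundary_term eta eta' phi j s (P + a)) = (sumC m (boundary_term eta eta' phi j s P) + a)%C.
Proof.
intros Hj. rewrite <- (sumC_update m j a _ Hj). apply sumC_ext. intros k _.
unfold boundary_term. destruct (Nat.eqb k j); reflexivity.
Qed.

(** Isolates the factor [1 / PI] of the kernels; the remaining [- i / 2] exchanges real and
    imaginary parts and brings in the one half of [h]. *)
Lemma Cinv_2PI_Ci : (/ (RtoC (2 * PI) * Ci))%C = (RtoC (/ PI) * (RtoC (- / 2) * Ci))%C.
Proof.
pose proof PI_RGT_0. apply injective_projections; simpl; field; lra.
Qed.

Theorem theorem3p4
  (m : nat) (eta eta' : nat -> R -> C) (A : nat -> R -> C) (gam mu : nat -> R -> R)
  (* connectivity m >= 1 *)
  (hm : (1 <= m)%nat)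
  (* each eta_k is 2pi-periodic, C^2, with nonvanishing derivative eta'_k *)
  (heta_per : forall k, (k < m)%nat -> periodic2pi (eta k))
  (heta_der : forall k t, (k < m)%nat -> derC (eta k) t (eta' k t))
  (heta_C2 : forall k, (k < m)%nat -> exists eta'' : R -> C,
      (forall t, derC (eta' k) t (eta'' t)) /\
      (forall t, filterlim eta'' (locally t) (locally (eta'' t))))
  (heta'_nz : forall k t, (k < m)%nat -> eta' k t <> RtoC 0)
  (* each Gamma_k is a simple closed curve *)
  (hsimple : forall k s t, (k < m)%nat -> 0 <= s < 2 * PI -> 0 <= t < 2 * PI ->
      eta k s = eta k t -> s = t)
  (* the curves are non-intersecting *)
  (hdisj : forall j k s t, (j < m)%nat -> (k < m)%nat -> j <> k -> eta j s <> eta k t)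
  (* clockwise orientation: eta_k winds -1 times around its interior, 0 times around its exterior *)
  (hcw : forall k z, (k < m)%nat -> (forall t, z <> eta k t) ->
      wind eta eta' k z = RtoC 0 \/ wind eta eta' k z = RtoC (-1))
  (* the curves are not nested (G is the unbounded region bounded by all of Gamma) *)
  (hnest : forall j k t, (j < m)%nat -> (k < m)%nat -> j <> k ->
      wind eta eta' k (eta j t) = RtoC 0)
  (* 0 lies in G *)
  (h0 : regionG m eta eta' (RtoC 0))
  (* A : nonvanishing, with continuously differentiable parametric form *)
  (hA_per : forall k, (k < m)%nat -> periodic2pi (A k))
  (hA_C1 : forall k, (k < m)%nat -> exists A' : R -> C,
      (forall t, derC (A k) t (A' t)) /\
      (forall t, filterlim A' (locally t) (locally (A' t))))
  (hA_nz : forall k t, (k < m)%nat -> A k t <> RtoC 0)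
  (* gamma in H, mu in H solves  mu - N mu = - M gamma *)
  (hgam : inH m gam)
  (hmu : inH m mu)
  (heq : forall j s, (j < m)%nat -> 0 <= s <= 2 * PI ->
      mu j s - Nop m A eta eta' mu j s = - Mop m A eta eta' gam j s) :
  let h := fun j s => / 2 * (Mop m A eta eta' mu j s - (gam j s - Nop m A eta eta' gam j s)) in
  (forall j s, (j < m)%nat -> 0 <= s <= 2 * PI ->
     exists fplus : C,
       filterlim (Phi m A eta eta' gam mu)
         (within (regionG m eta eta') (locally (eta j s))) (locally fplus) /\
       Cmult (A j s) fplus = Cplus (RtoC (gam j s + h j s)) (Cmult Ci (RtoC (mu j s))))
  /\ inSminus m A eta eta' h.
Proof.
set (phi := fun k t => ((RtoC (gam k t) + Ci * RtoC (mu k t)) / A k t)%C).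
(* The operators act on real functions, so the density is split into the quotients of [gam] and [mu]
   by [A]. *)
set (phig := fun k t => (RtoC (gam k t) / A k t)%C).
set (phim := fun k t => (RtoC (mu k t) / A k t)%C).
pose proof PI_RGT_0 as HPI.
assert (HJ : forall k, (k < m)%nat -> jordan_curve (eta k) (eta' k)).
{ intros k Hk. constructor; auto.
  - intros s t. exact (hsimple k s t Hk). }
assert (Hcw : forall k z, (k < m)%nat -> (forall t, z <> eta k t) ->
  winding_integral (eta k) (eta' k) z = RtoC 0 \/ winding_integral (eta k) (eta' k) z = (- (RtoC (2 * PI) * Ci))%C).
{ intros k z Hk Hz. destruct (hcw k z Hk Hz) as [E|E]; [left; apply (proj1 (wind_eq_0 eta eta' k z)); exact E|right].
  change (/ (RtoC (2 * PI) * Ci) * winding_integral (eta k) (eta' k) z = RtoC (-1))%C in E.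
  replace (winding_integral (eta k) (eta' k) z) with ((RtoC (2 * PI) * Ci) * (/ (RtoC (2 * PI) * Ci) * winding_integral (eta k) (eta' k) z))%C.
  - rewrite E. apply injective_projections; simpl; ring.
  - rewrite Cmult_assoc, Cinv_r by apply PI_Ci_nz. ring. }
assert (Hnest : forall j k t, (j < m)%nat -> (k < m)%nat -> j <> k -> winding_integral (eta k) (eta' k) (eta j t) = RtoC 0).
{ intros j k t Hj Hk Hjk. apply (proj1 (wind_eq_0 eta eta' k (eta j t))). apply hnest; assumption. }
assert (Hquot : forall u k, inH m u -> (k < m)%nat -> exists b, 0 < b <= 1 /\ loc_holder (fun t => RtoC (u k t) / A k t)%C b).
{ intros u k Hu Hk. destruct (hA_C1 k Hk) as [A' [HA1 HA2]]. destruct (Hu k Hk) as [Hu1 Hu2].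
  apply holder_quotient with A'; auto. }
assert (Hquotper : forall u k, inH m u -> (k < m)%nat -> periodic2pi (fun t => RtoC (u k t) / A k t)%C).
{ intros u k Hu Hk t. rewrite (proj2 (Hu k Hk)), (hA_per k Hk). reflexivity. }
assert (Hphig : forall k, (k < m)%nat -> exists K al, holder_periodic (phig k) K al).
{ intros k Hk. destruct (Hquot gam k hgam Hk) as [b [Hb Hl]].
  destruct (loc_holder_periodic _ b (Hquotper gam k hgam Hk) Hb Hl) as [K HK]. exists K, b. exact HK. }
assert (Hphim : forall k, (k < m)%nat -> exists K al, holder_periodic (phim k) K al).
{ intros k Hk. destruct (Hquot mu k hmu Hk) as [b [Hb Hl]].
  destruct (loc_holder_periodic _ b (Hquotper mu k hmu Hk) Hb Hl) as [K HK]. exists K, b. exact HK. }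
assert (Hsplit : forall k t, phi k t = (phig k t + Ci * phim k t)%C).
{ intros k t. unfold phi, phig, phim, Cdiv. ring. }
assert (Hphi : forall k, (k < m)%nat -> exists K al, holder_periodic (phi k) K al).
{ intros k Hk. destruct (Hquot gam k hgam Hk) as [b [Hb Hl]]. destruct (Hquot mu k hmu Hk) as [b' [Hb' Hl']].
  assert (Hmin : 0 < Rmin b b' <= 1) by (split; [apply Rmin_pos; lra|pose proof (Rmin_l b b'); lra]).
  assert (HL : loc_holder (phi k) (Rmin b b')).
  { replace (phi k) with (fun t => phig k t + Ci * phim k t)%C by (apply functional_extensionality; intros t; symmetry; apply Hsplit).
    apply loc_holder_plus; [|apply loc_holder_mult; [apply loc_holder_const|]].
    - apply loc_holder_weaken with b; [apply Rmin_l|exact Hl].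
    - apply loc_holder_weaken with b'; [apply Rmin_r|exact Hl']. }
  assert (Hp : periodic2pi (phi k)).
  { intros t. rewrite !Hsplit. unfold phig, phim. rewrite (Hquotper gam k hgam Hk t), (Hquotper mu k hmu Hk t). reflexivity. }
  destruct (loc_holder_periodic _ _ Hp Hmin HL) as [K HK]. exists K, (Rmin b b'). exact HK. }
set (bt := boundary_term eta eta' phi).
assert (Halg : forall j s P, (j < m)%nat -> 0 <= s <= 2 * PI ->
  improper (regularized (phi j) (eta j) (eta' j) s) s (s + 2 * PI) P ->
  let h := / 2 * (Mop m A eta eta' mu j s - (gam j s - Nop m A eta eta' gam j s)) in
  (A j s * (/ (RtoC (2 * PI) * Ci) * sumC m (bt j s (P + phi j s * RtoC 0))) = RtoC (gam j s + h) + Ci * RtoC (mu j s))%C /\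
  (A j s * (/ (RtoC (2 * PI) * Ci) * sumC m (bt j s (P + phi j s * - (RtoC (2 * PI) * Ci)))) = RtoC h)%C).
{ intros j s P Hj Hs HP h.
  destruct (regularized_choice m eta eta' HJ phig Hphig j Hj) as [Pg HPg].
  destruct (regularized_choice m eta eta' HJ phim Hphim j Hj) as [Pm HPm].
  set (T := sumC m (bt j s (P + phi j s * - (RtoC PI * Ci))%C)).
  set (Vg := boundary_term eta eta' phig j s (Pg s + phig j s * - (RtoC PI * Ci))).
  set (Vm := boundary_term eta eta' phim j s (Pm s + phim j s * - (RtoC PI * Ci))).
  assert (HVg : forall k, (k < m)%nat -> improper (fun t => phig k t * cauchy_kernel (eta k) (eta' k) (eta j s) t)%C s (s + 2 * PI) (Vg k)).
  { intros k Hk. apply (improper_boundary_term m eta eta' HJ hdisj Hcw phig Hphig j k s (Pg s) Hj Hk (HPg s)). }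
  assert (HVm : forall k, (k < m)%nat -> improper (fun t => phim k t * cauchy_kernel (eta k) (eta' k) (eta j s) t)%C s (s + 2 * PI) (Vm k)).
  { intros k Hk. apply (improper_boundary_term m eta eta' HJ hdisj Hcw phim Hphim j k s (Pm s) Hj Hk (HPm s)). }
  (* Principal values add up, by uniqueness; the regularized values [P], [Pg] and [Pm] never have to
     be compared. *)
  assert (HT : T = (sumC m Vg + Ci * sumC m Vm)%C).
  { rewrite <- sumC_scal, <- sumC_plus. apply sumC_ext. intros k Hk.
    assert (Hss : s < s + 2 * PI) by lra.
    apply (improper_unique _ _ _ _ _ Hss (improper_boundary_term m eta eta' HJ hdisj Hcw phi Hphi j k s P Hj Hk HP)).
    eapply improper_ext; [|exact (improper_plus _ _ _ _ _ _ (HVg k Hk) (improper_Cmult Ci _ _ _ _ (HVm k Hk)))].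
    intros t _. simpl. rewrite Hsplit. ring. }
  destruct (operators_improper m eta eta' A gam j s Vg HVg) as [HMg HNg].
  destruct (operators_improper m eta eta' A mu j s Vm HVm) as [HMm HNm].
  pose proof (heq j s Hj Hs) as He. rewrite HMg, HNm in He. unfold h. rewrite HMm, HNg.
  (* [X] is [M gam + i N gam] and [Y] is [M mu + i N mu] at [s]. *)
  set (X := (RtoC (/ PI) * A j s * sumC m Vg)%C) in *.
  set (Y := (RtoC (/ PI) * A j s * sumC m Vm)%C) in *.
  assert (HX : (RtoC (/ PI) * A j s * T)%C = (X + Ci * Y)%C) by (rewrite HT; unfold X, Y; ring).
  assert (HA : (A j s * phi j s)%C = (RtoC (gam j s) + Ci * RtoC (mu j s))%C).
  { unfold phi. field. apply hA_nz. exact Hj. }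
  assert (HPi : (RtoC (/ PI) * RtoC PI)%C = RtoC 1) by (rewrite <- RtoC_mult; f_equal; field; lra).
  (* The Plemelj formulas with the principal value as reference: [a = 1] is the side of [G],
     [a = -1] that of [G^-]. The result is [- i / 2 (X + i Y) + a / 2 (gam + i mu)]. *)
  assert (Hsh : forall a, (A j s * (/ (RtoC (2 * PI) * Ci) * sumC m (bt j s (P + phi j s * (- (RtoC PI * Ci) + a * (RtoC PI * Ci))))))%C
    = (RtoC (- / 2) * Ci * (X + Ci * Y) + RtoC (- / 2) * (Ci * Ci) * a * (RtoC (gam j s) + Ci * RtoC (mu j s)))%C).
  { intros a. replace (P + phi j s * (- (RtoC PI * Ci) + a * (RtoC PI * Ci)))%C with ((P + phi j s * - (RtoC PI * Ci)) + phi j s * (a * (RtoC PI * Ci)))%C by ring.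
    unfold bt. rewrite boundary_term_sum_shift by exact Hj. fold bt. fold T. rewrite Cinv_2PI_Ci, <- HX, <- HA.
    replace (A j s * (RtoC (/ PI) * (RtoC (- / 2) * Ci) * (T + phi j s * (a * (RtoC PI * Ci)))))%C with
      (RtoC (- / 2) * Ci * (RtoC (/ PI) * A j s * T) + (RtoC (/ PI) * RtoC PI) * (RtoC (- / 2) * (Ci * Ci) * a * (A j s * phi j s)))%C by ring.
    rewrite HPi. ring. }
  clearbody X Y.
  split.
  (* The real part of [- i / 2 (X + i Y)] is [(M mu + N gam) / 2 = h + gam / 2]; its imaginary part
     [(N mu - M gam) / 2] equals [mu / 2] by the integral equation. Adding or subtracting
     [(gam + i mu) / 2] gives the two claims. *)
  - replace (phi j s * RtoC 0)%C with (phi j s * (- (RtoC PI * Ci) + RtoC 1 * (RtoC PI * Ci)))%C by ring.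
    rewrite Hsh. apply injective_projections; simpl; lra.
  - replace (phi j s * - (RtoC (2 * PI) * Ci))%C with (phi j s * (- (RtoC PI * Ci) + RtoC (-1) * (RtoC PI * Ci)))%C
      by (f_equal; apply injective_projections; simpl; ring).
    rewrite Hsh. apply injective_projections; simpl; lra. }
assert (Hlim : forall (D : C -> Prop) j s P w0, (j < m)%nat ->
  improper (regularized (phi j) (eta j) (eta' j) s) s (s + 2 * PI) P ->
  within D (locally (eta j s)) (fun z => (forall t, z <> eta j t) /\ winding_integral (eta j) (eta' j) z = w0) ->
  filterlim (Phi m A eta eta' gam mu) (within D (locally (eta j s)))
    (locally (/ (RtoC (2 * PI) * Ci) * sumC m (bt j s (P + phi j s * w0)))%C)).
{ intros D j s P w0 Hj HP Hw.
  assert (HF : Filter (within D (locally (eta j s)))) by apply within_filter, locally_filter.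
  apply filterlim_Cmult; [exact HF|apply filterlim_const|].
  apply (filterlim_sumC _ m (fun k => cauchy_integral (phi k) (eta k) (eta' k))).
  intros k Hk. apply (filterlim_boundary_term m eta eta' HJ hdisj Hcw phi Hphi j k s P w0 D Hj Hk HP Hw). }
intros h. split; [|split].
- intros j s Hj Hs. destruct (regularized_choice m eta eta' HJ phi Hphi j Hj) as [P HP].
  exists (/ (RtoC (2 * PI) * Ci) * sumC m (bt j s (P s + phi j s * RtoC 0)))%C. split.
  + apply Hlim; [exact Hj|apply HP|]. apply regionG_winding. exact Hj.
  + exact (proj1 (Halg j s (P s) Hj Hs (HP s))).
(* On one period [h] is [A] times the boundary value from [G^-], which is Hoelder by
   [loc_holder_boundary_sum]. *)
- intros j Hj. split.
  + destruct (regularized_choice m eta eta' HJ phi Hphi j Hj) as [P HP].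
    destruct (loc_holder_boundary_sum m eta eta' HJ hdisj Hcw phi Hphi j P (- (RtoC (2 * PI) * Ci))%C Hj HP) as [b [Hb Hl]].
    assert (HLA : loc_holder (A j) b).
    { destruct (hA_C1 j Hj) as [A' [HA1 HA2]].
      destruct (periodic_contC_bounded (A j) (hA_per j Hj) (fun t => derC_cont _ _ _ (HA1 t))) as [B [_ HB]].
      destruct (periodic_contC_bounded A' (derC_periodic _ _ (hA_per j Hj) HA1) HA2) as [L [_ HL]].
      apply loc_holder_lipschitz with (L := L) (B := B); auto; [lra|].
      intros s t. apply derC_mean_value with A'; auto. }
    pose proof (loc_holder_mult _ _ _ HLA (loc_holder_mult _ _ _ (loc_holder_const (/ (RtoC (2 * PI) * Ci))%C b) Hl)) as HLh.
    destruct (loc_holder_global _ b HLh ltac:(lra)) as [K [HK HKb]].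
    exists b, K. split; [exact Hb|]. split; [exact HK|]. intros s t Hs Ht.
    destruct (Req_dec s t) as [->|Hst].
    * rewrite Rminus_diag, Rabs_R0. apply Rmult_le_pos; [exact HK|left; apply Rpower_pos].
    * rewrite <- Cmod_R, RtoC_minus. unfold h.
      rewrite <- (proj2 (Halg j s (P s) Hj Hs (HP s))), <- (proj2 (Halg j t (P t) Hj Ht (HP t))).
      apply HKb. exact Hst.
  + intros s. unfold h.
    destruct (operators_periodic m eta eta' HJ A hA_per mu j s Hj (fun k Hk => proj2 (hmu k Hk))) as [E1 _].
    destruct (operators_periodic m eta eta' HJ A hA_per gam j s Hj (fun k Hk => proj2 (hgam k Hk))) as [_ E2].
    rewrite E1, E2, (proj2 (hgam j Hj)). reflexivity.
(* The analytic function is [Phi] itself; that [A Phi^-] equals the real function [h] is the second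
   half of [Halg]. *)
- exists (Phi m A eta eta' gam mu). split.
  + intros z [Hz _].
    assert (Hoff : forall k t, (k < m)%nat -> (eta k t - z)%C <> RtoC 0).
    { intros k t Hk E. apply (off_all_curves m eta z Hz k t Hk). rewrite <- (Cplus_0_r z), <- E. ring. }
    destruct (C_expansion_sumC m (fun k => cauchy_integral (phi k) (eta k) (eta' k)) z) as [l Hl].
    { intros k Hk. apply (cauchy_off_curve_expansion _ _ (HJ k Hk) (phi k)); auto.
      - apply (phi_per m phi Hphi k Hk).
      - intros t. apply (phi_cont m phi Hphi k t Hk). }
    exact (C_expansion_ex_derive _ _ _ (C_expansion_scal (/ (RtoC (2 * PI) * Ci))%C _ _ _ Hl)).
  + intros j s Hj Hs. destruct (regularized_choice m eta eta' HJ phi Hphi j Hj) as [P HP].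
    exists (/ (RtoC (2 * PI) * Ci) * sumC m (bt j s (P s + phi j s * - (RtoC (2 * PI) * Ci))))%C. split.
    * apply Hlim; [exact Hj|apply HP|].
      apply (regionGm_winding m eta eta' HJ hdisj Hcw Hnest). exact Hj.
    * symmetry. exact (proj2 (Halg j s (P s) Hj Hs (HP s))).
Qed.
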